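(* Let $\Gamma\subset\mathbb{R}^3$ be a smooth, closed, bounded surface with reach $\tau_\Gamma>0$, let $0<\varepsilon<\tau_\Gamma$, and let $\bar{\mathbf{x}}^*=(x^*,y^*,z^* )\in\Gamma$. Suppose that the outward unit normal $\bar{\mathbf{n}}$ to $\Gamma$ at $\bar{\mathbf{x}}^*$ satisfies $\bar{\mathbf{n}}^T\bar{\mathbf{e}}_z\neq 0$, where $\bar{\mathbf{e}}_z=(0,0,1)^T$. Let $z\in\mathbb{R}$ be such that $\bar{\mathbf{y}}_0(z)\in T_\varepsilon$ and $P_\Gamma(\bar{\mathbf{y}}_0(z))=\bar{\mathbf{x}}^*$. Then there is an $r>0$, depending on $z$, such that each of the functions $s^{SL}(\cdot;z)$, $s^{DLC}(\cdot;z)$, $s^{DL}(\cdot;z)$ defined in the context can be written in the form $$s^{X}(\mathbf{y};z)=\frac{1}{|\mathbf{y}|}\,\ell^X\!\left(|\mathbf{y}|,\frac{\mathbf{y}}{|\mathbf{y}|};z\right),\qquad \mathbf{y}\in\mathbb{R}^2,\ 0<|\mathbf{y}|<r,\qquad X\in\{SL, DLC, DL\},$$ where $\ell^X(\cdot,\cdot;z)\in C^\infty((-r,r)\times\mathbb{S}^1)$. Moreover, in the expansion $$s^X(\mathbf{y};z)=s_0^X(\mathbf{y};z)+s_1^X(\mathbf{y};z)+O(|\mathbf{y}|)\quad(\mathbf{y}\to 0),\qquad s_0^X(\mathbf{y};z)=\frac{1}{|\mathbf{y}|}\ell^X(0,\hat{\mathbf{y}};z),\quad s_1^X(\mathbf{y};z)=\partial_r\ell^X(0,\hat{\mathbf{y}};z),$$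 with $\hat{\mathbf{y}}=\mathbf{y}/|\mathbf{y}|$ and $\partial_r$ the derivative in the first argument, the terms are given by $$s_0^{SL}(\mathbf{y};z)=\frac{1}{4\pi}\frac{1}{|\mathbf{y}|}\frac{1}{\psi_0(\hat{\mathbf{y}})},\qquad s_1^{SL}(\mathbf{y};z)=-\frac{1}{4\pi}\frac{\psi_1(\hat{\mathbf{y}})}{\psi_0(\hat{\mathbf{y}})^2},$$ $$s_0^{DLC}(\mathbf{y};z)=\frac{1}{4\pi}\frac{1}{|\mathbf{y}|}\frac{\xi_0(\hat{\mathbf{y}})}{\psi_0(\hat{\mathbf{y}})^3},\qquad s_1^{DLC}(\mathbf{y};z)=\frac{1}{4\pi}\left(-3\frac{\xi_0(\hat{\mathbf{y}})\psi_1(\hat{\mathbf{y}})}{\psi_0(\hat{\mathbf{y}})^4}+\frac{\xi_1(\hat{\mathbf{y}})}{\psi_0(\hat{\mathbf{y}})^3}\right),$$ $$s_0^{DL}(\mathbf{y};z)=s_0^{DLC}(\mathbf{y};z),\qquad s_1^{DL}(\mathbf{y};z)=\frac{1}{4\pi}\left(-3\frac{\xi_0(\hat{\mathbf{y}})\psi_1(\hat{\mathbf{y}})}{\psi_0(\hat{\mathbf{y}})^4}+\frac{\tilde\xi_1(\hat{\mathbf{y}})}{\psi_0(\hat{\mathbf{y}})^3}\right),$$ where $\psi_0,\psi_1,\xi_0,\xi_1,\tilde\xi_1$ (which depend on $z$ through $\eta$) are the functions defined explicitly in the context.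
   Context: Vectors in $\mathbb{R}^2$ are written $\mathbf{y}$, vectors in $\mathbb{R}^3$ are written $\bar{\mathbf{y}}$; for $\mathbf{y}\in\mathbb{R}^2$, $z\in\mathbb{R}$, $(\mathbf{y},z)$ denotes the corresponding vector in $\mathbb{R}^3$. Distance and projection. $\Gamma$ bounds a bounded region $\Omega$; $d_\Gamma$ is the signed distance to $\Gamma$, negative inside $\Omega$. $P_\Gamma$ maps a point to its closest point on $\Gamma$. With $\mathcal{C}_\Gamma$ the set of points of $\mathbb{R}^3$ having non-unique closest points on $\Gamma$, the reach is $\tau_\Gamma=\inf_{\bar{\mathbf{x}}\in\Gamma,\bar{\mathbf{y}}\in\mathcal{C}_\Gamma}|\bar{\mathbf{x}}-\bar{\mathbf{y}}|$. $T_\varepsilon=\{\bar{\mathbf{x}}\in\mathbb{R}^3: |d_\Gamma(\bar{\mathbf{x}})|\le\varepsilon\}$. Normal line. $\bar{\mathbf{y}}_0(z)=\bar{\mathbf{x}}^*+\frac{z-z^*}{\bar{\mathbf{n}}^T\bar{\mathbf{e}}_z}\,\bar{\mathbf{n}}$, the point of height $z$ on the normal line through $\bar{\mathbf{x}}^*$; write $\bar{\mathbf{y}}_0(z)=(\mathbf{y}_0(z),z)$. Put $\eta=\eta(z)=d_\Gamma(\bar{\mathbf{y}}_0(z))$. Singular functions. With $\bar{\mathbf{p}}=P_\Gamma(\mathbf{y}+\mathbf{y}_0(z),z)$, $\bar{\mathbf{n}}_x=\bar{\mathbf{n}}$ the outward unit normal at $\bar{\mathbf{x}}^*$ and $\bar{\mathbf{n}}_y$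 the outward unit normal to $\Gamma$ at $\bar{\mathbf{p}}$, $$s^{SL}(\mathbf{y};z)=\frac{1}{4\pi}\frac{1}{|\bar{\mathbf{p}}-\bar{\mathbf{x}}^*|},\quad s^{DL}(\mathbf{y};z)=-\frac{1}{4\pi}\frac{\bar{\mathbf{n}}_y^T(\bar{\mathbf{p}}-\bar{\mathbf{x}}^* )}{|\bar{\mathbf{p}}-\bar{\mathbf{x}}^*|^3},\quad s^{DLC}(\mathbf{y};z)=\frac{1}{4\pi}\frac{\bar{\mathbf{n}}_x^T(\bar{\mathbf{p}}-\bar{\mathbf{x}}^* )}{|\bar{\mathbf{p}}-\bar{\mathbf{x}}^*|^3}.$$ Local representation of $\Gamma$. Let $\bar{\boldsymbol{\tau}}_1,\bar{\boldsymbol{\tau}}_2$ be orthonormal principal directions of $\Gamma$ at $\bar{\mathbf{x}}^*$ and let $Q$ be the orthogonal matrix with columns $\bar{\boldsymbol{\tau}}_1,\bar{\boldsymbol{\tau}}_2,\bar{\mathbf{n}}$. Near $\bar{\mathbf{x}}^*$, $\Gamma$ is the set of points $\bar{\mathbf{x}}^*+Q(\mathbf{y}',f(\mathbf{y}'))^T$ with $f$ smooth in a neighborhood of $0\in\mathbb{R}^2$, $f(0)=0$, $\nabla f(0)=0$, and Hessian $M:=\nabla^2 f(0)=\mathrm{diag}(\kappa_1,\kappa_2)$ (this fixes the sign convention for the principal curvatures $\kappa_1,\kappa_2$). With $f_{xxx},f_{xxy},f_{xyy},f_{yyy}$ the third derivatives of $f$ at $0$, for $\mathbf{w}=(x,y)$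 set $$B(\mathbf{w},\mathbf{w},\mathbf{w})=\tfrac12\left[f_{xxx}\tfrac{x^3}{3}+f_{yyy}\tfrac{y^3}{3}+f_{xxy}x^2y+f_{xyy}xy^2\right],\qquad C(\mathbf{w},\mathbf{w})=\tfrac12\begin{pmatrix}f_{xxx}x^2+2f_{xxy}xy+f_{xyy}y^2\\ f_{yyy}y^2+2f_{xyy}xy+f_{xxy}x^2\end{pmatrix}.$$ Write $Q^T=\begin{pmatrix}A&\mathbf{c}\\ \mathbf{d}^T&\alpha\end{pmatrix}$ with $A\in\mathbb{R}^{2\times2}$, $\mathbf{c},\mathbf{d}\in\mathbb{R}^{2}$ (column vectors), $\alpha\in\mathbb{R}$. Let $D_0=(I-\eta M)^{-1}$. Explicit functions of $\mathbf{y}\in\mathbb{R}^2$. Abbreviating $C=C(D_0A\mathbf{y},D_0A\mathbf{y})$ and $B=B(D_0A\mathbf{y},D_0A\mathbf{y},D_0A\mathbf{y})$, $$\chi_0(\mathbf{y})=D_0A\mathbf{y},\qquad \chi_1(\mathbf{y})=(\mathbf{d}^T\mathbf{y})D_0D_0MA\mathbf{y}+\eta D_0C,$$ $$\psi_0(\mathbf{y})=|\chi_0(\mathbf{y})|,\qquad \psi_1(\mathbf{y})=\frac{\chi_0(\mathbf{y})^T\chi_1(\mathbf{y})}{|\chi_0(\mathbf{y})|},\qquad \xi_0(\mathbf{y})=\tfrac12\mathbf{y}^T(A^TD_0^TMD_0A)\mathbf{y},$$ $$\xi_1(\mathbf{y})=\tfrac12\eta(D_0C)^TMD_0A\mathbf{y}+(\mathbf{d}^T\mathbf{y})\mathbf{y}^TA^T(M^TD_0^TD_0^TMD_0)A\mathbf{y}+\tfrac12\eta(D_0A\mathbf{y})^TMD_0C+B,$$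 $$\tilde\xi_1(\mathbf{y})=\tfrac12\eta(D_0C)^TMD_0A\mathbf{y}+(\mathbf{d}^T\mathbf{y})\mathbf{y}^TA^TD_0MD_0D_0MA\mathbf{y}-B+\mathbf{y}^TA^TD_0^T(I+\eta MD_0)C-\tfrac12\eta(D_0A\mathbf{y})^TMD_0C.$$ *)

(* Defs.v *)
From mathcomp Require Export all_boot all_order all_algebra.
From mathcomp Require Export all_classical all_reals all_analysis.
Set Implicit Arguments.
Unset Strict Implicit.
Unset Printing Implicit Defensive.
Export Order.TTheory GRing.Theory Num.Theory numFieldNormedType.Exports.

Local Open Scope classical_set_scope.
Local Open Scope ring_scope.

(** The library norm on ['cV[R]_n] is the max norm: it
    gives the same topology, but lengths must be measured with [enorm]. *)

Definition dot (R : realType) n (u v : 'cV[R]_n) : R := (u^T *m v) 0 0.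

Definition enorm (R : realType) n (u : 'cV[R]_n) : R := Num.sqrt (dot u u).

Definition orthogonal_mx (R : realType) n (Q : 'M[R]_n) : Prop :=
  Q^T *m Q = 1%:M.

Definition vec2 (R : realType) (a b : R) : 'cV[R]_2 := \col_i [:: a; b]`_i.

Definition vec3 (R : realType) (y : 'cV[R]_2) (z : R) : 'cV[R]_3 :=
  col_mx y (z%:M : 'cV[R]_1).

Definition horizontal (R : realType) (x : 'cV[R]_3) : 'cV[R]_2 :=
  @usubmx R 2 1 1 x.

Definition height (R : realType) (x : 'cV[R]_3) : R := (@dsubmx R 2 1 1 x) 0 0.

(** [Ck U k f], for [U] open in a finite-dimensional space: the
    iterated directional derivatives of [f] of order at most [k] exist and are
    continuous on [U]. *)

Fixpoint Ck (R : realType) (V W : normedModType R) (U : set V) (k : nat)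
    (f : V -> W) : Prop :=
  (forall x, U x -> {for x, continuous f}) /\
  (if k is k'.+1
   then forall v, (forall x, U x -> derivable f x v) /\ Ck U k' ('D_v f)
   else True).

Definition Cinfty (R : realType) (V W : normedModType R) (U : set V)
    (f : V -> W) : Prop := forall k, Ck U k f.

(** Smoothness on an arbitrary subset [S] (here an embedded submanifold):
    [f] is near each point of [S] the restriction of a smooth function defined
    on an open set of the ambient space. *)
Definition smooth_on (R : realType) (V W : normedModType R) (S : set V)
    (f : V -> W) : Prop :=
  forall x, S x -> exists (U : set V) (g : V -> W),
    [/\ open U, U x, Cinfty U g & forall y, S y -> U y -> f y = g y].

Definition boundary (T : topologicalType) (Om : set T) : set T :=
  closure Om `\` interior Om.

(** Near each of its boundary points, [Om] is, in suitable orthonormal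
    coordinates, the set lying below the graph of a smooth function: this is the
    usual definition of a smooth domain. It keeps [Om] on one side only of its
    boundary, so that outward normals exist. *)
Definition smooth_boundary (R : realType) (Om : set 'cV[R]_3) : Prop :=
  forall x, boundary Om x ->
  exists (Q : 'M[R]_3) (g : 'cV[R]_2 -> R),
    [/\ orthogonal_mx Q, Cinfty setT g &
        \forall y \near x, let w := Q^T *m (y - x) in
                           Om y <-> height w < g (horizontal w)].

Definition smooth_surface_bounding (R : realType) (G Om : set 'cV[R]_3) : Prop :=
  [/\ open Om, bounded_set Om, G = boundary Om & smooth_boundary Om].

Definition tangent (R : realType) (G : set 'cV[R]_3) (x v : 'cV[R]_3) : Prop :=
  exists gam : R -> 'cV[R]_3,
    [/\ gam 0 = x, \forall t \near (0 : R), G (gam t) & is_derive (0 : R) (1 : R) gam v].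

Definition is_outward_unit_normal (R : realType) (Om : set 'cV[R]_3)
    (x n : 'cV[R]_3) : Prop :=
  [/\ enorm n = 1,
      forall v, tangent (boundary Om) x v -> dot n v = 0 &
      \forall t \near (0 : R)^'+, Om (x - t *: n) /\ ~ closure Om (x + t *: n)].

Definition outward_unit_normal (R : realType) (Om : set 'cV[R]_3)
    (x : 'cV[R]_3) : 'cV[R]_3 :=
  xget 0 [set n | is_outward_unit_normal Om x n].

Definition is_closest (R : realType) (G : set 'cV[R]_3) (x p : 'cV[R]_3) : Prop :=
  G p /\ forall q, G q -> enorm (x - p) <= enorm (x - q).

(** An arbitrary closest point where the closest point is not unique. *)
Definition proj (R : realType) (G : set 'cV[R]_3) (x : 'cV[R]_3) : 'cV[R]_3 :=
  xget 0 [set p | is_closest G x p].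

Definition nonunique (R : realType) (G : set 'cV[R]_3) : set 'cV[R]_3 :=
  [set x | exists p q, [/\ is_closest G x p, is_closest G x q & p <> q]].

Definition reach (R : realType) (G : set 'cV[R]_3) : \bar R :=
  ereal_inf [set e | exists x y,
    [/\ G x, nonunique G y & e = (enorm (x - y))%:E]].

Definition dist (R : realType) (G : set 'cV[R]_3) (x : 'cV[R]_3) : R :=
  inf [set enorm (x - q) | q in G].

Definition signed_dist (R : realType) (G Om : set 'cV[R]_3) (x : 'cV[R]_3) : R :=
  if `[< Om x >] then - dist G x else dist G x.

Definition tube (R : realType) (G Om : set 'cV[R]_3) (eps : R) : set 'cV[R]_3 :=
  [set x | `|signed_dist G Om x| <= eps].

Definition e_z (R : realType) : 'cV[R]_3 := vec3 0 1.

Definition normal_pt (R : realType) (xs n : 'cV[R]_3) (z : R) : 'cV[R]_3 :=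
  xs + ((z - height xs) / dot n (e_z R)) *: n.

Section SingularFunctions.
Variables (R : realType) (G Om : set 'cV[R]_3) (xs : 'cV[R]_3) (z : R).

Let n_x := outward_unit_normal Om xs.
Let y0 := horizontal (normal_pt xs n_x z).
Let p (y : 'cV[R]_2) := proj G (vec3 (y + y0) z).
Let n_y (y : 'cV[R]_2) := outward_unit_normal Om (p y).

Definition s_SL (y : 'cV[R]_2) : R :=
  (4 * pi)^-1 * (enorm (p y - xs))^-1.

Definition s_DL (y : 'cV[R]_2) : R :=
  - (4 * pi)^-1 * (dot (n_y y) (p y - xs) / enorm (p y - xs) ^+ 3).

Definition s_DLC (y : 'cV[R]_2) : R :=
  (4 * pi)^-1 * (dot n_x (p y - xs) / enorm (p y - xs) ^+ 3).

End SingularFunctions.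

(** The condition that the Hessian
    at [0] is diagonal says that the first two columns of [Q] are principal
    directions; [k1], [k2] are the principal curvatures, with the sign they get
    when heights are measured along the outward normal (negative for a sphere). *)

Definition e_x2 (R : realType) : 'cV[R]_2 := vec2 1 0.
Definition e_y2 (R : realType) : 'cV[R]_2 := vec2 0 1.

Definition gradient (R : realType) (f : 'cV[R]_2 -> R) (w : 'cV[R]_2) : 'cV[R]_2 :=
  \col_i 'D_(delta_mx i 0) f w.

Definition hessian (R : realType) (f : 'cV[R]_2 -> R) (w : 'cV[R]_2) : 'M[R]_2 :=
  \matrix_(i, j) 'D_(delta_mx j 0) ('D_(delta_mx i 0) f) w.

Definition frame (R : realType) (t1 t2 n : 'cV[R]_3) : 'M[R]_3 :=
  row_mx (row_mx t1 t2) n.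

Definition local_representation (R : realType) (G : set 'cV[R]_3)
    (xs : 'cV[R]_3) (Q : 'M[R]_3) (k1 k2 : R) (f : 'cV[R]_2 -> R) : Prop :=
  exists U : set 'cV[R]_2,
  [/\ [/\ open U, U 0 & Cinfty U f],
      \forall x \near xs, G x <-> exists2 w, U w & x = xs + Q *m vec3 w (f w),
      f 0 = 0,
      gradient f 0 = 0 &
      hessian f 0 = diag_mx (vec2 k1 k2)^T].

Section LocalExpansion.
Variables (R : realType) (Q : 'M[R]_3) (f : 'cV[R]_2 -> R) (eta : R).

Let M : 'M[R]_2 := hessian f 0.
Let A : 'M[R]_2 := @ulsubmx R 2 1 2 1 Q^T.
Let d : 'cV[R]_2 := (@dlsubmx R 2 1 2 1 Q^T)^T.
Let D0 : 'M[R]_2 := invmx (1%:M - eta *: M).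

Let f_xxx : R := 'D_(e_x2 R) ('D_(e_x2 R) ('D_(e_x2 R) f)) 0.
Let f_xxy : R := 'D_(e_y2 R) ('D_(e_x2 R) ('D_(e_x2 R) f)) 0.
Let f_xyy : R := 'D_(e_y2 R) ('D_(e_y2 R) ('D_(e_x2 R) f)) 0.
Let f_yyy : R := 'D_(e_y2 R) ('D_(e_y2 R) ('D_(e_y2 R) f)) 0.

Definition cubic_B (w : 'cV[R]_2) : R :=
  let x := w 0 0 in let y := w 1 0 in
  2^-1 * (f_xxx * (x ^+ 3 / 3) + f_yyy * (y ^+ 3 / 3)
          + f_xxy * x ^+ 2 * y + f_xyy * x * y ^+ 2).

Definition quadratic_C (w : 'cV[R]_2) : 'cV[R]_2 :=
  let x := w 0 0 in let y := w 1 0 in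
  2^-1 *: vec2 (f_xxx * x ^+ 2 + 2 * f_xxy * x * y + f_xyy * y ^+ 2)
               (f_yyy * y ^+ 2 + 2 * f_xyy * x * y + f_xxy * x ^+ 2).

Let B (y : 'cV[R]_2) : R := cubic_B (D0 *m A *m y).
Let C (y : 'cV[R]_2) : 'cV[R]_2 := quadratic_C (D0 *m A *m y).

Definition chi0 (y : 'cV[R]_2) : 'cV[R]_2 := D0 *m A *m y.

Definition chi1 (y : 'cV[R]_2) : 'cV[R]_2 :=
  dot d y *: (D0 *m D0 *m M *m A *m y) + eta *: (D0 *m C y).

Definition psi0 (y : 'cV[R]_2) : R := enorm (chi0 y).

Definition psi1 (y : 'cV[R]_2) : R := dot (chi0 y) (chi1 y) / enorm (chi0 y).

Definition xi0 (y : 'cV[R]_2) : R :=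
  2^-1 * dot y ((A^T *m D0^T *m M *m D0 *m A) *m y).

Definition xi1 (y : 'cV[R]_2) : R :=
  2^-1 * eta * dot (D0 *m C y) (M *m D0 *m A *m y)
  + dot d y * dot y (A^T *m (M^T *m D0^T *m D0^T *m M *m D0) *m A *m y)
  + 2^-1 * eta * dot (D0 *m A *m y) (M *m D0 *m C y)
  + B y.

Definition xi1_tilde (y : 'cV[R]_2) : R :=
  2^-1 * eta * dot (D0 *m C y) (M *m D0 *m A *m y)
  + dot d y * dot y (A^T *m D0 *m M *m D0 *m D0 *m M *m A *m y)
  - B y
  + dot y (A^T *m D0^T *m (1%:M + eta *: (M *m D0)) *m C y)
  - 2^-1 * eta * dot (D0 *m A *m y) (M *m D0 *m C y).

End LocalExpansion.

Definition unit_dir (R : realType) (y : 'cV[R]_2) : 'cV[R]_2 := (enorm y)^-1 *: y.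

Definition polar_form (R : realType) (r : R) (s : 'cV[R]_2 -> R)
    (l : R -> 'cV[R]_2 -> R) : Prop :=
  smooth_on [set q : R * 'cV[R]_2 | - r < q.1 < r /\ enorm q.2 = 1]
    (fun q : R * 'cV[R]_2 => l q.1 q.2 : R) /\
  forall y, 0 < enorm y < r -> s y = (enorm y)^-1 * l (enorm y) (unit_dir y).

Definition term0 (R : realType) (l : R -> 'cV[R]_2 -> R) (y : 'cV[R]_2) : R :=
  (enorm y)^-1 * l 0 (unit_dir y).

Definition term1 (R : realType) (l : R -> 'cV[R]_2 -> R) (y : 'cV[R]_2) : R :=
  derive1 (fun rho : R => l rho (unit_dir y)) 0.

Definition two_term_expansion (R : realType) (s : 'cV[R]_2 -> R)
    (l : R -> 'cV[R]_2 -> R) : Prop :=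
  let F := (0 : 'cV[R]_2)^' in
  (fun y => s y - term0 l y - term1 l y) =O_F (@enorm R 2).

(* Main.v *)
From HB Require Import structures.
Require Import Defs.
From mathcomp Require Import perm ring lra.
Set Implicit Arguments.
Unset Strict Implicit.
Unset Printing Implicit Defensive.
Local Open Scope classical_set_scope.
Local Open Scope ring_scope.

(** Near [y = 0] the closest point of the slice point [(y + y_0, z)] is a smooth
    function of [y]. The argument for this avoids the regularity theory of the
    distance function. Below the reach, the closest point [xs] of
    [x0 = (y_0, z)] stays the closest one when [x0] moves a little further away
    along the normal ([closest_extends]); hence the squared distance from [x0]
    grows quadratically along the surface away from [xs]
    ([closest_quadratic_growth]), and its Hessian in a graph chart is invertible
    ([foot_hess_unit]). The projection is continuous by compactness, and it solves
    the stationarity equation of the squared distance, so implicit differentiation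
    makes it smooth ([smooth_projection]).

    With [P y = p - xs], Hadamard's lemma gives [P (rho h) = rho A(rho, h)] with [A]
    smooth. The map [A(0, .)] is injective because the normal at [xs] is not
    horizontal, so [A] vanishes nowhere on the cylinder over the unit circle.
    Both [n . P] and [n_y . P] vanish to second order, since [P] is tangent to the
    surface to first order; they are [rho ^ 2] times a smooth function
    ([surface_blow_up]). Therefore each singular function is [1 / rho] times a smooth
    function of [(rho, h)], namely a multiple of [1 / |A|] or of [v / |A| ^ 3], and
    Taylor's formula in [rho] gives the two-term expansion.

    For the coefficients, the displacement [rho A] has in the principal frame the
    form [rho (alpha, rho nu)]. The stationarity equation divided by [rho] and the
    Taylor expansion of [f], also divided by powers of [rho], determine the value and
    the derivative of [alpha] and of the numerators at [rho = 0]
    ([frame_expansion]). The number [eta] enters as the position of [x0] on the normal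
    line, which equals the signed distance ([signed_dist_normal]). *)

(** * Calculus with smooth functions on normed modules *)

Section CkCalculus.
Context {R : realType} {E : normedModType R}.
Implicit Types (U : set E) (f g : E -> R) (k : nat).

Lemma Ck_sub (W : normedModType R) U U' k (f : E -> W) :
  U' `<=` U -> Ck U k f -> Ck U' k f.
Proof.
move=> sU; elim: k f => [|k IH] f [cf df]; split=> //; first by move=> x /sU/cf.
  by move=> x /sU/cf.
by move=> v; have [d1 d2] := df v; split; [move=> x /sU/d1|exact: IH].
Qed.

Lemma Ck_pred U k f : Ck U k.+1 f -> Ck U k f.
Proof.
elim: k f => [|k IH] f [cf df]; split=> // v; have [d1 d2] := df v.
by split=> //; exact: IH.
Qed.

Lemma Ck_le U j k f : (j <= k)%N -> Ck U k f -> Ck U j f.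
Proof.
move=> /subnK <-; elim: (k - j)%N => [//|i IH]; rewrite addSn => Cf.
exact/IH/Ck_pred.
Qed.

(** On an open set, directional derivatives depend only on the values in that
    set. The inductions on [k] below replace a derivative by its closed formula
    through this lemma. *)
Lemma Ck_eq U k f g : open U -> (forall x, U x -> f x = g x) ->
  Ck U k f -> Ck U k g.
Proof.
move=> oU; elim: k f g => [|k IH] f g fg [cf df].
  split=> // x Ux; have nfg : \near x, f x = g x.
    by apply: filterS (open_nbhs_nbhs (conj oU Ux)) => y /fg.
  rewrite /prop_for /continuous_at -(fg _ Ux); apply: cvg_trans (cf x Ux).
  by apply: near_eq_cvg; apply: filterS nfg => y ->.
have nfg x : U x -> \near x, f x = g x.
  by move=> Ux; apply: filterS (open_nbhs_nbhs (conj oU Ux)) => y /fg.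
split=> [x Ux|v].
  rewrite /prop_for /continuous_at -(fg _ Ux); apply: cvg_trans (cf x Ux).
  by apply: near_eq_cvg; apply: filterS (nfg x Ux) => y ->.
have [d1 d2] := df v; split=> [x Ux|].
  exact: near_eq_derivable (nfg x Ux) (d1 x Ux).
by apply: IH d2 => x Ux; exact: near_eq_derive (nfg x Ux).
Qed.

Lemma Ck_cst U k (c : R) : Ck U k (fun _ : E => c).
Proof.
elim: k c => [|k IH] c; split=> //; try by move=> x _; exact: cvg_cst.
move=> v; split=> [x _|]; first exact: derivable_cst.
rewrite (_ : 'D_v _ = fun=> 0) ?funeqE; first exact: IH.
by move=> x; exact: derive_cst.
Qed.

Lemma CkD U k f g : open U -> Ck U k f -> Ck U k g ->
  Ck U k (fun x => f x + g x).
Proof.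
move=> oU; elim: k f g => [|k IH] f g [cf df] [cg dg].
  by split=> // x Ux; apply: cvgD; [exact: cf|exact: cg].
split=> [x Ux|v]; first by apply: cvgD; [exact: cf|exact: cg].
have [df1 df2] := df v; have [dg1 dg2] := dg v; split=> [x Ux|].
  by apply: derivableD; [exact: df1|exact: dg1].
apply: (@Ck_eq _ _ (fun x => 'D_v f x + 'D_v g x)) => //; last exact: IH.
by move=> x Ux; rewrite [RHS]deriveD//; [exact: df1|exact: dg1].
Qed.

Lemma CkM U k f g : open U -> Ck U k f -> Ck U k g ->
  Ck U k (fun x => f x * g x).
Proof.
move=> oU; elim: k f g => [|k IH] f g Cf Cg; have [cf df] := Cf;
  have [cg dg] := Cg.
  by split=> // x Ux; apply: cvgM; [exact: cf|exact: cg].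
split=> [x Ux|v]; first by apply: cvgM; [exact: cf|exact: cg].
have [df1 df2] := df v; have [dg1 dg2] := dg v; split=> [x Ux|].
  by apply: derivableM; [exact: df1|exact: dg1].
apply: (@Ck_eq _ _ (fun x => f x * 'D_v g x + g x * 'D_v f x)) => //.
  by move=> x Ux; rewrite [RHS]deriveM//; [exact: df1|exact: dg1].
by apply: CkD => //; apply: IH => //; exact: Ck_pred.
Qed.

Lemma CkZ U k c f : open U -> Ck U k f -> Ck U k (fun x => c * f x).
Proof. by move=> oU; apply: CkM => //; exact: Ck_cst. Qed.

Lemma CkN U k f : open U -> Ck U k f -> Ck U k (fun x => - f x).
Proof.
move=> oU Cf; apply: (@Ck_eq _ _ (fun x => (-1) * f x)) => //.
  by move=> x _; rewrite mulN1r.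
exact: CkZ.
Qed.

Lemma CkB U k f g : open U -> Ck U k f -> Ck U k g ->
  Ck U k (fun x => f x - g x).
Proof. by move=> oU Cf Cg; apply: CkD => //; exact: CkN. Qed.

Lemma Ck_sum U k (I : finType) (P : pred I) (F : I -> E -> R) : open U ->
  (forall i, P i -> Ck U k (F i)) -> Ck U k (fun x => \sum_(i | P i) F i x).
Proof.
move=> oU CF; rewrite (_ : (fun _ => _) = \sum_(i | P i) F i); last first.
  by rewrite funeqE => x; rewrite fct_sumE.
elim/big_ind : _ => //; first exact: Ck_cst.
by move=> f g Cf Cg; exact: (CkD oU Cf Cg).
Qed.

Lemma Ck_prod U k (I : finType) (P : pred I) (F : I -> E -> R) : open U ->
  (forall i, P i -> Ck U k (F i)) -> Ck U k (fun x => \prod_(i | P i) F i x).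
Proof.
move=> oU CF; rewrite (_ : (fun _ => _) = \prod_(i | P i) F i); last first.
  by rewrite funeqE => x; rewrite fct_prodE.
elim/big_ind : _ => //; first exact: Ck_cst.
by move=> f g Cf Cg; exact: (CkM oU Cf Cg).
Qed.

(** The derivative is a product of inverses of [f] and of a derivative of [f],
    which is what makes the induction on [k] go through. *)
Lemma CkV U k f : open U -> (forall x, U x -> f x != 0) -> Ck U k f ->
  Ck U k (fun x => (f x)^-1).
Proof.
move=> oU f0; elim: k => [|k IH] Cf; have [cf df] := Cf.
  by split=> // x Ux; apply: cvgV; [exact: f0|exact: cf].
split=> [x Ux|v]; first by apply: cvgV; [exact: f0|exact: cf].
have [df1 df2] := df v; split=> [x Ux|].
  by apply: derivableV; [exact: f0|exact: df1].
apply: (@Ck_eq _ _ (fun x => - ((f x)^-1 * (f x)^-1 * 'D_v f x))) => //.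
  move=> x Ux; rewrite [RHS]deriveV//; [|exact: f0|exact: df1].
  by rewrite expr2 scaleNr -invfM.
have Ci : Ck U k (fun x => (f x)^-1) by apply: IH; exact: Ck_pred.
by apply: CkN => //; apply: CkM => //; exact: CkM.
Qed.

Lemma Ck_lin U k (f : {linear E -> R}) : continuous f -> Ck U k f.
Proof.
move=> cf; case: k => [|k]; (split; first by move=> x _; exact: (cf x)); first exact: I.
have df x v : derivable f x v by exact/diff_derivable/linear_differentiable.
move=> v; split=> //; rewrite (_ : 'D_v f = fun=> f v); first exact: Ck_cst.
rewrite funeqE => x; rewrite deriveE; last exact: linear_differentiable.
by rewrite diff_lin.
Qed.

End CkCalculus.

Section Directional.
Context {R : realType} {E : normedModType R}.

Lemma derive_line (W : normedModType R) (f : E -> W) x v :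
  'D_v f x = 'D_1 (fun t : R => f (t *: v + x)) 0.
Proof.
rewrite /derive; set g := fun h => _; set g' := fun h => _.
suff -> : g = g' by [].
by rewrite funeqE /g /g' => h /=; rewrite addr0 scale0r add0r [_%:A]mulr1.
Qed.

Lemma is_derive_line (W : normedModType R) (f : E -> W) x v (t : R) df :
  is_derive (t *: v + x) v f df ->
  is_derive t 1 (fun s : R => f (s *: v + x)) df.
Proof.
move=> [d1 d2].
have e : (fun h : R => h^-1 *: (((fun s : R => f (s *: v + x)) \o shift t) h%:A
      - f (t *: v + x))) =
    (fun h => h^-1 *: ((f \o shift (t *: v + x)) (h *: v) - f (t *: v + x))).
  by rewrite funeqE => h /=; rewrite [_%:A]mulr1 scalerDl addrA.
by split; rewrite /derivable/derive e.
Qed.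

(** The scalar [c] lies between [0] and [a]; the bound on its modulus is all
    that continuity arguments need, and it covers both signs of [a]. *)
Lemma mean_value (f : E -> R) x v (a : R) :
  (forall c : R, `|c| <= `|a| -> derivable f (c *: v + x) v) ->
  exists2 c : R, `|c| <= `|a| &
    f (a *: v + x) - f x = a * 'D_v f (c *: v + x).
Proof.
move=> df.
pose g (s : R) := f (s *: v + x).
have dg (c : R) : `|c| <= `|a| -> is_derive c 1 g ('D_v f (c *: v + x)).
  by move=> ca; apply: is_derive_line; exact/derivableP/df.
have cg (c : R) : `|c| <= `|a| -> {for c, continuous g}.
  move=> /dg dgc; apply/differentiable_continuous/derivable1_diffP.
  exact: ex_derive.
have g0 : g 0 = f x by rewrite /g scale0r add0r.
have [a0|a0|->] := ltgtP a 0; last 1 first.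
- by exists 0 => //; rewrite scale0r add0r subrr mul0r.
- have le (c : R) : a <= c <= 0 -> `|c| <= `|a|.
    by move=> /andP[h1 h2]; rewrite !ler0_norm ?lerN2 ?(ltW a0).
  have [||c] := @MVT _ g (fun c => 'D_v f (c *: v + x)) _ _ a0.
  + by move=> c; rewrite in_itv/= => /andP[/ltW h1 /ltW h2]; apply/dg/le/andP.
  + apply: continuous_in_subspaceT => c; rewrite inE/= in_itv/= => h.
    exact/cg/le.
  rewrite in_itv/= => /andP[/ltW h1 /ltW h2] e.
  exists c; first by apply: le; rewrite h1.
  by rewrite -g0 -opprB e sub0r mulrN opprK mulrC.
have le (c : R) : 0 <= c <= a -> `|c| <= `|a|.
  by move=> /andP[h1 h2]; rewrite !ger0_norm ?(ltW a0).
have [||c] := @MVT _ g (fun c => 'D_v f (c *: v + x)) _ _ a0.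
- by move=> c; rewrite in_itv/= => /andP[/ltW h1 /ltW h2]; apply/dg/le/andP.
- apply: continuous_in_subspaceT => c; rewrite inE/= in_itv/= => h.
  exact/cg/le.
rewrite in_itv/= => /andP[/ltW h1 /ltW h2] e.
exists c; first by apply: le; rewrite h1.
by rewrite -g0 [LHS]e subr0 mulrC.
Qed.

(** The outer function has to be differentiable, which is more than having
    directional derivatives; [C1_differentiable] supplies this. *)
Lemma is_derive_comp_diff (F W : normedModType R) (f : F -> W) (u : E -> F)
    x v du : differentiable f (u x) -> is_derive x v u du ->
  is_derive x v (f \o u) ('d f (u x) du).
Proof.
move=> df [d1 d2].
have du1 : differentiable (fun h : R => u (h *: v + x)) 0.
  exact: (derivable1_diffP _ _).1 ((derivable1P _ _ _).1 d1).
have df' : differentiable f ((fun h : R => u (h *: v + x)) 0).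
  by rewrite scale0r add0r.
have dc := differentiable_comp du1 df'.
split; first exact: (derivable1P _ _ _).2 ((derivable1_diffP _ _).2 dc).
have e : 'd (fun h : R => u (h *: v + x)) 0 1 = du.
  by rewrite -deriveE//= -d2 -(derive_line u).
rewrite derive_line deriveE// (_ : (fun t : R => _) =
  f \o (fun h : R => u (h *: v + x)))// diff_comp//= e.
by rewrite scale0r add0r.
Qed.

End Directional.

Section Convergence.
Context {R : realType} {T : Type} (F : set_system T) {FF : Filter F}.

Lemma cvg_sumr (I : Type) (r : seq I) (P : pred I) (f : I -> T -> R) (l : I -> R) :
  (forall i, P i -> f i x @[x --> F] --> l i) ->
  \sum_(i <- r | P i) f i x @[x --> F] --> \sum_(i <- r | P i) l i.
Proof. by apply: cvg_big; exact: (@add_continuous R^o). Qed.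

Lemma cvg_prodr (I : Type) (r : seq I) (P : pred I) (f : I -> T -> R) (l : I -> R) :
  (forall i, P i -> f i x @[x --> F] --> l i) ->
  \prod_(i <- r | P i) f i x @[x --> F] --> \prod_(i <- r | P i) l i.
Proof. by apply: cvg_big; exact: (@mul_continuous R). Qed.

Lemma cvg_mx m p (M : T -> 'M[R]_(m, p)) (L : 'M[R]_(m, p)) :
  (forall i j, M x i j @[x --> F] --> L i j) -> M x @[x --> F] --> L.
Proof.
move=> ML; apply/cvgrPdist_le => /= e e0; near=> x.
rewrite /Num.norm/= mx_normrE (bigmax_le _ (ltW e0))//= => i _.
rewrite !mxE; move: i; near: x; apply: filter_forall => /= i.
exact: ((cvgrPdist_le _ _).1 (ML i.1 i.2)).
Unshelve. all: by end_near. Qed.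

End Convergence.

Section Coordinates.
Context {R : realType} {n : nat}.

Lemma coord_le_norm (u : 'cV[R]_n) i : `|u i 0| <= `|u|.
Proof.
by rewrite [leRHS]/Num.norm/= mx_normrE; exact: (le_bigmax _ _ (i, 0)).
Qed.

Lemma norm_le_coord (u : 'cV[R]_n) r :
  0 <= r -> (forall i, `|u i 0| <= r) -> `|u| <= r.
Proof.
move=> r0 ur; rewrite [leLHS]/Num.norm/= mx_normrE bigmax_le//= => -[i j] _ /=.
by rewrite (ord1 j).
Qed.

Lemma col_sum_delta (u : 'cV[R]_n) : u = \sum_i u i 0 *: delta_mx i 0.
Proof.
apply/colP => k; rewrite summxE (bigD1 k)//= big1 ?addr0.
  by rewrite !mxE !eqxx mulr1.
by move=> i ik; rewrite !mxE eq_sym (negbTE ik) mulr0.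
Qed.

Lemma diff_col (f : 'cV[R]_n -> R) x v : differentiable f x ->
  'd f x v = \sum_i v i 0 * 'D_(delta_mx i 0) f x.
Proof.
move=> df; rewrite {1}(col_sum_delta v) linear_sum; apply: eq_bigr => i _.
by rewrite linearZ -deriveE.
Qed.

Lemma derive_col (f : 'cV[R]_n -> R) x v : differentiable f x ->
  'D_v f x = \sum_i v i 0 * 'D_(delta_mx i 0) f x.
Proof. by move=> df; rewrite deriveE// diff_col. Qed.

(** The increment of [f] is split along the broken line from [x] to [x + h]
    that follows the coordinate directions one after the other. *)
Lemma C1_differentiable (U : set 'cV[R]_n) (f : 'cV[R]_n -> R) x :
  open U -> Ck U 1 f -> U x -> differentiable f x.
Proof.
move=> oU [cf df] Ux.
pose L (h : 'cV[R]_n) : R := \sum_i h i 0 * 'D_(delta_mx i 0) f x.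
have linL : linear L.
  move=> a u v; rewrite /L scaler_sumr -big_split/=; apply: eq_bigr => i _.
  by rewrite !mxE mulrDl -mulrA.
pose LlM := GRing.isLinear.Build _ _ _ _ _ linL.
pose Ll : {linear 'cV[R]_n -> R} := HB.pack L LlM.
have cL : continuous L.
  move=> y; apply: (@cvg_sumr _ _ (nbhs y)) => i _.
  by apply: cvgM; [exact: coord_continuous|exact: cvg_cst].
suff dL : f \o shift x = cst (f x) + Ll +o_ (0 : 'cV[R]_n) id.
  have e : 'd f x = Ll :> ('cV[R]_n -> R) by exact: diff_unique.
  by apply/diff_locallyP; rewrite e.
apply/eqaddoP => _/posnumP[e].
have e'0 : 0 < e%:num / n.+1%:R by rewrite divr_gt0.
have /nbhs_ballP[d /= d0 dU] : \forall y \near x, U y /\ forall i : 'I_n,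
    `|'D_(delta_mx i 0) f y - 'D_(delta_mx i 0) f x| <= e%:num / n.+1%:R.
  have nU : \forall y \near x, U y := open_nbhs_nbhs (conj oU Ux).
  have nD : \forall y \near x, forall i : 'I_n,
    `|'D_(delta_mx i 0) f y - 'D_(delta_mx i 0) f x| <= e%:num / n.+1%:R.
    apply: (@filter_forall _ _ (fun i y => `|'D_(delta_mx i 0) f y -
      'D_(delta_mx i 0) f x| <= e%:num / n.+1%:R) (nbhs x)) => i.
    have [_ [cD _]] := df (delta_mx i 0).
    have /cvgrPdist_le/(_ _ e'0) := cD x Ux.
    by apply: filterS => y; rewrite distrC.
  by apply: filterS2 nU nD => y.
have inU y : `|y| < d -> U (y + x) /\ forall i : 'I_n,
    `|'D_(delta_mx i 0) f (y + x) - 'D_(delta_mx i 0) f x| <= e%:num / n.+1%:R.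
  move=> yd; apply: dU; rewrite -ball_normE /ball_/=.
  by rewrite opprD addrCA subrr addr0 normrN.
near=> h.
have hd : `|h| < d by near: h; exact: (@nbhs0_lt _ 'cV[R]_n).
(* The corners of the broken line. *)
pose p (k : nat) : 'cV[R]_n := \col_i (if (i < k)%N then h i 0 else 0).
have pS (k : 'I_n) : p k.+1 = h k 0 *: delta_mx k 0 + p k.
  apply/colP => i; rewrite !mxE eqxx andbT ltnS leq_eqVlt.
  have [->|ik] := eqVneq i k; first by rewrite eqxx ltnn mulr1 addr0.
  by rewrite mulr0 add0r val_eqE (negbTE ik).
have step (k : 'I_n) : `|f (p k.+1 + x) - f (p k + x)
    - h k 0 * 'D_(delta_mx k 0) f x| <= `|h| * (e%:num / n.+1%:R).
  have pk c : `|c| <= `|h k 0| -> `|c *: delta_mx k 0 + p k| < d.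
    move=> ck; apply: le_lt_trans hd; apply: norm_le_coord => // i.
    rewrite !mxE eqxx andbT; have [->|ik] := eqVneq i k.
      by rewrite ltnn mulr1 addr0 (le_trans ck)// coord_le_norm.
    by rewrite mulr0 add0r; case: ifP => _; rewrite ?normr0 ?coord_le_norm.
  have [|c ck] := @mean_value _ _ f (p k + x) (delta_mx k 0) (h k 0).
    move=> c ck; have [d1 _] := df (delta_mx k 0); apply: d1.
    by rewrite addrA; apply: (inU _ _).1; exact: pk.
  rewrite addrA -pS => ->; rewrite -mulrBr normrM ler_pM// ?coord_le_norm//.
  by rewrite addrA; apply: (inU _ _).2; exact: pk.
have -> : (f \o shift x - (cst (f x) + Ll)) h =
    \sum_(k < n) (f (p k.+1 + x) - f (p k + x)
       - h k 0 * 'D_(delta_mx k 0) f x).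
  rewrite sumrB -(big_mkord xpredT (fun k => f (p k.+1 + x) - f (p k + x))).
  rewrite telescope_sumr//.
  have -> : p n = h by apply/colP => i; rewrite mxE ltn_ord.
  have -> : p 0%N = 0 by apply/colP => i; rewrite !mxE.
  by rewrite add0r opprD addrA.
apply: le_trans (ler_norm_sum _ _ _) _.
apply: le_trans (ler_sum _ (fun k _ => step k)) _.
rewrite sumr_const card_ord -mulrnAr mulrC ler_wpM2r//.
rewrite -mulr_natr -mulrA ler_piMr// mulrC ler_pdivrMr// mul1r.
by rewrite ler_nat.
Unshelve. all: by end_near. Qed.

End Coordinates.

Section Composition.
Context {R : realType} {E : normedModType R}.

Lemma is_derive_mx m p (M : E -> 'M[R]_(m, p)) x v (dM : 'M[R]_(m, p)) :
  (forall i j, is_derive x v (fun y => M y i j) (dM i j)) ->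
  is_derive x v M dM.
Proof.
move=> h; have dd : derivable M x v by apply/derivable_mxP => i j; apply: ex_derive.
split=> //; rewrite derive_mx//; apply/matrixP => i j; rewrite mxE.
exact: derive_val.
Qed.

Lemma is_derive_comp_col n (f : 'cV[R]_n -> R) (u : E -> 'cV[R]_n) x v :
  differentiable f (u x) ->
  (forall i, derivable (fun y => u y i 0) x v) ->
  is_derive x v (f \o u)
    (\sum_i 'D_v (fun y => u y i 0) x * 'D_(delta_mx i 0) f (u x)).
Proof.
move=> df du; have du' : is_derive x v u (\col_i 'D_v (fun y => u y i 0) x).
  by apply: is_derive_mx => i j; rewrite (ord1 j) mxE; exact/derivableP.
apply: is_derive_eq (is_derive_comp_diff df du') _.
by rewrite diff_col//; apply: eq_bigr => i _; rewrite mxE.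
Qed.

(** The chain rule writes a derivative of the composite as a sum of products of
    functions that are smooth of one order less. *)
Lemma Ck_comp n (U : set E) (V : set 'cV[R]_n) k (f : 'cV[R]_n -> R)
    (u : E -> 'cV[R]_n) : open U -> open V -> (forall x, U x -> V (u x)) ->
  (forall i, Ck U k (fun x => u x i 0)) -> Ck V k f -> Ck U k (fun x => f (u x)).
Proof.
move=> oU oV UV Cu Cf.
have comp0 j (g : 'cV[R]_n -> R) : Ck V j g ->
    forall x, U x -> {for x, continuous (fun x => g (u x))}.
  move=> Cg x Ux; have cg : {for u x, continuous g} by case: j Cg => [|j] [+ _]; apply; exact: UV.
  apply: (continuous_comp _ cg) => //; apply: cvg_mx => i j'; rewrite (ord1 j').
  by case: k Cu {Cf} => [|k] /(_ i) [cu _]; exact: cu.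
elim: k f Cu Cf => [|k IH] f Cu Cf; first by split=> //; exact: comp0 Cf.
have df x : U x -> differentiable f (u x).
  by move=> Ux; apply: (C1_differentiable oV _ (UV _ Ux)); exact: Ck_le Cf.
have du x i v : U x -> derivable (fun y => u y i 0) x v.
  by move=> Ux; have [_ /(_ v)[+ _]] := Cu i; exact.
have dfu x v : U x -> is_derive x v (f \o u) _ :=
  fun Ux => is_derive_comp_col (df x Ux) (fun i => du x i v Ux).
split=> [|v]; first exact: comp0 Cf.
split=> [x Ux|]; first by have [] := dfu x v Ux.
apply: (@Ck_eq _ _ _ _ (fun x => \sum_i 'D_v (fun y => u y i 0) x *
   'D_(delta_mx i 0) f (u x))) => // [x Ux|].
  by have [_ ->] := dfu x v Ux.
apply: (@Ck_sum _ _ _ _ _ _ (fun i x => 'D_v (fun y => u y i 0) x *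
   'D_(delta_mx i 0) f (u x))) => // i _; apply: CkM => //; first by have [_ /(_ v)[]] := Cu i.
apply: (IH ('D_(delta_mx i 0) f)); first by move=> l; exact: Ck_pred.
by have [_ /(_ (delta_mx i 0))[]] := Cf.
Qed.

End Composition.

Section MoreCk.
Context {R : realType} {E : normedModType R}.

Lemma Ck_linear (U : set E) k (f : E -> R) : linear f -> continuous f -> Ck U k f.
Proof.
move=> lf; pose fM := GRing.isLinear.Build _ _ _ _ _ lf.
by pose fl : {linear E -> R} := HB.pack f fM; exact: (@Ck_lin _ _ U k fl).
Qed.

Lemma is_derive_sqrt (f : E -> R) x v df : 0 < f x -> is_derive x v f df ->
  is_derive x v (fun y => Num.sqrt (f y)) (df / (2 * Num.sqrt (f x))).
Proof.
move=> f0 d; have ds := is_derive1_sqrt f0.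
have dd : differentiable (@Num.sqrt R) (f x) by apply/derivable1_diffP; exact: ex_derive.
apply: is_derive_eq (is_derive_comp_diff dd d) _.
rewrite (deriv1E (ex_derive (is_derive := ds))) derive1E derive_val.
by [].
Qed.

Lemma Ck_sqrt (U : set E) k (f : E -> R) : open U -> (forall x, U x -> 0 < f x) ->
  Ck U k f -> Ck U k (fun x => Num.sqrt (f x)).
Proof.
move=> oU f0; have cs j : Ck U j f -> forall x, U x ->
    {for x, continuous (fun x => Num.sqrt (f x))}.
  move=> Cf x Ux; apply: continuous_comp; last exact: sqrt_continuous.
  by case: j Cf => [|j] [cf _]; exact: cf.
elim: k => [|k IH] Cf; split=> //; try exact: cs Cf.
have [cf df] := Cf; move=> v; have [df1 df2] := df v.
have ds x (Ux : U x) := is_derive_sqrt (f0 x Ux) (derivableP (df1 x Ux)).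
split=> [x Ux|]; first by have [] := ds x Ux.
apply: (@Ck_eq _ _ _ _ (fun x => 'D_v f x * (2 * Num.sqrt (f x))^-1)) => //.
  by move=> x Ux; have [_ ->] := ds x Ux.
apply: CkM => //; apply: CkV => //.
  by move=> x Ux; rewrite mulf_neq0// gt_eqF// sqrtr_gt0 f0.
by apply: CkZ => //; apply: IH; exact: Ck_pred.
Qed.

End MoreCk.

Section CkCoordinates.
Context {R : realType}.

Lemma Ck_fst (E : normedModType R) (U : set (R * E)) k : Ck U k (fun q => q.1).
Proof. by apply: Ck_linear => // q; exact: cvg_fst. Qed.

Lemma Ck_snd_coord n (U : set (R * 'cV[R]_n)) k i : Ck U k (fun q => q.2 i 0).
Proof.
apply: Ck_linear; first by move=> a u v; rewrite !mxE.
move=> q; apply: (@continuous_comp _ _ _ snd (fun u : 'cV[R]_n => u i 0)).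
  exact: cvg_snd.
exact: coord_continuous.
Qed.

End CkCoordinates.

Section SymmetryOfSecondDerivatives.
Context {R : realType} {E : normedModType R} (U : set E) (f : E -> R) (x : E).
Hypotheses (oU : open U) (Cf : Ck U 2 f) (Ux : U x).

(** The mean value theorem is applied along [u] and then along [v]; the left-hand
    side is symmetric in [u] and [v]. *)
Let second_difference (u v : E) e : 0 < e -> \forall s \near (0 : R),
  exists2 r, f (s *: u + (s *: v + x)) - f (s *: v + x)
      - (f (s *: u + x) - f x) = s * (s * r) & `|'D_v ('D_u f) x - r| <= e.
Proof.
move=> e0; have [_ /(_ u)[du [_ /(_ v)[duv [cuv _]]]]] := Cf.
have nU : \forall y \near x, U y := open_nbhs_nbhs (conj oU Ux).
have nD : \forall y \near x, `|'D_v ('D_u f) x - 'D_v ('D_u f) y| <= e.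
  exact: (cvgrPdist_le _ _).1 (cuv x Ux) e e0.
have /nbhs_ballP[d /= d0 dU] : \forall y \near x, U y /\
  `|'D_v ('D_u f) x - 'D_v ('D_u f) y| <= e by apply: filterS2 nU nD => y.
have M0 : 0 < `|u| + `|v| + 1 by rewrite ltr_wpDl// addr_ge0.
have inU a b s : s * (`|u| + `|v| + 1) < d -> `|a| <= s -> `|b| <= s ->
    U (a *: u + (b *: v + x)) /\
    `|'D_v ('D_u f) x - 'D_v ('D_u f) (a *: u + (b *: v + x))| <= e.
  move=> sd ha hb; apply: dU; rewrite -ball_normE /ball_/= addrA opprD addrCA subrr.
  rewrite addr0 normrN; apply: le_lt_trans sd; apply: le_trans (ler_normD _ _) _.
  have s0 : 0 <= s by apply: le_trans ha.
  by rewrite !normrZ !mulrDr mulr1 ler_wpDr// lerD// ler_wpM2r.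
near=> s.
have sd : `|s| * (`|u| + `|v| + 1) < d.
  rewrite -ltr_pdivlMr//; near: s.
  by apply: (@nbhs0_lt _ R^o); rewrite divr_gt0.
pose g y := f (y + s *: v) - f y.
have dg c : `|c| <= `|s| -> is_derive (c *: u + x) u g
    ('D_u f (c *: u + x + s *: v) - 'D_u f (c *: u + x)).
  move=> cs; apply: is_deriveB; last first.
    apply/derivableP/du; have [] := inU c 0 `|s| sd cs; first by rewrite normr0.
    by rewrite scale0r add0r.
  have [] : derivable f (c *: u + x + s *: v) u /\ True.
    split=> //; apply: du; have [+ _] := inU c s `|s| sd cs (lexx _).
    by rewrite -addrA [x + _]addrC.
  move=> dd _; split; rewrite /derivable /derive.
    move: dd; rewrite /derivable; set h1 := fun h => _; set h2 := fun h => _.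
    by suff -> : h1 = h2 by []; rewrite funeqE /h1/h2 => h /=; rewrite !addrA.
  set h1 := fun h => _; set h2 := fun h => _.
  by suff -> : h1 = h2 by []; rewrite funeqE /h1/h2 => h /=; rewrite !addrA.
have [c cs Hc] := @mean_value _ _ g x u s (fun c cs => ex_derive (is_derive := dg c cs)).
have [c' cs' Hc'] := @mean_value _ _ ('D_u f) (c *: u + x) v s (fun c' cs' =>
  duv _ (eq_rect _ U (inU c c' `|s| sd cs cs').1 _ (addrCA _ _ _))).
exists ('D_v ('D_u f) (c' *: v + (c *: u + x))).
  have [_ eg] := dg c cs; rewrite -Hc' [s *: v + (c *: u + x)]addrC -eg -Hc /g.
  by rewrite -[s *: u + x + s *: v]addrA [x + s *: v]addrC; ring.
by rewrite addrCA; apply: (inU _ _ _ sd _ _).2.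
Unshelve. all: by end_near. Qed.

(** Schwarz's theorem: both mixed derivatives are limits of the same symmetric
    second difference quotient. *)
Lemma deriveC u v : 'D_v ('D_u f) x = 'D_u ('D_v f) x.
Proof.
apply/eqP; rewrite -subr_eq0 -normr_le0; apply/ler_addgt0Pr => e e0.
have e2 : 0 < e / 2 by rewrite divr_gt0.
have n0 : \forall s \near (0 : R)^', s != 0 by exact: nbhs_dnbhs_neq.
have [s [[sN0 [r Hr er]] [r' Hr' er']]] := @filter_ex _ (0 : R)^' _ _ (filterI (filterI n0
  (nbhs_dnbhs (second_difference u v e2)))
  (nbhs_dnbhs (second_difference v u e2))).
have err : r = r'.
  apply: (mulfI sN0); apply: (mulfI sN0); rewrite -Hr -Hr' addrCA.
  by rewrite opprB opprB !addrA; ring.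
rewrite add0r -(subrKA r) (splitr e) (le_trans (ler_normD _ _))// lerD//.
by rewrite distrC err.
Qed.

End SymmetryOfSecondDerivatives.

(** * Hadamard's lemma *)

Section UnitIntegral.
Context {R : realType}.
Implicit Types (f g F : R -> R).

Definition int01 f : R := \int[@lebesgue_measure R]_(s in `[0, 1]) f s.

(** Continuity is two-sided at the endpoints as well: it holds along rays, which
    extend beyond the unit interval inside an open set, and it is stable under
    pointwise operations. *)
Definition cont01 f := forall s : R, 0 <= s <= 1 -> {for s, continuous f}.

Lemma cont01_within f : cont01 f -> {within `[0, 1], continuous f}.
Proof.
by move=> cf; apply: continuous_in_subspaceT => s; rewrite inE/= in_itv/=; exact: cf.
Qed.

Lemma cont01_integrable f : cont01 f ->
  (@lebesgue_measure R).-integrable `[0, 1] (EFin \o f).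
Proof.
move=> cf; apply: continuous_compact_integrable; first exact: segment_compact.
exact: cont01_within.
Qed.

Lemma int01_eq f g : (forall s : R, 0 <= s <= 1 -> f s = g s) -> int01 f = int01 g.
Proof.
by move=> fg; apply: eq_Rintegral => s; rewrite inE/= in_itv/=; exact: fg.
Qed.

Lemma int01B f g : cont01 f -> cont01 g ->
  int01 (fun s => f s - g s) = int01 f - int01 g.
Proof. by move=> cf cg; apply: RintegralB => //; exact: cont01_integrable. Qed.

Lemma int01D f g : cont01 f -> cont01 g ->
  int01 (fun s => f s + g s) = int01 f + int01 g.
Proof. by move=> cf cg; apply: RintegralD => //; exact: cont01_integrable. Qed.

Lemma int01Z c f : cont01 f -> int01 (fun s => c * f s) = c * int01 f.
Proof. by move=> cf; apply: RintegralZl => //; exact: cont01_integrable. Qed.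

Lemma cont01_cst (c : R) : cont01 (fun=> c).
Proof. by move=> s _; exact: cvg_cst. Qed.

Lemma cont01B f g : cont01 f -> cont01 g -> cont01 (fun s => f s - g s).
Proof. by move=> cf cg s s01; apply: cvgB; [exact: cf|exact: cg]. Qed.

Lemma cont01M f g : cont01 f -> cont01 g -> cont01 (fun s => f s * g s).
Proof. by move=> cf cg s s01; apply: cvgM; [exact: cf|exact: cg]. Qed.

Lemma cont01_sum n (f : 'I_n -> R -> R) : (forall i, cont01 (f i)) ->
  cont01 (fun s => \sum_i f i s).
Proof.
by move=> cf s s01; apply: (@cvg_sumr _ _ (nbhs s)) => i _; exact: cf.
Qed.

Lemma int01_sum n (f : 'I_n -> R -> R) : (forall i, cont01 (f i)) ->
  int01 (fun s => \sum_i f i s) = \sum_i int01 (f i).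
Proof.
elim: n f => [|n IH] f cf.
  rewrite big_ord0 -[RHS](mul0r (int01 (fun=> 0))) -int01Z; last exact: cont01_cst.
  by apply: int01_eq => s _; rewrite big_ord0 mul0r.
rewrite big_ord_recl -IH; last by move=> i; exact: cf.
rewrite -int01D//; last exact: cont01_sum.
by apply: int01_eq => s _; rewrite big_ord_recl.
Qed.

Lemma int01_bound (M : R) f : cont01 f -> (forall s : R, 0 <= s <= 1 -> `|f s| <= M) ->
  `|int01 f| <= M.
Proof.
move=> cf fM; have cnf : cont01 (fun s => `|f s|).
  by move=> s s01; apply: cvg_norm; exact: cf.
have := @le_normr_Rintegral _ _ _ (@lebesgue_measure R) `[0, 1]%classic f
  (measurable_itv _) (cont01_integrable cf).
move=> /le_trans; apply.
have := @le_Rintegral _ _ _ (@lebesgue_measure R) `[0, 1]%classic _ (fun=> M)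
  (measurable_itv _) (cont01_integrable cnf) (cont01_integrable (@cont01_cst M)).
move=> h; apply: le_trans (h _) _; first by move=> s; rewrite /= in_itv/=; exact: fM.
rewrite Rintegral_cst//= -[leRHS]mulr1; have := @lebesgue_measure_itv R `[0, 1].
by rewrite /= lte_fin ltr01 sube0 => ->.
Qed.

Lemma int01_FTC F f : cont01 f ->
  (forall s : R, 0 <= s <= 1 -> is_derive s 1 F (f s)) -> int01 f = F 1 - F 0.
Proof.
move=> cf dF; have cF : cont01 F.
  move=> s /dF dFs; apply/differentiable_continuous/derivable1_diffP.
  exact: ex_derive.
rewrite /int01 /Rintegral (@continuous_FTC2 _ f F 0 1)//.
- exact: cont01_within.
- split.
  + move=> s; rewrite in_itv/= => /andP[/ltW h1 /ltW h2].
    by apply: ex_derive; apply: dF; rewrite h1.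
  + by apply: cvg_at_right_filter; apply: cF; rewrite lexx ler01.
  + by apply: cvg_at_left_filter; apply: cF; rewrite lexx ler01.
- move=> s; rewrite in_itv/= => /andP[/ltW h1 /ltW h2].
  have dFs : is_derive s 1 F (f s) by apply: dF; rewrite h1.
  by rewrite derive1E derive_val.
Qed.

End UnitIntegral.

Section RadialIntegral.
Context {R : realType} {E : normedModType R} (U : set E).
Hypotheses (oU : open U)
  (starU : forall x (s : R), U x -> 0 <= s <= 1 -> U (s *: x)).

(** The remainders of Taylor's formula at [0] have this form, with weight [1] at
    first order and [1 - s] at second order. *)
Definition radial_int (w : R -> R) (K : E -> R) (x : E) : R :=
  int01 (fun s => w s * K (s *: x)).

(** The bound by [1] survives multiplication by [s], the factor that each
    derivative in [x] brings in. *)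
Definition weight (w : R -> R) :=
  continuous w /\ forall s : R, 0 <= s <= 1 -> `|w s| <= 1.

Let cont01_w w : weight w -> cont01 w.
Proof. by move=> [cw _] s _; exact: cw. Qed.

Lemma weight_id w : weight w -> weight (fun s => w s * s).
Proof.
move=> [cw w1]; split=> [s|s s01]; first by apply: cvgM; [exact: cw|exact: cvg_id].
by rewrite normrM mulr_ile1 ?w1//; case/andP: s01 => s0 s1; rewrite ger0_norm.
Qed.

Let cont_on (K : E -> R) := forall x, U x -> {for x, continuous K}.

Let cont_ray K x : cont_on K -> U x -> cont01 (fun s => K (s *: x)).
Proof.
move=> cK Ux s s01; apply: (@continuous_comp _ _ _ (fun s : R => s *: x) K).
  by apply: cvgZr_tmp; exact: cvg_id.
exact/cK/starU.
Qed.

Let cont_integrand w K x : weight w -> cont_on K -> U x ->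
  cont01 (fun s => w s * K (s *: x)).
Proof. by move=> hw cK Ux; apply: cont01M; [exact: cont01_w|exact: cont_ray]. Qed.

(** Compactness of the unit interval makes the continuity of [K] uniform along
    the segment from [0] to [x]. *)
Let uniform K x e : cont_on K -> U x -> 0 < e -> \forall y \near x,
  forall s : R, 0 <= s <= 1 -> `|K (s *: y) - K (s *: x)| <= e.
Proof.
move=> cK Ux e0; have e2 : 0 < e / 2 by rewrite divr_gt0.
have := (compact_near_coveringP (`[0%R, 1%R]%classic : set R)).1 (@segment_compact R 0 1).
move=> /(_ E (nbhs x) (fun y s => `|K (s *: y) - K (s *: x)| <= e) _).
move=> H; suff {}H' : forall s : R, `[0, 1]%classic s ->
    \forall s' \near s & y \near x, `|K (s' *: y) - K (s' *: x)| <= e.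
  by apply: filterS (H H') => y hy s s01; apply: hy; rewrite /= in_itv.
move=> s; rewrite /= in_itv/= => s01; have Usx := starU Ux s01.
have cs : (fun q : R * E => K (q.1 *: q.2)) @ (s, x) --> K (s *: x).
  apply: (@continuous_comp _ _ _ (fun q : R * E => q.1 *: q.2) K (s, x)).
    exact: (@scale_continuous R E).
  exact: cK.
have cs' : (fun s : R => K (s *: x)) @ s --> K (s *: x) by exact: cont_ray.
have h1 : \forall q \near (s, x), `|K (s *: x) - K (q.1 *: q.2)| <= e / 2.
  exact: (cvgrPdist_le _ _).1 cs _ e2.
have h2 : \forall s' \near s, `|K (s *: x) - K (s' *: x)| <= e / 2.
  exact: (cvgrPdist_le _ _).1 cs' _ e2.
have {}h2 : \forall q \near (s, x), `|K (s *: x) - K (q.1 *: x)| <= e / 2.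
  exact: (cvg_fst (F := nbhs s) (G := nbhs x)) h2.
apply: filterS2 h1 h2 => -[s' y]/= h1 h2.
rewrite -(subrKA (K (s *: x))) (splitr e) (le_trans (ler_normD _ _))// lerD//.
by rewrite distrC.
Qed.

Lemma is_derive_scale_arg (K : E -> R) s x v : derivable K (s *: x) v ->
  is_derive x v (fun y => K (s *: y)) (s * 'D_v K (s *: x)).
Proof.
move=> dK; pose phi (t : R) := K (t *: v + s *: x).
have dphi : differentiable phi (s * 0).
  by rewrite mulr0; apply/derivable1_diffP; exact: (derivable1P _ _ _).1.
have dm : is_derive (0 : R) 1 (fun h : R => s * h) s.
  exact: is_derive_eq (is_deriveZ s (is_derive_id (0 : R) 1)) (mulr1 s).
have [d1 d2] := is_derive_comp_diff dphi dm.
have e : phi \o (fun h : R => s * h) = (fun h : R => K (s *: (h *: v + x))).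
  by rewrite funeqE => h /=; rewrite /phi scalerDr scalerA.
rewrite e in d1 d2; split; first exact: (derivable1P _ _ _).2.
rewrite (derive_line (fun y => K (s *: y))) d2 -[s in LHS]mulr1 linearZ/=.
by rewrite mulr0 -deriveE -?derive_line// -[X in differentiable _ X](mulr0 s).
Qed.

Lemma radial_int_continuous w K : weight w -> cont_on K ->
  cont_on (radial_int w K).
Proof.
move=> hw cK x Ux; apply/cvgrPdist_le => e e0.
have nU : \forall y \near x, U y := open_nbhs_nbhs (conj oU Ux).
apply: filterS2 nU (uniform cK Ux e0) => y Uy hy.
rewrite distrC /radial_int -int01B; [|exact: cont_integrand..].
apply: int01_bound; first by apply: cont01B; exact: cont_integrand.
move=> s s01; rewrite -mulrBr normrM -[e]mul1r ler_pM//; last exact: hy.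
by have [_ ->] := hw.
Qed.

(** Differentiation under the integral sign: by the mean value theorem the
    difference quotients of the integrand converge uniformly in [s]. *)
Lemma radial_int_is_derive w K x v : weight w -> Ck U 1 K -> U x ->
  is_derive x v (radial_int w K) (radial_int (fun s => w s * s) ('D_v K) x).
Proof.
move=> hw [cK /(_ v)[dK [cdK _]]] Ux; have hw' := weight_id hw.
suff cvg : (fun h : R => h^-1 *: ((radial_int w K \o shift x) (h *: v) -
    radial_int w K x)) @ 0^' --> radial_int (fun s => w s * s) ('D_v K) x.
  by split; [apply/cvg_ex; eexists; exact: cvg|exact: cvg_lim cvg].
apply/cvgrPdist_le => e e0.
have nU : \forall y \near x, U y := open_nbhs_nbhs (conj oU Ux).
have /nbhs_ballP[d /= d0 hd] : \forall y \near x, U y /\ forall s : R, 0 <= s <= 1 ->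
    `|'D_v K (s *: y) - 'D_v K (s *: x)| <= e.
  by apply: filterS2 nU (uniform cdK Ux e0) => y.
have v1 : 0 < `|v| + 1 by rewrite ltr_wpDl.
have {}hd (c : R) : `|c| * (`|v| + 1) < d -> U (c *: v + x) /\ forall s : R, 0 <= s <= 1 ->
    `|'D_v K (s *: (c *: v + x)) - 'D_v K (s *: x)| <= e.
  move=> cd; apply: hd; rewrite -ball_normE /ball_/= opprD addrCA subrr addr0.
  by rewrite normrN normrZ (le_lt_trans _ cd)// mulrDr mulr1 lerDl.
near=> h; have h0 : h != 0 by near: h; exact: nbhs_dnbhs_neq.
have hsmall : `|h| * (`|v| + 1) < d.
  rewrite -ltr_pdivlMr//; near: h; apply: (@dnbhs0_lt _ R^o).
  by rewrite divr_gt0.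
have Uh : U (h *: v + x) by have [] := hd h hsmall.
have scE (a b : R) : a *: (b : R^o) = a * b by [].
have ch : cont01 (fun s => w s * K (s *: (h *: v + x))) by exact: cont_integrand.
have c0 : cont01 (fun s => w s * K (s *: x)) by exact: cont_integrand.
have cq := cont01M (@cont01_cst _ h^-1) (cont01B ch c0).
have cD : cont01 (fun s => w s * s * 'D_v K (s *: x)).
  exact: (cont_integrand hw' cdK Ux).
rewrite /= /radial_int -int01B// scE -int01Z; last exact: cont01B.
rewrite -int01B//; apply: int01_bound; first exact: cont01B.
move=> s s01.
have dKs (c : R) : `|c| <= `|h| -> U (c *: v + x) /\
    `|'D_v K (s *: (c *: v + x)) - 'D_v K (s *: x)| <= e.
  move=> ch'; have [Uc hc] := hd c (le_lt_trans (ler_wpM2r (ltW v1) ch') hsmall).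
  by split=> //; exact: hc.
have dKd (c : R) : `|c| <= `|h| -> is_derive (c *: v + x) v (fun y => K (s *: y))
    (s * 'D_v K (s *: (c *: v + x))).
  by move=> /dKs[Uc _]; apply/is_derive_scale_arg/dK/starU.
have [c ch' Hc] := @mean_value _ _ (fun y => K (s *: y)) x v h
  (fun c ch => ex_derive (is_derive := dKd c ch)).
have [_ hc] := dKs c ch'; move: Hc; have [_ ->] := dKd c ch'.
rewrite -mulrBr => ->; rewrite mulrCA [h^-1 * _]mulrA mulVf// mul1r mulrA -mulrBr.
by rewrite normrM distrC -[e]mul1r ler_pM//; case: hw' => _ ->.
Unshelve. all: by end_near. Qed.

Lemma radial_int_Ck w K k : weight w -> Ck U k K -> Ck U k (radial_int w K).
Proof.
elim: k w K => [|k IH] w K hw CK.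
  by split=> //; apply: radial_int_continuous => //; case: CK.
have CK1 : Ck U 1 K by exact: Ck_le CK.
have [cK dK] := CK; split; first exact: radial_int_continuous.
move=> v; split=> [x Ux|].
  by have [] := radial_int_is_derive v hw CK1 Ux.
apply: (@Ck_eq _ _ _ _ (radial_int (fun s => w s * s) ('D_v K))) => //.
  by move=> x Ux; have [_ ->] := radial_int_is_derive v hw CK1 Ux.
by apply: IH; [exact: weight_id|have [] := dK v].
Qed.

Lemma radial_int0 w K : weight w -> radial_int w K 0 = K 0 * int01 w.
Proof.
move=> hw; rewrite -int01Z; last exact: cont01_w.
by apply: int01_eq => s _; rewrite scaler0 mulrC.
Qed.

End RadialIntegral.

Section WeightValues.
Context {R : realType}.

Lemma weight1 : @weight R (fun=> 1).
Proof. by split=> [s|s _]; [exact: cvg_cst|rewrite normr1]. Qed.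

Lemma weight_onem : @weight R (fun s => 1 - s).
Proof.
split=> [s|s /andP[s0 s1]]; first by apply: cvgB; [exact: cvg_cst|exact: cvg_id].
by rewrite ger0_norm ?subr_ge0// lerBlDr lerDl.
Qed.

Let is_derive_monomial (n : nat) (s : R) :
  is_derive s 1 (fun t : R => n.+1%:R^-1 * t ^+ n.+1) (s ^+ n).
Proof.
have := is_deriveX n.+1 (is_derive_id s 1); rewrite exprfctE /= => dX.
have dZ := @is_deriveZ _ _ _ _ n.+1%:R^-1 _ _ _ dX; apply: is_derive_eq dZ _.
by rewrite [_%:A]mulr1 [_ *: _]mulrA mulVf// ?mul1r// pnatr_eq0.
Qed.

Let cont01_X n : cont01 (fun s : R => s ^+ n).
Proof. by move=> s _; exact: exprn_continuous. Qed.

Let int01_X n : int01 (fun s : R => s ^+ n) = n.+1%:R^-1.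
Proof.
rewrite (int01_FTC (@cont01_X n) (fun s _ => is_derive_monomial n s)).
by rewrite expr1n expr0n mulr0 subr0 mulr1.
Qed.

Lemma int01_1 : int01 (fun=> 1 : R) = 1.
Proof. by rewrite -[RHS]invr1 -(int01_X 0). Qed.

Lemma int01_id : int01 (fun s : R => 1 * s) = 2^-1.
Proof. by rewrite -(int01_X 1); apply: int01_eq => s _; rewrite mul1r expr1. Qed.

Lemma int01_onem : int01 (fun s : R => 1 - s) = 2^-1.
Proof.
rewrite int01B; [|exact: cont01_cst|exact: (@cont01_X 1)].
by rewrite int01_1 (int01_X 1); lra.
Qed.

Lemma int01_onem_id : int01 (fun s : R => (1 - s) * s) = 6^-1.
Proof.
rewrite (@int01_eq _ _ (fun s => s ^+ 1 - s ^+ 2)); last first.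
  by move=> s _; rewrite mulrBl mul1r expr1 expr2.
by rewrite int01B ?int01_X; [lra|exact: cont01_X..].
Qed.

End WeightValues.

Section Hadamard.
Context {R : realType} {n : nat} (U : set 'cV[R]_n).
Hypotheses (oU : open U)
  (starU : forall x (s : R), U x -> 0 <= s <= 1 -> U (s *: x)).
Local Notation "''d_' i f" := (derive f ^~ (delta_mx i 0))
  (at level 10, i, f at next level, format "''d_' i  f").

Lemma Cinfty_derive (u : 'cV[R]_n -> R) v : Cinfty U u -> Cinfty U ('D_v u).
Proof. by move=> Cu k; have [_ /(_ v)[]] := Cu k.+1. Qed.

Let cont_ray (K : 'cV[R]_n -> R) x : Cinfty U K -> U x ->
  cont01 (fun s : R => K (s *: x)).
Proof.
move=> /(_ 0%N)[cK _] Ux s s01.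
apply: (@continuous_comp _ _ _ (fun s : R => s *: x) K).
  by apply: cvgZr_tmp; exact: cvg_id.
exact/cK/starU.
Qed.

Let is_derive_ray (u : 'cV[R]_n -> R) y (s : R) : Cinfty U u -> U y -> 0 <= s <= 1 ->
  is_derive s 1 (fun t : R => u (t *: y)) (\sum_i y i 0 * 'd_i u (s *: y)).
Proof.
move=> Cu Uy s01; have Usy := starU Uy s01.
have df : differentiable u (s *: y) by exact: (C1_differentiable oU (Cu 1%N)).
rewrite -derive_col//.
have dsy : is_derive (s *: y + 0) y u ('D_y u (s *: y)).
  by rewrite addr0; exact/derivableP/diff_derivable.
have := is_derive_line dsy.
by rewrite (_ : (fun t : R => u (t *: y + 0)) = (fun t : R => u (t *: y)))//
  funeqE => t; rewrite addr0.
Qed.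

(** Integration of the derivative along the segment from [0] to [y]. The values
    and first derivatives of the factors at [0] enter the coefficients of the
    expansion. *)
Lemma hadamard1 (u : 'cV[R]_n -> R) : Cinfty U u -> U 0 -> u 0 = 0 ->
  exists b : 'I_n -> 'cV[R]_n -> R,
  [/\ forall j, Cinfty U (b j),
      forall y, U y -> u y = \sum_j y j 0 * b j y,
      forall j, b j 0 = 'd_j u 0 &
      forall j v, 'D_v (b j) 0 = 2^-1 * 'D_v ('d_j u) 0].
Proof.
move=> Cu U0 u0; exists (fun j => radial_int (fun=> 1) ('d_j u)).
have Cd j : Cinfty U ('d_j u) by exact: Cinfty_derive.
split=> [j k|y Uy|j|j v].
- exact: radial_int_Ck weight1 (Cd j k).
- have c0 j : cont01 (fun s : R => 'd_j u (s *: y)) := cont_ray (Cd j) Uy.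
  have c1 j : cont01 (fun s : R => y j 0 * 'd_j u (s *: y)).
    by apply: cont01M; [exact: cont01_cst|exact: c0].
  have c2 : cont01 (fun s => \sum_j y j 0 * 'd_j u (s *: y)).
    exact: (@cont01_sum _ _ (fun j s => y j 0 * 'd_j u (s *: y))).
  transitivity (int01 (fun s => \sum_j y j 0 * 'd_j u (s *: y))); last first.
    rewrite (int01_sum c1); apply: eq_bigr => j _; rewrite int01Z//.
    by congr (_ * _); apply: int01_eq => s _; rewrite mul1r.
  rewrite (int01_FTC c2 (fun s s01 => is_derive_ray Cu Uy s01)).
  by rewrite scale1r scale0r u0 subr0.
- by rewrite (radial_int0 _ weight1) int01_1 mulr1.
- have [_ ->] := radial_int_is_derive oU starU v weight1 (Cd j 1%N) U0.
  by rewrite (radial_int0 _ (weight_id weight1)) int01_id mulrC.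
Qed.

(** Taylor's formula with integral remainder of weight [1 - s]; the constant
    [6^-1] is the integral of [(1 - s) * s] over the unit interval. *)
Lemma hadamard2 (u : 'cV[R]_n -> R) : Cinfty U u -> U 0 -> u 0 = 0 ->
  (forall i, 'd_i u 0 = 0) ->
  exists c : 'I_n -> 'I_n -> 'cV[R]_n -> R,
  [/\ forall i j, Cinfty U (c i j),
      forall y, U y -> u y = \sum_i \sum_j y i 0 * y j 0 * c i j y,
      forall i j, c i j 0 = 2^-1 * 'd_j ('d_i u) 0 &
      forall i j v, 'D_v (c i j) 0 = 6^-1 * 'D_v ('d_j ('d_i u)) 0].
Proof.
move=> Cu U0 u0 du0; pose w (s : R) := 1 - s.
exists (fun i j => radial_int w ('d_j ('d_i u))).
have Cd j : Cinfty U ('d_j u) by exact: Cinfty_derive.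
have Cdd i j : Cinfty U ('d_j ('d_i u)) by exact: Cinfty_derive.
split=> [i j k|y Uy|i j|i j v].
- exact: radial_int_Ck weight_onem (Cdd i j k).
- have cw : cont01 w by move=> s _; have [cw _] := @weight_onem R; exact: cw.
  have c1 i j : cont01 (fun s : R => w s * 'd_j ('d_i u) (s *: y)).
    by apply: cont01M; [exact: cw|exact: cont_ray (Cdd i j) Uy].
  have c2 i j : cont01 (fun s : R => y i 0 * y j 0 * (w s * 'd_j ('d_i u) (s *: y))).
    by apply: cont01M; [exact: cont01_cst|exact: c1].
  have c3 i : cont01 (fun s => \sum_j y i 0 * y j 0 * (w s * 'd_j ('d_i u) (s *: y))).
    exact: (@cont01_sum _ _ (fun j s => y i 0 * y j 0 * (w s * 'd_j ('d_i u) (s *: y)))).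
  have c4 : cont01 (fun s => \sum_i \sum_j
      y i 0 * y j 0 * (w s * 'd_j ('d_i u) (s *: y))).
    exact: (@cont01_sum _ _ (fun i s => \sum_j y i 0 * y j 0 * (w s * 'd_j ('d_i u) (s *: y)))).
  transitivity (int01 (fun s => \sum_i \sum_j
      y i 0 * y j 0 * (w s * 'd_j ('d_i u) (s *: y)))); last first.
    rewrite (int01_sum c3).
    by apply: eq_bigr => i _; rewrite (int01_sum (c2 i)); apply: eq_bigr => j _; rewrite int01Z.
  (* Integration by parts, in the form of a primitive. *)
  pose F s := w s * \sum_i y i 0 * 'd_i u (s *: y) + u (s *: y).
  have dF (s : R) : 0 <= s <= 1 -> is_derive s 1 F
      (\sum_i \sum_j y i 0 * y j 0 * (w s * 'd_j ('d_i u) (s *: y))).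
    move=> s01.
    have dw : is_derive s 1 w (-1).
      by apply: is_derive_eq (is_deriveB (is_derive_cst _ _ _) (is_derive_id s 1)) (sub0r _).
    have ds : is_derive s 1 (fun t : R => \sum_i y i 0 * 'd_i u (t *: y))
        (\sum_i y i 0 * \sum_j y j 0 * 'd_j ('d_i u) (s *: y)).
      rewrite (_ : (fun t : R => _) = \sum_i (fun t : R => y i 0 * 'd_i u (t *: y))).
        apply: is_derive_sum => i.
        exact: is_deriveZ (is_derive_ray (Cd i) Uy s01).
      by rewrite funeqE => t; rewrite fct_sumE.
    apply: is_derive_eq (is_deriveD (is_deriveM dw ds) (is_derive_ray Cu Uy s01)) _.
    rewrite [_ *: (-1)]mulrN1 subrK [LHS]mulr_sumr; apply: eq_bigr => i _.
    rewrite mulrCA mulr_sumr mulr_sumr; apply: eq_bigr => j _.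
    by ring.
  rewrite (int01_FTC c4 dF) /F /w subrr mul0r add0r scale1r subr0 mul1r scale0r u0 addr0.
  by rewrite big1 ?subr0// => i _; rewrite du0 mulr0.
- by rewrite (radial_int0 _ weight_onem) int01_onem mulrC.
- have [_ ->] := radial_int_is_derive oU starU v weight_onem (Cdd i j 1%N) U0.
  by rewrite (radial_int0 _ (weight_id weight_onem)) int01_onem_id mulrC.
Qed.

End Hadamard.

(** * Euclidean geometry and closest points *)

Section Euclid.
Context {R : realType} {n : nat}.
Implicit Types u v w : 'cV[R]_n.

Lemma dotE u v : dot u v = \sum_i u i 0 * v i 0.
Proof. by rewrite /dot mxE; apply: eq_bigr => i _; rewrite mxE. Qed.

Lemma dotC u v : dot u v = dot v u.
Proof. by rewrite !dotE; apply: eq_bigr => i _; rewrite mulrC. Qed.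

Lemma dotDl u v w : dot (u + v) w = dot u w + dot v w.
Proof. by rewrite /dot linearD/= mulmxDl mxE. Qed.

Lemma dotZl a u v : dot (a *: u) v = a * dot u v.
Proof. by rewrite /dot linearZ/= -scalemxAl mxE. Qed.

Lemma dotNl u v : dot (- u) v = - dot u v.
Proof. by rewrite -scaleN1r dotZl mulN1r. Qed.

Lemma dotDr u v w : dot w (u + v) = dot w u + dot w v.
Proof. by rewrite !(dotC w) dotDl. Qed.

Lemma dotZr a u v : dot u (a *: v) = a * dot u v.
Proof. by rewrite !(dotC u) dotZl. Qed.

Lemma dotNr u v : dot u (- v) = - dot u v.
Proof. by rewrite !(dotC u) dotNl. Qed.

Lemma dot0l u : dot 0 u = 0.
Proof. by rewrite -(scale0r 0) dotZl mul0r. Qed.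

Lemma dot0r u : dot u 0 = 0.
Proof. by rewrite dotC dot0l. Qed.

Lemma dot_ge0 u : 0 <= dot u u.
Proof. by rewrite dotE sumr_ge0// => i _; rewrite -expr2 sqr_ge0. Qed.

Lemma dot_eq0 u : (dot u u == 0) = (u == 0).
Proof.
apply/idP/idP => [|/eqP->]; last by rewrite dot0l.
rewrite dotE psumr_eq0 => [/allP h|i _]; last by rewrite -expr2 sqr_ge0.
apply/eqP/colP => i; apply/eqP; rewrite mxE.
by have := h i; rewrite mem_index_enum mulf_eq0 orbb => /(_ isT).
Qed.

Lemma enorm_ge0 u : 0 <= enorm u. Proof. exact: sqrtr_ge0. Qed.

Lemma enorm_sqr u : enorm u ^+ 2 = dot u u.
Proof. by rewrite sqr_sqrtr// dot_ge0. Qed.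

Lemma enorm_eq0 u : (enorm u == 0) = (u == 0).
Proof. by rewrite -sqrf_eq0 enorm_sqr dot_eq0. Qed.

Lemma enorm_gt0 u : (0 < enorm u) = (u != 0).
Proof. by rewrite lt0r enorm_ge0 andbT enorm_eq0. Qed.

Lemma enorm0 : enorm (0 : 'cV[R]_n) = 0.
Proof. by apply/eqP; rewrite enorm_eq0. Qed.

Lemma enormZ a u : enorm (a *: u) = `|a| * enorm u.
Proof. by rewrite /enorm dotZl dotZr mulrA -expr2 sqrtrM ?sqr_ge0// sqrtr_sqr. Qed.

Lemma enormN u : enorm (- u) = enorm u.
Proof. by rewrite -scaleN1r enormZ normrN1 mul1r. Qed.

Lemma enormBC u v : enorm (u - v) = enorm (v - u).
Proof. by rewrite -enormN opprB. Qed.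

Lemma enormD_sqr u v : enorm (u + v) ^+ 2 = enorm u ^+ 2 + 2 * dot u v + enorm v ^+ 2.
Proof. by rewrite !enorm_sqr dotDl !dotDr (dotC v u); ring. Qed.

Lemma enormB_sqr u v : enorm (u - v) ^+ 2 = enorm u ^+ 2 - 2 * dot u v + enorm v ^+ 2.
Proof. by rewrite enormD_sqr enormN dotNr; ring. Qed.

Lemma dot_le_enorm u v : dot u v <= enorm u * enorm v.
Proof.
have [->|u0] := eqVneq u 0; first by rewrite dot0l enorm0 mul0r.
have [->|v0] := eqVneq v 0; first by rewrite dot0r enorm0 mulr0.
have := dot_ge0 (enorm v *: u - enorm u *: v).
rewrite -enorm_sqr enormB_sqr !enormZ !(ger0_norm (enorm_ge0 _)) dotZl dotZr.
move: u0 v0; rewrite -!enorm_gt0; move: (enorm u) (enorm v) (dot u v) => a b d a0 b0 h.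
have ab : 0 < a * b by rewrite mulr_gt0.
have : 0 <= 2 * (a * b) * (a * b - d) by move: h; set x := (X in 0 <= X); set y := (X in _ -> 0 <= X);
  suff -> : x = y by []; rewrite /x/y; ring.
by rewrite pmulr_rge0 ?subr_ge0// mulr_gt0.
Qed.

Lemma enormD u v : enorm (u + v) <= enorm u + enorm v.
Proof.
rewrite -ler_sqr ?nnegrE ?addr_ge0 ?enorm_ge0// enormD_sqr sqrrD.
rewrite lerD2r lerD2l mulr_natl; have := dot_le_enorm u v; lra.
Qed.

Lemma norm_le_enorm u : `|u| <= enorm u.
Proof.
apply: norm_le_coord => [|i]; first exact: enorm_ge0.
rewrite -ler_sqr ?nnegrE ?enorm_ge0// enorm_sqr real_normK ?num_real//.
rewrite dotE (bigD1 i)//= -expr2 lerDl sumr_ge0// => j _.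
by rewrite -expr2 sqr_ge0.
Qed.

Section Continuity.
Context {T : Type} (F : set_system T) {FF : Filter F}.

Lemma cvg_dot (f g : T -> 'cV[R]_n) u v : f x @[x --> F] --> u ->
  g x @[x --> F] --> v -> dot (f x) (g x) @[x --> F] --> dot u v.
Proof.
move=> fu gv; rewrite dotE (_ : (fun x => _) = fun x => \sum_i f x i 0 * g x i 0).
  apply: (@cvg_sumr _ _ F) => i _; apply: cvgM.
    by apply: (@cvg_comp _ _ _ f (fun w : 'cV[R]_n => w i 0)) fu _; exact: coord_continuous.
  by apply: (@cvg_comp _ _ _ g (fun w : 'cV[R]_n => w i 0)) gv _; exact: coord_continuous.
by rewrite funeqE => x; rewrite dotE.
Qed.

Lemma cvg_enorm (f : T -> 'cV[R]_n) u : f x @[x --> F] --> u ->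
  enorm (f x) @[x --> F] --> enorm u.
Proof.
move=> fu; apply: (@cvg_comp _ _ _ _ (@Num.sqrt R) F _ _ (cvg_dot fu fu)).
exact: sqrt_continuous.
Qed.

End Continuity.

Lemma enorm_continuous : continuous (@enorm R n).
Proof. by move=> u; apply: (@cvg_enorm _ (nbhs u)); exact: cvg_id. Qed.

Lemma near_enorm_lt u e : 0 < e -> \forall v \near u, enorm (v - u) < e.
Proof.
move=> e0; have : enorm (v - u) @[v --> u] --> (0 : R).
  rewrite -enorm0 -(subrr u); apply: (@cvg_enorm _ (nbhs u)).
  by apply: cvgB; [exact: cvg_id|exact: cvg_cst].
move=> /cvgrPdist_lt/(_ e e0); apply: filterS => v.
by rewrite sub0r normrN ger0_norm// enorm_ge0.
Qed.

(** Transported from row vectors by transposition. *)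
Lemma bounded_closed_compact_col (K : set 'cV[R]_n) :
  bounded_set K -> closed K -> compact K.
Proof.
move=> bK cK; pose K' := [set u : 'rV[R]_n | K u^T].
have ctr : continuous (@trmx R 1 n).
  move=> u; apply: (@cvg_mx _ _ (nbhs u)) => i j.
  rewrite (_ : (fun x : 'rV[R]_n => x^T i j) = fun x => x j i); last first.
    by rewrite funeqE => x; rewrite mxE.
  by rewrite mxE; exact: coord_continuous.
have -> : K = @trmx R 1 n @` K'.
  rewrite eqEsubset; split=> [u Ku|_ [u Ku <-]//].
  by exists u^T; rewrite /K' /= trmxK.
apply: continuous_compact; first exact: continuous_subspaceT.
apply: bounded_closed_compact.
  have [M [Mr hM]] := bK; exists M; split=> // m Mm u /= /(hM m Mm).
  apply: le_trans; rewrite /Num.norm/= !mx_normrE; apply: bigmax_le => //.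
    by apply: bigmax_ge_id.
  move=> [i j] _ /=; apply: le_trans (le_bigmax _ _ (j, i)) => /=.
  by rewrite mxE.
exact: (continuous_closedP _).1 ctr K cK.
Qed.

End Euclid.

Lemma reach_unique {R : realType} (G : set 'cV[R]_3) x p q :
  is_closest G x p -> is_closest G x q -> ((enorm (x - p))%:E < reach G)%E -> p = q.
Proof.
move=> cp cq lt; apply: contrapT => pq; move: lt; apply/negP; rewrite -leNgt.
apply: ereal_inf_lbound; exists p, x; split; first by case: cp.
  by exists p, q.
by rewrite enormBC.
Qed.

Section ClosestPoint.
Context {R : realType} {G : set 'cV[R]_3}.
Hypotheses (cG : compact G) (G0 : G !=set0).

Let cont_enormB (x : 'cV[R]_3) : continuous (fun q : 'cV[R]_3 => enorm (x - q)).
Proof.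
move=> q; apply: (@cvg_enorm _ _ _ (nbhs q)).
by apply: cvgB; [exact: cvg_cst|exact: cvg_id].
Qed.

Lemma closest_exists x : exists p, is_closest G x p.
Proof.
have [p pG hp] := compact_EVT_min G0 cG (continuous_subspaceT (@cont_enormB x)).
by exists p; split=> [|q Gq]; [exact: set_mem|apply: hp; exact: mem_set].
Qed.

Lemma proj_closest x : is_closest G x (proj G x).
Proof.
have [p hp] := closest_exists x.
exact: (@xgetPex _ 0 [set p | is_closest G x p] (ex_intro _ p hp)).
Qed.

Lemma dist_closest x p : is_closest G x p -> dist G x = enorm (x - p).
Proof.
move=> [Gp hp]; apply/eqP; rewrite eq_le; apply/andP; split.
  by apply: inf_lbound; [exists 0 => _ [q _ <-]; exact: enorm_ge0|exists p].
by apply: lb_le_inf; [exists (enorm (x - p)), p|move=> _ [q Gq <-]; exact: hp].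
Qed.

Lemma dist_proj x : dist G x = enorm (x - proj G x).
Proof. exact/dist_closest/proj_closest. Qed.

Lemma dist_le x q : G q -> dist G x <= enorm (x - q).
Proof. by move=> Gq; rewrite dist_proj; have [_] := proj_closest x; apply. Qed.

Lemma is_closestP x p : G p -> enorm (x - p) <= dist G x -> is_closest G x p.
Proof. by move=> Gp h; split=> // q Gq; apply: le_trans h _; exact: dist_le. Qed.

Lemma dist_lipschitz x y : dist G x <= dist G y + enorm (x - y).
Proof.
rewrite (dist_proj y) addrC; have [Gp _] := proj_closest y.
apply: le_trans (dist_le x Gp) _; apply: le_trans (enormD _ _).
by rewrite subrKA.
Qed.

Lemma dist_continuous : continuous (dist G).
Proof.
move=> x; apply/(@cvgrPdist_lt _ _ _ (nbhs x) _) => e e0.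
apply: filterS (near_enorm_lt x e0) => y; apply: le_lt_trans.
rewrite ler_norml; have := dist_lipschitz x y; have := dist_lipschitz y x.
by rewrite (enormBC x y); lra.
Qed.

(** By compactness, the points of [G] outside a ball around the closest point are
    farther from [x] by a definite amount, which a small displacement of [x]
    cannot make up. *)
Lemma proj_continuous x : (forall p q, is_closest G x p -> is_closest G x q -> p = q) ->
  {for x, continuous (proj G)}.
Proof.
move=> uniq; set p := proj G x.
have cp : is_closest G x p := proj_closest x.
move=> P /nbhs_ballP[e /= e0 eP].
suff : \forall y \near x, ball p e (proj G y) by apply: filterS => y /eP.
pose K := G `&` ~` ball p e.
have cK : compact K.
  apply: (subclosed_compact _ cG); last by move=> q [].
  apply: closedI; last by apply: open_closedC; exact: ball_open.
  exact: compact_closed (@norm_hausdorff _ _) cG.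
have [[q Kq]|K0] := pselect (K !=set0); last first.
  near=> y; apply: contrapT => nb; apply: K0; exists (proj G y); split=> //.
  by have [] := proj_closest y.
have K0 : K !=set0 by exists q.
have [m mK hm] := compact_EVT_min K0 cK (continuous_subspaceT (@cont_enormB x)).
have {mK} [Gm nm] := set_mem mK.
have lt : dist G x < enorm (x - m).
  rewrite lt_neqAle dist_le// andbT; apply/eqP => dm; apply: nm.
  have cm : is_closest G x m by apply: is_closestP => //; rewrite dm.
  by rewrite (uniq _ _ cm cp); exact: ballxx.
have d0 : 0 < (enorm (x - m) - dist G x) / 2 by rewrite divr_gt0 ?subr_gt0.
apply: filterS (near_enorm_lt x d0) => y hy; apply: contrapT => nb.
have [Gy _] := proj_closest y.
have h1 : enorm (x - m) <= enorm (x - proj G y) by apply: hm; apply/mem_set; split.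
have h2 : enorm (x - proj G y) <= enorm (x - y) + enorm (y - proj G y).
  by apply: le_trans (enormD _ _); rewrite subrKA.
have h3 := dist_lipschitz y x; rewrite -dist_proj in h2.
by move: h1 h2 h3 hy; rewrite (enormBC x y); lra.
Unshelve. all: by end_near. Qed.

End ClosestPoint.

(** * Closest points below the reach *)

Section BelowReach.
Context {R : realType} {G : set 'cV[R]_3}.
Hypotheses (cG : compact G) (G0 : G !=set0).

Lemma proj_continuous_below_reach x :
  ((dist G x)%:E < reach G)%E -> {for x, continuous (proj G)}.
Proof.
move=> lt; apply: (proj_continuous cG G0) => p q cp cq.
by apply: (reach_unique cp cq); rewrite -(dist_closest cp).
Qed.

(** Moving away from the closest point increases the distance at unit rate:
    the closest points of the displaced points converge to that of [x]. *)
Lemma dist_grows_along_normal x d : ((dist G x)%:E < reach G)%E ->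
  0 < dist G x -> 0 < d < 1 ->
  \forall t \near (0 : R)^'+,
    dist G x + t * (1 - d) <= dist G (x + t *: ((dist G x)^-1 *: (x - proj G x))).
Proof.
move=> lt D0 /andP[d0 d1]; set D := dist G x; set u := D^-1 *: (x - proj G x).
have u1 : enorm u = 1.
  by rewrite enormZ ger0_norm ?invr_ge0 ?ltW// -(dist_proj cG G0) mulVf// gt_eqF.
have cx := proj_continuous_below_reach lt.
have cu : (fun t : R => proj G (x + t *: u)) @ 0 --> proj G x.
  have h : (fun t : R => x + t *: u) @ 0 --> x.
    rewrite -[X in _ --> X]addr0 -(scale0r u); apply: cvgD; first exact: cvg_cst.
    by apply: cvgZr_tmp; exact: cvg_id.
  exact: (@cvg_comp _ _ _ _ _ _ _ _ h cx).
have dD : 0 < d * D by rewrite mulr_gt0.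
have := near_enorm_lt (proj G x) dD => /cu /= hq.
have {}hq : \forall t \near (0 : R)^'+,
    enorm (proj G (x + t *: u) - proj G x) < d * D.
  exact: (@cvg_within _ (nbhs (0 : R)) _ _ _ hq).
near=> t; have t0 : 0 < t by near: t; exact: nbhs_right_gt.
have hqt : enorm (proj G (x + t *: u) - proj G x) < d * D by near: t; exact: hq.
rewrite (dist_proj cG G0 (x + _)); set q := proj G (x + _).
have Gq : G q by have [] := proj_closest cG G0 (x + t *: u).
have pos : 0 <= D + t * (1 - d).
  by rewrite addr_ge0// ?(ltW D0)// mulr_ge0// ?subr_ge0 ltW.
rewrite -ler_sqr ?nnegrE ?enorm_ge0//.
rewrite addrAC enormD_sqr dotZr enormZ u1 mulr1 real_normK ?num_real//.
have h1 : D <= enorm (x - q) by exact: dist_le.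
have h1' : D ^+ 2 <= enorm (x - q) ^+ 2 by rewrite ler_sqr ?nnegrE ?enorm_ge0 ?(ltW D0).
have h2 : D - d * D <= dot (x - q) u.
  rewrite -(subrKA (proj G x)) dotDl.
  have -> : dot (x - proj G x) u = D.
    rewrite dotZr -enorm_sqr -(dist_proj cG G0) expr2 mulrA mulVf ?mul1r//.
    by rewrite gt_eqF.
  rewrite lerD2l lerNl -dotNl opprB.
  apply: le_trans (dot_le_enorm _ _) _; rewrite u1 mulr1; exact: ltW hqt.
have h3 : t * (D - d * D) <= t * dot (x - q) u by rewrite ler_wpM2l// ltW.
have h4 : (t * (1 - d)) ^+ 2 <= t ^+ 2.
  rewrite exprMn -[leRHS]mulr1 ler_wpM2l ?sqr_ge0// -[leRHS](expr1n _ 2).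
  by rewrite ler_sqr ?nnegrE ?subr_ge0 ?ltW// ltrBlDr ltrDl.
rewrite sqrrD; apply: lerD h4; apply: lerD h1' _; rewrite -[leLHS]mulr_natl ler_wpM2l//.
by rewrite (_ : D * _ = t * (D - d * D))//; ring.
Unshelve. all: by end_near. Qed.

(** Federer's observation: the closest point stays the same when one moves a
    little further along the normal. A point of the ball of radius [h] about
    [y0] where [dist G x - (1 - d) * enorm (x - y0)] is largest must lie on the
    sphere, since otherwise one could go on along the normal; hence the
    distance reaches [dist G y0 + h] on the ball, and the triangle inequality
    allows this only at the point of the normal line through [xs]. *)
Lemma closest_extends y0 xs : is_closest G y0 xs ->
  ((dist G y0)%:E < reach G)%E -> 0 < dist G y0 ->
  exists2 h, 0 < h &
    is_closest G (y0 + h *: ((dist G y0)^-1 *: (y0 - xs))) xs.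
Proof.
move=> cxs lt D0; set D := dist G y0; have De : D = enorm (y0 - xs) := dist_closest cxs.
have [Gxs _] := cxs.
have [h [h0 hD hr]] : exists h, [/\ 0 < h, h < D & ((D + h)%:E < reach G)%E].
  have [r Dr rr] : exists2 r, D < r & (r%:E <= reach G)%E.
    move: lt; rewrite -/D; case: (reach G) => [r||]//.
      by rewrite lte_fin => Dr; exists r.
    by exists (D + 1); rewrite ?ltrDl// leey.
  (* The radius is small enough for the ball about [y0] to stay off [G] and below
     the reach. *)
  exists (Num.min (D / 2) ((r - D) / 2)); split.
  - by rewrite lt_min !divr_gt0// subr_gt0.
  - by rewrite gt_min ltr_pdivrMr// mulr_natr mulr2n ltrDl D0.
  - apply: lt_le_trans rr; rewrite lte_fin -ltrBrDl.
    rewrite gt_min; apply/orP; right.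
    by rewrite ltr_pdivrMr// mulr_natr mulr2n ltrDl subr_gt0.
pose K := [set x : 'cV[R]_3 | enorm (x - y0) <= h].
have cB : continuous (fun x : 'cV[R]_3 => enorm (x - y0)).
  move=> x; apply: (@cvg_enorm _ _ _ (nbhs x)).
  by apply: cvgB; [exact: cvg_id|exact: cvg_cst].
have K0 : K !=set0 by exists y0; rewrite /K/= subrr enorm0 ltW.
have cK : compact K.
  apply: bounded_closed_compact_col.
    exists (`|y0| + h); split=> [|m hm x /= Kx]; first exact: num_real.
    rewrite -(subrK y0 x) addrC (le_trans (ler_normD _ _))// (le_trans _ (ltW hm))//.
    by rewrite lerD2l (le_trans (norm_le_enorm _)).
  exact: ((continuous_closedP _).1 cB _ (@closed_le _ h)).
have cD := dist_continuous cG G0.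
have DK x : K x -> 0 < dist G x /\ ((dist G x)%:E < reach G)%E.
  rewrite /K /= => Kx; split.
    by have := dist_lipschitz cG G0 y0 x; rewrite enormBC -/D; move: hD Kx; lra.
  apply: le_lt_trans hr; rewrite lee_fin.
  by have := dist_lipschitz cG G0 x y0; rewrite -/D; move: Kx; lra.
have far d : 0 < d < 1 -> exists2 x, K x & D + (1 - d) * h <= dist G x.
  move=> /andP[d0 d1]; pose Psi (x : 'cV[R]_3) := dist G x - (1 - d) * enorm (x - y0).
  have cPsi : continuous Psi.
    move=> x; apply: (@cvgB _ _ _ (nbhs x)); first exact: cD.
    by apply: cvgM; [exact: cvg_cst|exact: cB].
  have [x /set_mem Kx hx] := compact_EVT_max K0 cK (continuous_subspaceT cPsi).
  exists x => //; have [Dx0 Dxr] := DK x Kx.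
  have [xh|xh] := ltrP (enorm (x - y0)) h; last first.
    have := hx y0 (mem_set _); rewrite /Psi subrr enorm0 mulr0 subr0 -/D.
    move=> /(_ _) hx0; have {}hx0 : D <= dist G x - (1 - d) * enorm (x - y0).
      by apply: hx0; rewrite /K/= subrr enorm0 ltW.
    have : (1 - d) * h <= (1 - d) * enorm (x - y0) by rewrite ler_wpM2l// subr_ge0 ltW.
    by move: hx0; lra.
  exfalso; have d2 : 0 < d / 2 < 1 by move: d0 d1; lra.
  have g1 := dist_grows_along_normal Dxr Dx0 d2.
  have g2 : \forall t \near (0 : R)^'+, t < h - enorm (x - y0).
    by apply: nbhs_right_lt; rewrite subr_gt0.
  have g3 : \forall t \near (0 : R)^'+, 0 < t by exact: nbhs_right_gt.
  have [t [[Ht th] t0]] := @filter_ex _ (0 : R)^'+ _ _ (filterI (filterI g1 g2) g3).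
  set u := (_ *: (x - proj G x)) in Ht.
  have u1 : enorm u = 1.
    by rewrite enormZ ger0_norm ?invr_ge0 ?ltW// -(dist_proj cG G0) mulVf// gt_eqF.
  have tu : enorm (x + t *: u - y0) <= enorm (x - y0) + t.
    by rewrite addrAC (le_trans (enormD _ _))// enormZ u1 mulr1 ger0_norm// ltW.
  have Kt : K (x + t *: u) by rewrite /K/= (le_trans tu)//; move: th; lra.
  have := hx _ (mem_set Kt); rewrite /Psi.
  have : (1 - d) * enorm (x + t *: u - y0) <= (1 - d) * (enorm (x - y0) + t).
    by rewrite ler_wpM2l// subr_ge0 ltW.
  have : 0 < t * d by rewrite mulr_gt0.
  by move: Ht; rewrite mulrDr; nra.
(* As [d] tends to [0], [far] bounds the maximum of the distance from below. *)
have [x /set_mem Kx hx] := compact_EVT_max K0 cK (continuous_subspaceT cD).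
have Dx : D + h <= dist G x.
  apply/ler_addgt0Pr => e e0; pose d := Num.min (e / h) (1 / 2).
  have d01 : 0 < d < 1.
    rewrite lt_min !divr_gt0//= gt_min; apply/orP; right; lra.
  have [x' Kx' hx'] := far d d01; have := hx x' (mem_set Kx').
  have : d * h <= e by rewrite -ler_pdivlMr// ge_min lexx.
  by move: hx'; rewrite mulrBl mul1r; lra.
exists h => //; set u := D^-1 *: (y0 - xs).
have xsu : y0 - xs = D *: u by rewrite scalerA divff ?scale1r// gt_eqF.
have u1 : enorm u = 1.
  by rewrite enormZ ger0_norm ?invr_ge0 ?ltW// -De mulVf// gt_eqF.
have Dxs : dist G x <= enorm (x - xs) by exact: dist_le.
have xxs : x - xs = (x - y0) + D *: u by rewrite -xsu subrKA.
have Dh0 : 0 <= D + h by rewrite addr_ge0// ltW.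
have dh : h <= dot (x - y0) u.
  have : (D + h) ^+ 2 <= enorm (x - xs) ^+ 2.
    by rewrite ler_sqr ?nnegrE ?enorm_ge0//; exact: le_trans Dx Dxs.
  rewrite xxs enormD_sqr dotZr enormZ u1 mulr1 ger0_norm ?(ltW D0)//.
  have : enorm (x - y0) ^+ 2 <= h ^+ 2 by rewrite ler_sqr ?nnegrE ?enorm_ge0 ?(ltW h0).
  move=> h1 h2; suff : D * h <= D * dot (x - y0) u by rewrite ler_pM2l.
  by nra.
have xe : x = y0 + h *: u.
  apply/eqP; rewrite addrC -subr_eq -subr_eq0 -enorm_eq0 -sqrf_eq0 eq_le sqr_ge0 andbT.
  rewrite enormB_sqr dotZr enormZ u1 mulr1 real_normK ?num_real//.
  have : enorm (x - y0) ^+ 2 <= h ^+ 2 by rewrite ler_sqr ?nnegrE ?enorm_ge0 ?(ltW h0).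
  have : h * h <= h * dot (x - y0) u by rewrite ler_pM2l.
  by nra.
rewrite -xe; apply: (is_closestP cG G0) => //; apply: le_trans Dx.
by rewrite xxs (le_trans (enormD _ _))// enormZ u1 mulr1 ger0_norm ?(ltW D0)// addrC lerD2l.
Qed.

(** The larger ball about [y0 + h *: u] also meets [G] only on its boundary. Between
    it and the ball about [y0], which touches it from inside at [xs], the gap grows
    quadratically with the distance from [xs]. *)
Lemma closest_quadratic_growth y0 xs : is_closest G y0 xs ->
  ((dist G y0)%:E < reach G)%E ->
  exists2 c, 0 < c & forall q, G q ->
    enorm (y0 - xs) ^+ 2 + c * enorm (q - xs) ^+ 2 <= enorm (y0 - q) ^+ 2.
Proof.
move=> cxs lt; have De := dist_closest cxs; have [Gxs _] := cxs.
have [D0|D0] := ltrP 0 (dist G y0); last first.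
  have e0 : y0 = xs.
    by apply/eqP; rewrite -subr_eq0 -enorm_eq0 -De eq_le D0 De enorm_ge0.
  by exists 1 => // q _; rewrite e0 subrr enorm0 expr0n add0r mul1r enormBC.
have [h h0 [_ ch]] := closest_extends cxs lt D0.
set D := dist G y0 in ch D0 De *; set u := D^-1 *: (y0 - xs) in ch.
have xsu : y0 - xs = D *: u by rewrite scalerA divff ?scale1r// gt_eqF.
have u1 : enorm u = 1.
  by rewrite enormZ ger0_norm ?invr_ge0 ?ltW// -De mulVf// gt_eqF.
exists (h / (D + h)) => [|q Gq]; first by rewrite divr_gt0// addr_gt0.
have split_ (a : R) : enorm (a *: u - (q - xs)) ^+ 2 =
    a ^+ 2 - 2 * (a * dot u (q - xs)) + enorm (q - xs) ^+ 2.
  by rewrite (enormB_sqr (a *: u)) (dotZl a) (enormZ a) u1 mulr1 real_normK ?num_real.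
have e1 : y0 - q = D *: u - (q - xs) by rewrite -xsu opprB subrKA.
have e2 b : y0 + h *: u - b = (D + h) *: u - (b - xs).
  by rewrite scalerDl -xsu; move: (h *: u) => hu; apply/colP => i; rewrite !mxE; ring.
have Dh : 0 < D + h by rewrite addr_gt0.
rewrite -De e1 split_.
have : (D + h) ^+ 2 <= (D + h) ^+ 2 - 2 * ((D + h) * dot u (q - xs)) + enorm (q - xs) ^+ 2.
  rewrite -split_ -e2; have := ch q Gq; rewrite e2 subrr subr0 enormZ u1 mulr1.
  rewrite ger0_norm ?(ltW Dh)// => hq.
  by rewrite ler_sqr ?nnegrE ?enorm_ge0 ?(ltW Dh).
move: (dot _ _) (enorm _ ^+ 2) => s N hs.
rewrite -subr_ge0 -(pmulr_rge0 _ Dh).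
have -> : (D + h) * (D ^+ 2 - 2 * (D * s) + N - (D ^+ 2 + h / (D + h) * N)) =
  D * (N - 2 * ((D + h) * s)) by field; rewrite gt_eqF.
by rewrite mulr_ge0 ?(ltW D0)//; move: hs; lra.
Qed.

End BelowReach.

(** * Vectors of space split into horizontal part and height *)

Section LinearOnColumns.
Context {R : realType} {n : nat} {W : normedModType R} (f : 'cV[R]_n -> W).
Hypothesis lf : linear f.

Let fM := GRing.isLinear.Build _ _ _ _ _ lf.
Let fl : {linear 'cV[R]_n -> W} := HB.pack f fM.

Let fE x : f x = \sum_i x i 0 *: f (delta_mx i 0).
Proof.
rewrite -[f x]/(fl x) {1}(col_sum_delta x) linear_sum; apply: eq_bigr => i _.
by rewrite linearZ.
Qed.

Lemma linear_col_continuous : continuous f.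
Proof.
move=> x; rewrite (_ : f = fun x => \sum_i x i 0 *: f (delta_mx i 0)).
  apply: (@cvg_big _ _ _ _ _ (@add_continuous W) _ (nbhs x)) => i _.
  by apply: cvgZr_tmp; exact: coord_continuous.
by rewrite funeqE => u; exact: fE.
Qed.

Lemma linear_col_is_derive (E : normedModType R) (u : E -> 'cV[R]_n) x v du :
  is_derive x v u du -> is_derive x v (f \o u) (f du).
Proof.
move=> d; have cf : continuous fl by exact: linear_col_continuous.
have df : differentiable fl (u x) by exact: linear_differentiable.
by apply: is_derive_eq (is_derive_comp_diff df d) _; rewrite diff_lin.
Qed.

End LinearOnColumns.

Lemma is_derive_coord (R : realType) (E : normedModType R) n (u : E -> 'cV[R]_n) x v du i :
  is_derive x v u du -> is_derive x v (fun y => u y i 0) (du i 0).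
Proof.
by apply: (linear_col_is_derive (f := fun z : 'cV[R]_n => z i 0)) => a z z'; rewrite !mxE.
Qed.

Section Matrices.
Context {R : realType}.

Lemma mulmx_linear m n (A : 'M[R]_(m, n)) : linear (fun x : 'cV[R]_n => A *m x).
Proof. by move=> a u v; rewrite mulmxDr scalemxAr. Qed.

Lemma cvg_mulmx m n (A : 'M[R]_(m, n)) T (F : set_system T) {FF : Filter F}
    (u : T -> 'cV[R]_n) x :
  u t @[t --> F] --> x -> A *m u t @[t --> F] --> A *m x.
Proof.
move=> h; apply: (@cvg_comp _ _ _ u (fun x => A *m x) F _ _ h).
exact: (linear_col_continuous (@mulmx_linear _ _ A)).
Qed.

Lemma is_derive_mulmx (E : normedModType R) m n (A : 'M[R]_(m, n))
    (u : E -> 'cV[R]_n) x v du :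
  is_derive x v u du -> is_derive x v (fun y => A *m u y) (A *m du).
Proof. exact: (linear_col_is_derive (@mulmx_linear _ _ A)). Qed.

Lemma horizontal_vec3 (y : 'cV[R]_2) z : horizontal (vec3 y z) = y.
Proof. by rewrite /horizontal /vec3 col_mxKu. Qed.

Lemma height_vec3 (y : 'cV[R]_2) z : height (vec3 y z) = z.
Proof. by rewrite /height /vec3 col_mxKd mxE. Qed.

Lemma vec3_split (x : 'cV[R]_3) : vec3 (horizontal x) (height x) = x.
Proof.
rewrite /vec3 (_ : (height x)%:M = @dsubmx R 2 1 1 x) ?vsubmxK//.
by apply/matrixP => i j; rewrite !ord1 mxE eqxx mulr1n.
Qed.

Lemma heightD (u v : 'cV[R]_3) : height (u + v) = height u + height v.
Proof. by rewrite /height linearD mxE. Qed.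

Lemma heightZ a (u : 'cV[R]_3) : height (a *: u) = a * height u.
Proof. by rewrite /height linearZ mxE. Qed.

Lemma height0 : height (0 : 'cV[R]_3) = 0.
Proof. by rewrite /height linear0 mxE. Qed.

Lemma horizontal0 : horizontal (0 : 'cV[R]_3) = 0.
Proof. by rewrite /horizontal linear0. Qed.

Lemma horizontalD (u v : 'cV[R]_3) : horizontal (u + v) = horizontal u + horizontal v.
Proof. by rewrite /horizontal linearD. Qed.

Lemma horizontalZ a (u : 'cV[R]_3) : horizontal (a *: u) = a *: horizontal u.
Proof. by rewrite /horizontal linearZ. Qed.

Lemma horizontal_linear : linear (@horizontal R).
Proof. by move=> a u v; rewrite /horizontal linearP. Qed.

Lemma height_linear : linear (@height R : 'cV[R]_3 -> R).
Proof. by move=> a u v; rewrite /height linearP !mxE. Qed.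

Lemma vec3D (y y' : 'cV[R]_2) z z' : vec3 (y + y') (z + z') = vec3 y z + vec3 y' z'.
Proof.
by rewrite /vec3 raddfD/=; have := @add_col_mx R 2 1 1 y z%:M y' z'%:M; move=> <-.
Qed.

Lemma vec3N (y : 'cV[R]_2) z : vec3 (- y) (- z) = - vec3 y z.
Proof. by rewrite /vec3 raddfN/=; have := @opp_col_mx R 2 1 1 y z%:M; move=> <-. Qed.

Lemma vec3Z a (y : 'cV[R]_2) z : vec3 (a *: y) (a * z) = a *: vec3 y z.
Proof.
by rewrite /vec3 -scale_scalar_mx; have := @scale_col_mx R 2 1 1 a y z%:M; move=> <-.
Qed.

Lemma vec3B (y y' : 'cV[R]_2) z z' : vec3 (y - y') (z - z') = vec3 y z - vec3 y' z'.
Proof. by rewrite vec3D vec3N. Qed.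

Lemma vec3_0 : vec3 (0 : 'cV[R]_2) 0 = 0.
Proof. by rewrite /vec3 raddf0 col_mx0. Qed.

Lemma dot_vec3 (y y' : 'cV[R]_2) z z' : dot (vec3 y z) (vec3 y' z') = dot y y' + z * z'.
Proof.
rewrite /dot /vec3 (tr_col_mx y) (mul_row_col y^T) mxE; congr (_ + _).
by rewrite tr_scalar_mx -scalar_mxM mxE eqxx mulr1n.
Qed.

Lemma cvg_vec3 T (F : set_system T) {FF : Filter F} (u : T -> 'cV[R]_2) (a : T -> R) y z :
  u t @[t --> F] --> y -> a t @[t --> F] --> z -> vec3 (u t) (a t) @[t --> F] --> vec3 y z.
Proof.
move=> hu ha.
have -> : (fun t => vec3 (u t) (a t)) = (fun t => vec3 (u t) 0 + a t *: vec3 0 1).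
  by rewrite funeqE => t; rewrite -vec3Z scaler0 mulr1 -vec3D addr0 add0r.
have -> : vec3 y z = vec3 y 0 + z *: vec3 0 1.
  by rewrite -vec3Z scaler0 mulr1 -vec3D addr0 add0r.
apply: cvgD; last exact: cvgZr_tmp.
apply: (@cvg_comp _ _ _ u (fun x => vec3 x 0) F _ _ hu).
apply: (@linear_col_continuous R 2 'cV[R]_3 (fun x => vec3 x 0)) => b x x'.
by rewrite -vec3Z mulr0 -vec3D addr0.
Qed.

Lemma is_derive_vec3 (E : normedModType R) (u : E -> 'cV[R]_2) (a : E -> R) x v du da :
  is_derive x v u du -> is_derive x v a da ->
  is_derive x v (fun y => vec3 (u y) (a y)) (vec3 du da).
Proof.
move=> hu ha.
have lin : linear (fun y : 'cV[R]_2 => vec3 y 0).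
  by move=> b y y'; rewrite -vec3Z mulr0 -vec3D addr0.
have lin2 : linear (fun y : 'cV[R]_1 => vec3 0 (y 0 0)).
  by move=> b y y'; rewrite !mxE -vec3Z scaler0 -vec3D addr0.
have ha' : is_derive x v (fun y => (a y)%:M : 'cV[R]_1) da%:M.
  apply: is_derive_mx => i j; rewrite !ord1 mxE eqxx mulr1n.
  rewrite (_ : (fun y => _) = a)// funeqE => y; by rewrite mxE eqxx mulr1n.
have := is_deriveD (linear_col_is_derive lin hu) (linear_col_is_derive lin2 ha').
rewrite !mxE eqxx mulr1n -vec3D addr0 add0r; set f := (_ + _ : E -> _).
rewrite (_ : f = fun y => vec3 (u y) (a y))// funeqE => y.
by rewrite /f/= /GRing.add/= mxE eqxx mulr1n -vec3D addr0 add0r.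
Qed.

Lemma orthogonal_mxC n (Q : 'M[R]_n) : orthogonal_mx Q -> Q *m Q^T = 1%:M.
Proof. exact: mulmx1C. Qed.

Lemma orthogonalK n (Q : 'M[R]_n) (x : 'cV[R]_n) : orthogonal_mx Q -> Q^T *m (Q *m x) = x.
Proof. by move=> oQ; rewrite mulmxA oQ mul1mx. Qed.

Lemma orthogonalVK n (Q : 'M[R]_n) (x : 'cV[R]_n) : orthogonal_mx Q -> Q *m (Q^T *m x) = x.
Proof. by move=> oQ; rewrite mulmxA orthogonal_mxC// mul1mx. Qed.

Lemma dot_mulmxl n (Q : 'M[R]_n) (x y : 'cV[R]_n) : dot (Q *m x) y = dot x (Q^T *m y).
Proof. by rewrite /dot trmx_mul -mulmxA. Qed.

Lemma dot_orthogonal n (Q : 'M[R]_n) (x y : 'cV[R]_n) : orthogonal_mx Q ->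
  dot (Q *m x) (Q *m y) = dot x y.
Proof. by move=> oQ; rewrite dot_mulmxl orthogonalK. Qed.

Lemma dot_orthogonalV n (Q : 'M[R]_n) (x y : 'cV[R]_n) : orthogonal_mx Q ->
  dot (Q^T *m x) (Q^T *m y) = dot x y.
Proof. by move=> oQ; rewrite dot_mulmxl trmxK orthogonalVK. Qed.

Lemma enorm_orthogonal n (Q : 'M[R]_n) (x : 'cV[R]_n) : orthogonal_mx Q ->
  enorm (Q *m x) = enorm x.
Proof. by move=> oQ; rewrite /enorm dot_orthogonal. Qed.

Lemma dot_e_z (x : 'cV[R]_3) : dot x (e_z R) = height x.
Proof. by rewrite -{1}(vec3_split x) dot_vec3 dot0r add0r mulr1. Qed.

End Matrices.

Section LocalExtrema.
Context {R : realType}.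

Lemma local_min_derive (phi : R -> R) d : is_derive (0 : R) 1 phi d ->
  (\forall t \near (0 : R), phi 0 <= phi t) -> d = 0.
Proof.
move=> [dphi <-] hmin.
have cv : (fun h : R => h^-1 *: (phi (h + 0) - phi 0)) @ 0^' --> 'D_1 phi 0.
  move: dphi; rewrite /derivable /derive; set g := fun h => _; set g' := fun h => _.
  by have -> : g = g' by rewrite funeqE /g/g' => h /=; rewrite [h%:A]mulr1.
apply/eqP; rewrite -normr_le0 leNgt; apply/negP => d0.
have h1 := nbhs_dnbhs hmin; have h2 := (cvgrPdist_lt _ _).1 cv _ d0.
have /nbhs_ballP[e /= e0 he] : \forall t \near (0 : R), t != 0 ->
    phi 0 <= phi t /\
    `|'D_1 phi 0 - t^-1 *: (phi (t + 0) - phi 0)| < `|'D_1 phi 0|.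
  exact: (filterI h1 (h2 _)).
have pick (s : R) : `|s| = 1 -> 0 <= s * 'D_1 phi 0.
  move=> s1; have s0 : s != 0 by rewrite -normr_eq0 s1 oner_neq0.
  have e20 : e / 2 != 0 by rewrite gt_eqF// divr_gt0.
  have [|/=] := he (s * (e / 2)) _ (mulf_neq0 s0 e20).
    rewrite /ball/= sub0r normrN normrM s1 mul1r gtr0_norm ?divr_gt0//.
    by rewrite ltr_pdivrMr// mulr_natr mulr2n ltrDl.
  move=> ph; rewrite addr0.
  have : 0 <= s * ((s * (e / 2))^-1 *: (phi (s * (e / 2)) - phi 0)).
    rewrite [_ *: _]/(_ * _) invfM !mulrA divff// mul1r mulr_ge0 ?subr_ge0//.
    by rewrite invr_ge0 ltW// divr_gt0.
  set q := (_ *: _) => sq lt; rewrite leNgt; apply/negP => sD.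
  move: lt; apply/negP; rewrite -leNgt.
  have -> : `|'D_1 phi 0 - q| = `|s * q - s * 'D_1 phi 0|.
    by rewrite -mulrBr normrM s1 mul1r distrC.
  have -> : `|'D_1 phi 0| = - (s * 'D_1 phi 0).
    by rewrite -(ltr0_norm sD) normrM s1 mul1r.
  by rewrite ger0_norm; move: sq sD; lra.
have := pick 1; have := pick (-1); rewrite normrN normr1 mul1r mulN1r.
move=> /(_ erefl) a /(_ erefl) b; move: d0; rewrite normr_gt0; apply/negP; rewrite negbK.
by rewrite eq_le b -oppr_ge0 a.
Qed.
End LocalExtrema.

(** * Graph charts and outward normals *)

Lemma near_at_right (R : realType) (x : R) (P : R -> Prop) :
  (\forall t \near x, P t) -> \forall t \near x^'+, P t.
Proof. exact: cvg_within. Qed.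

Lemma cvg_line (R : realType) n (w v : 'cV[R]_n) : (fun t : R => t *: v + w) @ (0 : R) --> w.
Proof.
rewrite -[X in _ --> X]add0r -(scale0r v); apply: cvgD; last exact: cvg_cst.
by apply: cvgZr_tmp; exact: cvg_id.
Qed.

Section Charts.
Context {R : realType}.
Implicit Types (w v : 'cV[R]_2) (G : set 'cV[R]_3) (xs : 'cV[R]_3) (Q : 'M[R]_3) (h : 'cV[R]_2 -> R)
  (W U : set 'cV[R]_2) (V : set 'cV[R]_3).

Definition chart xs Q h (w : 'cV[R]_2) : 'cV[R]_3 := xs + Q *m vec3 w (h w).

Definition chart_coord xs Q (x : 'cV[R]_3) : 'cV[R]_2 := horizontal (Q^T *m (x - xs)).

Definition chart_tangent Q h (w v : 'cV[R]_2) : 'cV[R]_3 :=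
  Q *m vec3 v (dot (gradient h w) v).

(** The two inclusions between the graph of [h] and [G] near [xs] are kept apart:
    points of the graph over [W] need not lie in [V]. *)
Definition local_graph G xs Q h W V :=
  [/\ [/\ orthogonal_mx Q, open W, W 0 & nbhs xs V], Cinfty W h, h 0 = 0,
      forall w, W w -> G (chart xs Q h w) &
      forall x, V x -> G x ->
        W (chart_coord xs Q x) /\ x = chart xs Q h (chart_coord xs Q x)].

Lemma chart_frame xs Q h w : orthogonal_mx Q ->
  Q^T *m (chart xs Q h w - xs) = vec3 w (h w).
Proof. by move=> oQ; rewrite /chart addrC addKr orthogonalK. Qed.

Lemma chartK xs Q h w : orthogonal_mx Q -> chart_coord xs Q (chart xs Q h w) = w.
Proof. by move=> oQ; rewrite /chart_coord chart_frame// horizontal_vec3. Qed.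

Lemma chart0 xs Q h : h 0 = 0 -> chart xs Q h 0 = xs.
Proof. by move=> h0; rewrite /chart h0 vec3_0 mulmx0 addr0. Qed.

Lemma chart_coord0 xs Q : chart_coord xs Q xs = 0.
Proof.
by rewrite /chart_coord subrr mulmx0 -(@vec3_0 R) horizontal_vec3.
Qed.

Lemma cvg_frame xs Q T (F : set_system T) {FF : Filter F} (u : T -> 'cV[R]_3) (x : 'cV[R]_3) :
  u t @[t --> F] --> x -> Q^T *m (u t - xs) @[t --> F] --> Q^T *m (x - xs).
Proof. by move=> h; apply: cvg_mulmx; apply: cvgB => //; exact: cvg_cst. Qed.

Lemma cvg_horizontal T (F : set_system T) {FF : Filter F} (u : T -> 'cV[R]_3) (x : 'cV[R]_3) :
  u t @[t --> F] --> x -> horizontal (u t) @[t --> F] --> horizontal x.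
Proof.
move=> h; apply: (@cvg_comp _ _ _ u (@horizontal R) F _ _ h).
exact: (linear_col_continuous (@horizontal_linear R)).
Qed.

Lemma cvg_height T (F : set_system T) {FF : Filter F} (u : T -> 'cV[R]_3) (x : 'cV[R]_3) :
  u t @[t --> F] --> x -> height (u t) @[t --> F] --> height x.
Proof.
move=> h; apply: (@cvg_comp _ _ _ u (@height R) F _ _ h).
exact: (linear_col_continuous (@height_linear R)).
Qed.

Lemma chart_coord_continuous xs Q : continuous (chart_coord xs Q).
Proof.
by move=> x; apply: (@cvg_horizontal _ (nbhs x)); apply: cvg_frame; exact: cvg_id.
Qed.

Lemma chart_continuous xs Q h w : {for w, continuous h} ->
  {for w, continuous (chart xs Q h)}.
Proof.
move=> ch; apply: (@cvgD _ _ _ (nbhs w)); first exact: cvg_cst.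
by apply: cvg_mulmx; apply: cvg_vec3; [exact: cvg_id|exact: ch].
Qed.

Lemma Cinfty_continuous (E : normedModType R) (U : set E) (f : E -> R) x :
  Cinfty U f -> U x -> {for x, continuous f}.
Proof. by move=> /(_ 0%N)[+ _]; exact. Qed.

Lemma Cinfty_differentiable n (U : set 'cV[R]_n) f x :
  open U -> Cinfty U f -> U x -> differentiable (f : 'cV[R]_n -> R) x.
Proof. by move=> oU Cf; exact: C1_differentiable (Cf 1%N). Qed.

Lemma local_graph_exists G xs Q h U : orthogonal_mx Q -> open U -> U 0 ->
  Cinfty U h -> h 0 = 0 ->
  (\forall x \near xs, G x <-> exists2 w, U w & x = chart xs Q h w) ->
  exists W V, W `<=` U /\ local_graph G xs Q h W V.
Proof.
move=> oQ oU U0 Ch h0 nG; pose V0 := [set x | G x <-> exists2 w, U w & x = chart xs Q h w].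
have {}nG : nbhs xs V0 by [].
pose W := (U `&` (chart xs Q h @^-1` V0))°.
have W0 : W 0.
  apply: filterI; first exact: open_nbhs_nbhs (conj oU U0).
  have ch0 : {for 0, continuous (chart xs Q h)}.
    exact/chart_continuous/(Cinfty_continuous Ch).
  by apply: ch0; rewrite chart0.
have WU : W `<=` U by move=> w /interior_subset[].
exists W, (V0 `&` chart_coord xs Q @^-1` W); split; first exact: WU.
split.
- split; [exact: oQ|exact: open_interior|exact: W0|].
  apply: filterI => //; apply: chart_coord_continuous; rewrite chart_coord0.
  by apply: open_nbhs_nbhs; split=> //; exact: open_interior.
- by move=> k; exact: Ck_sub (Ch k).
- exact: h0.
- by move=> w /[dup] /interior_subset[Uw Vw] _; apply: (Vw.2); exists w.
- move=> x [V0x Wx] Gx; split=> //.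
  have [w Uw ->] := V0x.1 Gx.
  by rewrite chartK.
Qed.

Lemma gradientE h w v : differentiable h w -> 'D_v h w = dot (gradient h w) v.
Proof.
by move=> dh; rewrite derive_col// dotE; apply: eq_bigr => i _; rewrite mxE mulrC.
Qed.

Lemma is_derive_line_id n (w v : 'cV[R]_n) :
  is_derive (0 : R) (1 : R) (fun t : R => t *: v + w) v.
Proof.
have d : is_derive (0 : R) (1 : R) (fun t : R => t *: v) v.
  have := is_diff_scalel (0 : R) v => dl; split.
    by apply: diff_derivable.
  by rewrite deriveE// diff_val scale1r.
by have := is_deriveD d (is_derive_cst w (0 : R) (1 : R)); rewrite addr0.
Qed.

Lemma is_derive_chart xs Q h w v : differentiable h w ->
  is_derive (0 : R) (1 : R) (fun t : R => chart xs Q h (t *: v + w)) (chart_tangent Q h w v).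
Proof.
move=> dh; have dl := is_derive_line_id w v.
have dhl : is_derive (0 : R) (1 : R) (fun t : R => h (t *: v + w)) (dot (gradient h w) v).
  have dh' : differentiable h ((fun t : R => t *: v + w) 0) by rewrite scale0r add0r.
  apply: is_derive_eq (is_derive_comp_diff (u := fun t : R => t *: v + w) dh' dl) _.
  by rewrite /= scale0r add0r -gradientE// -deriveE.
have := is_deriveD (is_derive_cst xs (0 : R) (1 : R))
  (is_derive_mulmx Q (is_derive_vec3 dl dhl)).
by rewrite add0r.
Qed.

Lemma chart_tangentP G xs Q h W V w v : local_graph G xs Q h W V -> W w ->
  tangent G (chart xs Q h w) (chart_tangent Q h w v).
Proof.
move=> [[oQ oW W0 nV] Ch h0 GX _] Ww.
exists (fun t : R => chart xs Q h (t *: v + w)); split.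
- by rewrite scale0r add0r.
- have nW : \forall t \near (0 : R), W (t *: v + w).
    exact: (@cvg_line _ _ w v _ (open_nbhs_nbhs (conj oW Ww))).
  by apply: filterS nW => t; exact: GX.
- by apply: is_derive_chart; exact: Cinfty_differentiable Ch Ww.
Qed.

End Charts.

Section SmoothBoundary.
Context {R : realType} (G Om : set 'cV[R]_3) (xs : 'cV[R]_3).
Hypotheses (smG : smooth_surface_bounding G Om) (Gxs : G xs).

(** A defining function of [Om] near [xs] once [Om] is the set below the graph of
    [g] in the frame [Q]. *)
Definition graph_defect (Q : 'M[R]_3) (g : 'cV[R]_2 -> R) (x : 'cV[R]_3) : R :=
  height (Q^T *m (x - xs)) - g (chart_coord xs Q x).

Lemma graph_defect_continuous Q g : Cinfty setT g -> continuous (graph_defect Q g).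
Proof.
move=> Cg x; apply: (@cvgB _ _ _ (nbhs x)).
  by apply: cvg_height; apply: cvg_frame; exact: cvg_id.
apply: (@cvg_comp _ _ _ (chart_coord xs Q) g (nbhs x)).
  exact: chart_coord_continuous.
exact: (Cinfty_continuous Cg).
Qed.

Lemma graph_defect_eq0 Q g x : orthogonal_mx Q ->
  graph_defect Q g x = 0 <-> x = chart xs Q g (chart_coord xs Q x).
Proof.
move=> oQ; rewrite /graph_defect; split=> [/subr0_eq e|->].
  by rewrite /chart -e vec3_split orthogonalVK// addrC subrK.
by rewrite chartK// chart_frame// height_vec3 subrr.
Qed.

Lemma graph_defect_is_derive Q g (u : R -> 'cV[R]_3) v : Cinfty setT g ->
  is_derive (0 : R) (1 : R) u v ->
  is_derive (0 : R) (1 : R) (fun t : R => graph_defect Q g (u t))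
    (height (Q^T *m v) - dot (gradient g (chart_coord xs Q (u 0))) (horizontal (Q^T *m v))).
Proof.
move=> Cg du.
have d1 : is_derive (0 : R) (1 : R) (fun t : R => u t - xs) v.
  by have := is_deriveD du (is_derive_cst (- xs) (0 : R) (1 : R)); rewrite addr0.
have d2 := is_derive_mulmx Q^T d1.
have dh := linear_col_is_derive (@height_linear R) d2.
have dk := linear_col_is_derive (@horizontal_linear R) d2.
have dg : differentiable g (chart_coord xs Q (u 0)) by exact: Cinfty_differentiable openT Cg I.
have := is_deriveB dh (is_derive_comp_diff (u := fun t => chart_coord xs Q (u t)) dg dk).
by rewrite -deriveE// gradientE.
Qed.

(** Near [xs], a point with positive defect has a neighbourhood outside [Om], and a
    point with defect zero is a limit of points straight below it, which lie in [Om]; so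
    the boundary is the zero set of the defect. *)
Lemma smooth_boundary_defect : exists Q g,
  [/\ orthogonal_mx Q, Cinfty setT g, g 0 = 0 &
   \forall x \near xs, [/\ Om x <-> graph_defect Q g x < 0,
     G x <-> graph_defect Q g x = 0 &
     0 < graph_defect Q g x -> ~ closure Om x]].
Proof.
have [oOm bOm GE sb] := smG; have Bxs : boundary Om xs by rewrite -GE.
have [Q [g0 [oQ Cg0 nOm]]] := sb xs Bxs.
pose D := graph_defect Q g0.
have cD : continuous D by exact: graph_defect_continuous.
pose N := [set x | Om x <-> D x < 0].
have nN : nbhs xs N.
  by apply: filterS nOm => y /= h; rewrite /N /D /graph_defect /= subr_lt0; exact: h.
have key : \forall x \near xs, [/\ Om x <-> D x < 0, G x <-> D x = 0 &
     0 < D x -> ~ closure Om x].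
  apply: filterS (nbhs_interior nN) => x Nx.
  have OmP := nbhs_singleton Nx.
  have outer : 0 < D x -> ~ closure Om x.
    move=> D0 /(_ ([set y | 0 < D y] `&` N)) [].
      by apply: filterI => //; exact: (cvgr_gt _ (cD x) _ D0).
    by move=> y [Omy [/= Dy Ny]]; have := Ny.1 Omy; rewrite ltNge (ltW Dy).
  split=> //; rewrite GE; split.
    move=> [cOm iOm]; have [D0|D0|//] := ltgtP (D x) 0.
      exfalso; apply: iOm.
      exact: open_nbhs_nbhs (conj oOm (OmP.2 D0)).
    by case: (outer D0).
  move=> Dx; split; last first.
    by move=> /interior_subset /OmP.1; rewrite Dx ltxx.
  move=> B nB.
  pose v := Q *m vec3 0 (-1).
  have cl : (fun t : R => x + t *: v) @ (0 : R) --> x.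
    rewrite -[X in _ --> X]addr0 -(scale0r v); apply: cvgD; first exact: cvg_cst.
    by apply: cvgZr_tmp; exact: cvg_id.
  have nB' : \forall t \near (0 : R), B (x + t *: v) /\ N (x + t *: v).
    exact: (cl _ (filterI nB Nx)).
  have n0 : \forall t \near (0 : R)^'+, 0 < t by exact: nbhs_right_gt.
  have nB2 := near_at_right nB'.
  have [t [[Bt Nt] t0]] := @filter_ex _ (0 : R)^'+ _ _ (filterI nB2 n0).
  exists (x + t *: v); split=> //; apply: Nt.2.
  have fr : Q^T *m (x + t *: v - xs) = Q^T *m (x - xs) + vec3 0 (- t).
    rewrite addrAC mulmxDr; congr (_ + _).
    by rewrite /v -scalemxAr orthogonalK// -vec3Z scaler0 mulrN1.
  rewrite /D /graph_defect /chart_coord fr -(vec3_split (Q^T *m (x - xs))).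
  rewrite -vec3D height_vec3 horizontal_vec3 addr0.
  have : D x = 0 by []; rewrite /D/graph_defect/chart_coord => /subr0_eq ->.
  by rewrite addrAC subrr add0r oppr_lt0.
exists Q, g0; split=> //.
have [_ [/(_ Gxs) + _] _] := nbhs_singleton key.
rewrite /D /graph_defect chart_coord0 subrr mulmx0 -(@vec3_0 R) height_vec3.
by move=> /eqP; rewrite sub0r oppr_eq0 => /eqP.
Qed.

End SmoothBoundary.

Section Normals.
Context {R : realType}.
Implicit Types (Q : 'M[R]_3) (h : 'cV[R]_2 -> R) (v w : 'cV[R]_2) (m : 'cV[R]_3).

Lemma near_right_gt0 (f : R -> R) d : is_derive (0 : R) (1 : R) f d -> f 0 = 0 -> 0 < d ->
  \forall t \near (0 : R)^'+, 0 < f t.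
Proof.
move=> [df <-] f0 d0.
have cv : (fun t : R => t^-1 * f t) @ 0^' --> 'D_1 f 0.
  have e : (fun t : R => t^-1 *: ((f \o shift 0) t%:A - f 0)) = (fun t => t^-1 * f t).
    by rewrite funeqE => t /=; rewrite [t%:A]mulr1 addr0 f0 subr0.
  by move: df; rewrite /derivable /derive e.
have n1 : \forall t \near (0 : R), t != 0 -> 0 < t^-1 * f t.
  exact: (cvgr_gt _ cv _ d0).
have n2 := near_at_right n1.
have n3 : \forall t \near (0 : R)^'+, 0 < t by exact: nbhs_right_gt.
apply: filterS2 n2 n3 => t h t0.
by have := h (lt0r_neq0 t0); rewrite pmulr_rgt0// invr_gt0.
Qed.

Definition graph_normal (Q : 'M[R]_3) (h : 'cV[R]_2 -> R) (w : 'cV[R]_2) : 'cV[R]_3 :=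
  (Num.sqrt (1 + dot (gradient h w) (gradient h w)))^-1 *:
    (Q *m vec3 (- gradient h w) 1).

Let slant_gt0 (a : 'cV[R]_2) : 0 < 1 + dot a a.
Proof. by rewrite ltr_wpDr// dot_ge0. Qed.

(** The tangent vectors of the graph fill a plane, so that a vector orthogonal to
    them is determined by its last coordinate in the frame. *)
Lemma chart_tangent_orthogonal Q h w m : orthogonal_mx Q ->
  (forall v, dot m (chart_tangent Q h w v) = 0) ->
  m = height (Q^T *m m) *: (Q *m vec3 (- gradient h w) 1).
Proof.
move=> oQ mT; set c := height _.
have ha : horizontal (Q^T *m m) = - (c *: gradient h w).
  apply/eqP; rewrite -addr_eq0 -dot_eq0; set u := _ + _; apply/eqP.
  have := mT u; rewrite /chart_tangent dotC dot_mulmxl -{1}(vec3_split (Q^T *m m)) dot_vec3.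
  rewrite -/c; have -> : dot (gradient h w) u * c = dot (c *: gradient h w) u.
    by rewrite dotZl mulrC.
  by rewrite (dotC u) -dotDl.
rewrite -{1}(orthogonalVK m oQ) -{1}(vec3_split (Q^T *m m)) ha -/c.
by rewrite [RHS]scalemxAr -vec3Z mulr1 scalerN.
Qed.

Lemma enorm_graph_normal Q h w : orthogonal_mx Q -> enorm (graph_normal Q h w) = 1.
Proof.
move=> oQ; rewrite enormZ enorm_orthogonal// /enorm dot_vec3 dotNl dotNr opprK.
rewrite mulr1 [_ + 1]addrC ger0_norm ?invr_ge0 ?sqrtr_ge0// mulVf// gt_eqF// sqrtr_gt0.
exact: slant_gt0.
Qed.

(** The defect increases at a positive rate in the direction of the graph normal,
    which is therefore outward. The only other unit vector orthogonal to the
    tangent plane points inward. *)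
Lemma outward_unit_normalE (G Om : set 'cV[R]_3) xs Q g :
  smooth_surface_bounding G Om -> orthogonal_mx Q -> Cinfty setT g ->
  (\forall x \near xs, [/\ Om x <-> graph_defect xs Q g x < 0,
     G x <-> graph_defect xs Q g x = 0 &
     0 < graph_defect xs Q g x -> ~ closure Om x]) ->
  \forall x \near xs, G x ->
    is_outward_unit_normal Om x (graph_normal Q g (chart_coord xs Q x)) /\
    outward_unit_normal Om x = graph_normal Q g (chart_coord xs Q x).
Proof.
move=> [_ _ GE _] oQ Cg nD; apply: filterS (nbhs_interior nD) => x nN Gx; set w := chart_coord xs Q x.
set m := graph_normal Q g w; set s := Num.sqrt (1 + dot (gradient g w) (gradient g w)).
have s0 : 0 < s by rewrite sqrtr_gt0 slant_gt0.
have dg : differentiable g w by exact: Cinfty_differentiable openT Cg I.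
have [_ GD _] := nbhs_singleton nN; have D0 := GD.1 Gx.
have xE : x = chart xs Q g w by exact: (graph_defect_eq0 _ _ _ oQ).1.
have Qm : Q^T *m m = s^-1 *: vec3 (- gradient g w) 1.
  by rewrite /m /graph_normal -scalemxAr orthogonalK.
have slope : height (Q^T *m m) - dot (gradient g w) (horizontal (Q^T *m m)) = s.
  rewrite Qm -vec3Z height_vec3 horizontal_vec3 mulr1 dotZr dotNr mulrN opprK.
  rewrite -[X in X + _]mulr1 -mulrDr -[X in _^-1 * X]sqr_sqrtr ?(ltW (slant_gt0 _))//.
  by rewrite -/s expr2 mulrA mulVf ?mul1r// gt_eqF.
have dD (a : R) : is_derive (0 : R) (1 : R)
    (fun t : R => graph_defect xs Q g (t *: (a *: m) + x)) (a * s).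
  have dl : is_derive (0 : R) (1 : R) (fun t : R => t *: (a *: m) + x) (a *: m).
    exact: is_derive_line_id.
  apply: is_derive_eq (graph_defect_is_derive xs Q Cg dl) _.
  rewrite scale0r add0r -scalemxAr -(vec3_split (Q^T *m m)) -vec3Z height_vec3 horizontal_vec3.
  by rewrite dotZr -mulrBr -/w slope.
have away : \forall t \near (0 : R)^'+, ~ closure Om (x + t *: m).
  have n1 := near_right_gt0 (dD 1) _ (mulr_gt0 ltr01 s0).
  have {}n1 := n1 _; rewrite scale0r add0r scale1r D0 in n1.
  have n2 := near_at_right (@cvg_line _ _ x m _ nN).
  by apply: filterS2 (n1 erefl) n2 => t ht [_ _ kt]; rewrite addrC; exact: kt ht.
have inside : \forall t \near (0 : R)^'+, Om (x - t *: m).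
  have dN : is_derive (0 : R) (1 : R)
      (fun t : R => - graph_defect xs Q g (t *: ((-1) *: m) + x)) s.
    by apply: is_derive_eq (is_deriveN (dD (-1))) _; rewrite mulN1r opprK.
  have n1 := near_right_gt0 dN _ s0.
  rewrite scale0r add0r scaleN1r D0 oppr0 in n1.
  have n2 := near_at_right (@cvg_line _ _ x (- m) _ nN).
  apply: filterS2 (n1 erefl) n2 => t ht [/= kt _ _].
  by move: ht; rewrite oppr_gt0 => /kt.2; rewrite scalerN addrC.
have tang v : tangent (boundary Om) x (chart_tangent Q g w v).
  exists (fun t : R => chart xs Q g (t *: v + w)); split.
  - by rewrite scale0r add0r -xE.
  - have cX : (fun t : R => chart xs Q g (t *: v + w)) @ (0 : R) --> x.
      rewrite {1}xE; apply: (@cvg_comp _ _ _ (fun t : R => t *: v + w) (chart xs Q g)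
        (nbhs (0 : R)) (nbhs w)); first exact: cvg_line.
      by apply: chart_continuous; exact: (Cinfty_continuous Cg).
    pose N := [set x | [/\ Om x <-> graph_defect xs Q g x < 0,
      G x <-> graph_defect xs Q g x = 0 & 0 < graph_defect xs Q g x -> ~ closure Om x]].
    have nX : \forall t \near (0 : R), N (chart xs Q g (t *: v + w)) := cX N nN.
    apply: filterS nX => t [_ + _]; rewrite GE => ->.
    by apply/(graph_defect_eq0 _ _ _ oQ); rewrite chartK.
  - exact: is_derive_chart.
have mP : is_outward_unit_normal Om x m.
  split; first exact: enorm_graph_normal.
    move=> v [gam [gam0 gamG dgam]].
    have cgam : gam t @[t --> (0 : R)] --> x.
      rewrite -gam0; apply: differentiable_continuous.
      by apply/derivable1_diffP; exact: ex_derive.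
    have e0 : is_derive (0 : R) (1 : R) (fun t : R => graph_defect xs Q g (gam t)) 0.
      apply: near_eq_is_derive (is_derive_cst 0 _ _).
      rewrite -GE in gamG; have ng : \forall t \near (0 : R), G (gam t) <-> graph_defect xs Q g (gam t) = 0.
        by apply: (cgam (fun x => G x <-> graph_defect xs Q g x = 0)); apply: filterS nN => y [].
      apply: filterS2 gamG ng => t Gt.
      by case=> /(_ Gt)/= <-.
    have [_ e1] := graph_defect_is_derive xs Q Cg dgam.
    have [_ e2] := e0; rewrite e2 gam0 -/w in e1.
    rewrite -(dot_orthogonalV _ _ oQ) Qm dotZl -(vec3_split (Q^T *m v)) dot_vec3 mul1r.
    by rewrite dotNl addrC -e1 mulr0.
  by apply: filterS2 inside away => t.
split=> //; rewrite /outward_unit_normal.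
suff uniq k : is_outward_unit_normal Om x k -> k = m.
  by apply: uniq; exact: (@xgetPex _ 0 [set k | is_outward_unit_normal Om x k] (ex_intro _ m mP)).
move=> [k1 kT kin].
have := chart_tangent_orthogonal oQ (fun v => kT _ (tang v)).
set c := height _ => kE.
have {kE}kE : k = (c * s) *: m.
  by rewrite kE /m /graph_normal scalerA -mulrA divff ?mulr1// gt_eqF.
have : `|c * s| = 1 by rewrite -k1 kE enormZ enorm_graph_normal// mulr1.
have [cs0|cs0] := lerP 0 (c * s).
  by rewrite ger0_norm// => cs; rewrite kE cs scale1r.
rewrite ltr0_norm// => cs.
have {}kE : k = - m by rewrite kE -[c * s]opprK cs scaleN1r.
have [t [[Om1 _] nOm]] := @filter_ex _ (0 : R)^'+ _ _ (filterI kin away).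
by case: nOm; apply: subset_closure; move: Om1; rewrite kE scalerN opprK.
Qed.

Lemma smooth_surface_chart (G Om : set 'cV[R]_3) xs :
  smooth_surface_bounding G Om -> G xs ->
  exists Q g W V, local_graph G xs Q g W V /\
    \forall x \near xs, G x ->
      is_outward_unit_normal Om x (graph_normal Q g (chart_coord xs Q x)) /\
      outward_unit_normal Om x = graph_normal Q g (chart_coord xs Q x).
Proof.
move=> smG Gxs; have [Q [g [oQ Cg g0 nD]]] := smooth_boundary_defect smG Gxs.
have [|W [V [_ lg]]] := @local_graph_exists _ G xs Q g setT oQ openT I Cg g0.
  apply: filterS nD => x [_ GD _]; rewrite GD graph_defect_eq0//.
  by split=> [->|[w _ ->]]; [eexists|rewrite chartK].
by exists Q, g, W, V; split=> //; exact: outward_unit_normalE nD.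
Qed.

End Normals.

(** * The foot-point equation *)

Section FootEquation.
Context {R : realType}.
Implicit Types (h : 'cV[R]_2 -> R) (Z x xs : 'cV[R]_3) (w v : 'cV[R]_2).
Local Notation "''d_' i f" := (derive f ^~ (delta_mx i 0))
  (at level 10, i, f at next level, format "''d_' i  f").

Lemma is_derive_dot (E : normedModType R) n (u u' : E -> 'cV[R]_n) (x v : E) du du' :
  is_derive x v u du -> is_derive x v u' du' ->
  is_derive x v (fun y => dot (u y) (u' y)) (dot du (u' x) + dot (u x) du').
Proof.
move=> d d'.
rewrite (_ : (fun y => _) = \sum_i (fun y => u y i 0 * u' y i 0)); last first.
  by rewrite funeqE => y; rewrite dotE fct_sumE.
rewrite !dotE -big_split/=; apply: is_derive_sum => i.
apply: is_derive_eq (is_deriveM (is_derive_coord i d) (is_derive_coord i d')) _.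
by rewrite addrC; congr (_ + _); exact: mulrC.
Qed.

(** Up to the factor [2], the partial derivatives in [w] of the squared distance
    from the point [Z], in the coordinates of the frame, to the graph of [h]. *)
Definition foot_eq h Z w (i : 'I_2) : R :=
  w i 0 - horizontal Z i 0 + (h w - height Z) * 'd_i h w.

(** Half the Hessian in [w] of the same squared distance. *)
Definition foot_hess h Z w : 'M[R]_2 :=
  \matrix_(i, j) ((i == j)%:R + 'd_j h w * 'd_i h w + (h w - height Z) * 'd_j ('d_i h) w).

(** Half the derivative, along the tangent vector of direction [v], of the squared
    distance from [x] to the graph. *)
Lemma foot_eq_tangent xs Q h w x v : orthogonal_mx Q ->
  \sum_i v i 0 * foot_eq h (Q^T *m (x - xs)) w i =
  dot (chart xs Q h w - x) (chart_tangent Q h w v).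
Proof.
move=> oQ; rewrite dotC /chart_tangent dot_mulmxl.
have -> : chart xs Q h w - x = (chart xs Q h w - xs) - (x - xs) by rewrite opprB addrA subrK.
rewrite (mulmxBr Q^T (chart xs Q h w - xs)) chart_frame//.
rewrite -(vec3_split (Q^T *m (x - xs))) -vec3B dot_vec3 !dotE mulr_suml -big_split/=.
apply: eq_bigr => i _; rewrite /foot_eq horizontal_vec3 height_vec3 !mxE; ring.
Qed.

Lemma foot_eq_coord xs Q h w x i : orthogonal_mx Q ->
  foot_eq h (Q^T *m (x - xs)) w i =
  dot (chart xs Q h w - x) (chart_tangent Q h w (delta_mx i 0)).
Proof.
move=> oQ; rewrite -foot_eq_tangent// (bigD1 i)//= mxE !eqxx mul1r big1 ?addr0// => j ji.
by rewrite mxE (negbTE ji) mul0r.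
Qed.

Lemma is_derive_chart_dir xs Q h w v : differentiable h w ->
  is_derive w v (chart xs Q h) (chart_tangent Q h w v).
Proof.
move=> dh; have d : is_derive w v h (dot (gradient h w) v).
  by split; [exact: diff_derivable|exact: gradientE].
have := is_deriveD (is_derive_cst xs w v)
  (is_derive_mulmx Q (is_derive_vec3 (is_derive_id w v) d)).
by rewrite add0r.
Qed.

(** At a closest point the squared distance is stationary along the graph. *)
Lemma closest_foot_eq G xs Q h W V w x : local_graph G xs Q h W V -> W w ->
  is_closest G x (chart xs Q h w) -> forall i, foot_eq h (Q^T *m (x - xs)) w i = 0.
Proof.
move=> [[oQ oW W0 nV] Ch h0 GX XG] Ww [_ hmin] i; rewrite foot_eq_coord//.
set v := delta_mx i 0.
have dX := is_derive_chart xs Q v (Cinfty_differentiable oW Ch Ww).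
have dX' : is_derive (0 : R) (1 : R) (fun t : R => chart xs Q h (t *: v + w) - x)
    (chart_tangent Q h w v).
  by have := is_deriveD dX (is_derive_cst (- x) (0 : R) (1 : R)); rewrite addr0.
have := is_derive_dot dX' dX'; rewrite scale0r add0r.
move=> /local_min_derive h2.
suff : dot (chart_tangent Q h w v) (chart xs Q h w - x) +
  dot (chart xs Q h w - x) (chart_tangent Q h w v) = 0 by rewrite dotC -mulr2n => /eqP; rewrite mulrn_eq0 => /eqP.
apply: h2; rewrite scale0r add0r.
have nW : \forall t \near (0 : R), W (t *: v + w).
  exact: (@cvg_line _ _ w v _ (open_nbhs_nbhs (conj oW Ww))).
apply: filterS nW => t Wt.
rewrite -!enorm_sqr ler_sqr ?nnegrE ?enorm_ge0// !(enormBC _ x).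
by apply: hmin; exact: GX.
Qed.

Section FootDerivative.
Context {E : normedModType R} (W : set 'cV[R]_2) (h : 'cV[R]_2 -> R)
  (w : E -> 'cV[R]_2) (Z : E -> 'cV[R]_3) (x : E).
Hypotheses (oW : open W) (Ch : Cinfty W h) (Wx : W (w x)).

Let dhd : differentiable h (w x).
Proof. exact: Cinfty_differentiable Ch Wx. Qed.

Let ddh i : differentiable ('d_i h) (w x).
Proof.
by apply: Cinfty_differentiable oW _ Wx => k; have [_ /(_ (delta_mx i 0))[]] := Ch k.+1.
Qed.

Lemma foot_eq_is_derive i (v : E) dw dZ : is_derive x v w dw -> is_derive x v Z dZ ->
  is_derive x v (fun y => foot_eq h (Z y) (w y) i)
    ((foot_hess h (Z x) (w x) *m dw) i 0
      - (horizontal dZ i 0 + height dZ * 'd_i h (w x))).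
Proof.
move=> d d'.
have dc := is_derive_coord i d.
have dz := is_derive_coord i (linear_col_is_derive (@horizontal_linear R) d').
have dt := linear_col_is_derive (@height_linear R) d'.
have dh := is_derive_comp_diff dhd d.
have ddi := is_derive_comp_diff (ddh i) d.
have e : (foot_hess h (Z x) (w x) *m dw) i 0 = dw i 0
    + (\sum_j dw j 0 * 'd_j h (w x)) * 'd_i h (w x)
    + (h (w x) - height (Z x)) * \sum_j dw j 0 * 'd_j ('d_i h) (w x).
  rewrite mxE mulr_suml mulr_sumr -[dw i 0 in RHS]mul1r.
  have -> : 1 * dw i 0 = \sum_j (i == j)%:R * dw j 0.
    rewrite (bigD1 i)//= eqxx big1 ?addr0// => j ji.
    by rewrite eq_sym (negbTE ji) mul0r.
  by rewrite -!big_split/=; apply: eq_bigr => j _; rewrite mxE; ring.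
apply: is_derive_eq (is_deriveD (is_deriveB dc dz) (is_deriveM (is_deriveB dh dt) ddi)) _.
rewrite !diff_col// e.
have sc (a b : R) : a *: (b : R^o) = a * b by [].
have fB : ((h \o w) - (@height R \o Z)) x = h (w x) - height (Z x) by [].
rewrite !sc fB [(_ \o w) x]/=.
have key (a z1 k s1 D s2 z2 : R) :
  a - z1 + (k * s1 + D * (s2 - z2)) = a + s2 * D + k * s1 - (z1 + z2 * D) by ring.
exact: key.
Qed.

Lemma foot_eq_differentiable i : differentiable w x -> differentiable Z x ->
  differentiable (fun y => foot_eq h (Z y) (w y) i) x.
Proof.
move=> d d'.
have lin n (f : 'cV[R]_n -> R) (u : E -> 'cV[R]_n) : linear f -> differentiable u x ->
    differentiable (f \o u) x.
  move=> lf du; apply: differentiable_comp => //.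
  pose fM := GRing.isLinear.Build _ _ _ _ _ lf.
  pose fl : {linear 'cV[R]_n -> R} := HB.pack f fM.
  by apply: (@linear_differentiable _ _ _ fl); exact: linear_col_continuous.
have dc : differentiable (fun y => w y i 0) x.
  apply: (lin _ (fun z : 'cV[R]_2 => z i 0)) d.
  by move=> a z z'; rewrite !mxE.
have dz : differentiable (fun y => horizontal (Z y) i 0) x.
  apply: (lin _ (fun z : 'cV[R]_3 => horizontal z i 0)) d'.
  by move=> a z z'; rewrite horizontal_linear !mxE.
have dt := lin _ _ _ (@height_linear R) d'.
have dh := differentiable_comp d dhd.
have ddi := differentiable_comp d (ddh i).
exact: differentiableD (differentiableB dc dz) (differentiableM (differentiableB dh dt) ddi).
Qed.

End FootDerivative.

(** Quadratic growth of the squared distance away from [xs] excludes a null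
    direction of its Hessian there. *)
Lemma foot_hess_unit G xs Q h W V x c : local_graph G xs Q h W V ->
  is_closest G x xs -> 0 < c ->
  (forall q, G q -> enorm (x - xs) ^+ 2 + c * enorm (q - xs) ^+ 2 <= enorm (x - q) ^+ 2) ->
  foot_hess h (Q^T *m (x - xs)) 0 \in unitmx.
Proof.
move=> lg cl c0 growth; have [[oQ oW W0 nV] Ch h0 GX XG] := lg.
set Z := Q^T *m (x - xs); set H := foot_hess h Z 0.
rewrite unitmxE unitfE; apply/negP => /det0P[v vN0 vH].
have {vH}vH : v *m H *m v^T = 0 by rewrite vH mul0mx.
pose u := v^T; have uN0 : u != 0 by apply: contra vN0 => /eqP e; rewrite -[v]trmxK -/u e trmx0.
have nu : 0 < enorm u ^+ 2 by rewrite exprn_gt0// enorm_gt0.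
have clW : is_closest G x (chart xs Q h 0) by rewrite chart0.
pose S (t : R) := \sum_i u i 0 * foot_eq h Z (t *: u) i.
have S0 : S 0 = 0.
  by rewrite /S big1// => i _; rewrite scale0r (closest_foot_eq lg W0 clW) mulr0.
have dl : is_derive (0 : R) (1 : R) (fun t : R => t *: u) u.
  have := is_derive_line_id 0 u.
  by rewrite (_ : (fun t : R => _) = fun t : R => t *: u)// funeqE => t; rewrite addr0.
have dS : is_derive (0 : R) (1 : R) S 0.
  have di i : is_derive (0 : R) (1 : R) (fun t : R => u i 0 * foot_eq h Z (t *: u) i)
      (u i 0 * (H *m u) i 0).
    have W0' : W (0 *: u) by rewrite scale0r.
    have := is_deriveZ (u i 0) (foot_eq_is_derive (w := fun t : R => t *: u) (Z := cst Z) oW Ch W0' i dl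
      (is_derive_cst Z (0 : R) (1 : R))).
    move=> dd; apply: is_derive_eq dd _; rewrite scale0r -/H.
    rewrite -(@vec3_0 R) horizontal_vec3 height_vec3 mul0r addr0 mxE.
    by rewrite [X in _ - X]mxE subr0.
  rewrite /S (_ : (fun t : R => _) = \sum_i (fun t : R => u i 0 * foot_eq h Z (t *: u) i)).
    apply: is_derive_eq (is_derive_sum di) _.
    rewrite -[RHS](_ : (v *m H *m v^T) 0 0 = 0); last by rewrite vH mxE.
    by rewrite -mulmxA mxE; apply: eq_bigr => i _; rewrite /u !mxE.
  by rewrite funeqE => t; rewrite fct_sumE.
pose phi (w : 'cV[R]_2) := dot (chart xs Q h w - x) (chart xs Q h w - x).
have dphi w : W w -> is_derive w u phi
    (2 * dot (chart xs Q h w - x) (chart_tangent Q h w u)).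
  move=> Ww; have dX : is_derive w u (fun w => chart xs Q h w - x) (chart_tangent Q h w u).
    have := is_deriveD (is_derive_chart_dir xs Q u (Cinfty_differentiable oW Ch Ww))
      (is_derive_cst (- x) w u).
    by rewrite addr0.
  by apply: is_derive_eq (is_derive_dot dX dX) _; rewrite dotC mulr_natl mulr2n.
have nW : \forall t \near (0 : R), W (t *: u + 0).
  exact: (@cvg_line _ _ 0 u _ (open_nbhs_nbhs (conj oW W0))).
(* A null direction [u] makes [S t = o(t)]. By the mean value theorem the bound
   [e * t] on [S] limits the growth of [phi] to half of what is assumed. *)
pose e := c * enorm u ^+ 2 / 4.
have e0 : 0 < e by rewrite divr_gt0// mulr_gt0.
have nS : \forall t \near (0 : R), t != 0 -> `|t^-1 * S t| <= e.
  have [dS1 dS2] := dS; move: dS1; rewrite /derivable -/(derive S 0 1) => dS1.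
  have cv : (fun t : R => t^-1 *: ((S \o shift 0) t%:A - S 0)) @ 0^' --> (0 : R).
    by rewrite -[X in _ --> X]dS2.
  have := (cvgrPdist_le _ _).1 cv e e0; move=> /(_ _) cv'.
  have {}cv' : \forall t \near (0 : R), t != 0 ->
    `|0 - t^-1 *: ((S \o shift 0) t%:A - S 0)| <= e by exact: cv'.
  apply: filterS cv' => t + tN0 => /(_ tN0).
  by rewrite sub0r normrN S0 subr0 /= addr0 [t%:A]mulr1.
have /nbhs_ballP[d /= d0 hd] : \forall t \near (0 : R),
    W (t *: u + 0) /\ (t != 0 -> `|t^-1 * S t| <= e) by apply: filterS2 nW nS.
have {}hd t : `|t| < d -> W (t *: u + 0) /\ `|S t| <= e * `|t|.
  move=> td; have [|W1 S1] := hd t; first by rewrite /ball/= sub0r normrN.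
  split=> //; have [->|tN0] := eqVneq t 0; first by rewrite S0 !normr0 mulr0.
  by have := S1 tN0; rewrite normrM normfV ler_pdivrMl ?normr_gt0// mulrC.
have t0 : 0 < d / 2 by rewrite divr_gt0.
set t := d / 2 in t0; have td : `|t| < d.
  by rewrite gtr0_norm// /t ltr_pdivrMr// mulr_natr mulr2n ltrDl.
have [k kt Hk] := @mean_value _ _ phi 0 u t (fun k kt =>
  ex_derive (is_derive := dphi _ (hd k (le_lt_trans kt td)).1)).
have [Wk Sk] := hd k (le_lt_trans kt td).
have [_ Dk] := dphi _ Wk; rewrite {}Dk -foot_eq_tangent// -/Z [k *: u + 0]addr0 -/(S k) in Hk.
have [Wt _] := hd t td; rewrite addr0 in Wt Hk.
have := growth _ (GX _ Wt); rewrite !enorm_sqr.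
have -> : dot (x - chart xs Q h (t *: u)) (x - chart xs Q h (t *: u)) = phi (t *: u).
  by rewrite /phi -[x - _]opprB dotNl dotNr opprK.
have -> : dot (x - xs) (x - xs) = phi 0.
  by rewrite /phi chart0// -[x - xs]opprB dotNl dotNr opprK.
have -> : dot (chart xs Q h (t *: u) - xs) (chart xs Q h (t *: u) - xs) =
    t ^+ 2 * enorm u ^+ 2 + h (t *: u) ^+ 2.
  by rewrite -(dot_orthogonalV _ _ oQ) chart_frame// dot_vec3 dotZl dotZr enorm_sqr; ring.
move=> gr; move: (sqr_ge0 (h (t *: u))) => h2.
have {}Sk : `|S k| <= e * t.
  by apply: le_trans Sk _; rewrite ler_pM2l//; move: kt; rewrite (gtr0_norm t0).
have Sk' : S k <= e * t by apply: le_trans Sk; exact: ler_norm.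
have : c * (t ^+ 2 * enorm u ^+ 2) <= t * (2 * (e * t)).
  have : t * (2 * S k) <= t * (2 * (e * t)) by rewrite !ler_pM2l.
  have : 0 <= c * h (t *: u) ^+ 2 by rewrite mulr_ge0// ltW.
  move: gr Hk; rewrite [c * (_ + _)]mulrDr. lra.
have : 0 < c * (t ^+ 2 * enorm u ^+ 2) by rewrite mulr_gt0// mulr_gt0// exprn_gt0.
rewrite /e; move: (enorm u ^+ 2) => N.
have -> : t * (2 * (c * N / 4 * t)) = c * (t ^+ 2 * N) / 2 by field.
by lra.
Qed.

End FootEquation.

(** * Smooth matrices and implicit differentiation *)

Section SmoothMatrices.
Context {R : realType} {E : normedModType R} (U : set E) (oU : open U) (k : nat).

Lemma Ck_det n (M : E -> 'M[R]_n) : (forall i j, Ck U k (fun x => M x i j)) ->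
  Ck U k (fun x => \det (M x)).
Proof.
move=> CM; rewrite /determinant.
apply: (@Ck_sum _ _ _ _ _ _ (fun (s : 'S_n) x => (-1) ^+ s * \prod_i M x i (s i))) => // s _.
by apply: CkZ => //; apply: (@Ck_prod _ _ _ _ _ _ (fun i x => M x i (s i))).
Qed.

(** By Cramer's rule the entries of the inverse are quotients of polynomials in
    the entries of [M]. *)
Lemma Ck_invmx n (M : E -> 'M[R]_n) : (forall i j, Ck U k (fun x => M x i j)) ->
  (forall x, U x -> M x \in unitmx) ->
  forall i j, Ck U k (fun x => invmx (M x) i j).
Proof.
move=> CM uM i j.
apply: (@Ck_eq _ _ _ _ (fun x => (\det (M x))^-1 * cofactor (M x) j i)) => //.
  by move=> x /uM; rewrite /invmx => ->; rewrite !mxE.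
apply: CkM => //; first apply: CkV => //.
- by move=> x /uM; rewrite unitmxE unitfE.
- exact: Ck_det.
rewrite /cofactor; apply: CkZ => //; apply: Ck_det => a b.
rewrite (_ : (fun x => _) = fun x => M x (lift j a) (lift i b)); first exact: CM.
by rewrite funeqE => x; rewrite !mxE.
Qed.

End SmoothMatrices.

Section ImplicitFunction.
Context {R : realType} {E : normedModType R} {n : nat}.

(** The existence of [w] is given, by the projection in the application; the
    invertibility of the derivative in the first variable turns the continuity of
    [w] into differentiability. *)
Lemma implicit_is_derive (F : 'I_n -> 'cV[R]_n * E -> R) (w : E -> 'cV[R]_n) y v
    (H : 'M[R]_n) (b : 'cV[R]_n) :
  (forall i, differentiable (F i) (w y, y)) ->
  (forall i u, 'd (F i) (w y, y) (u, 0) = (H *m u) i 0) ->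
  (forall i, 'd (F i) (w y, y) (0, v) = b i 0) ->
  H \in unitmx -> {for y, continuous w} ->
  (\forall y' \near y, forall i, F i (w y', y') = 0) ->
  is_derive y v w (- (invmx H *m b)).
Proof.
move=> dF dFu dFv uH cw F0.
have [K K0 hK] : exists2 K, 0 < K & forall u : 'cV[R]_n, `|invmx H *m u| <= K * `|u|.
  pose fM := GRing.isLinear.Build _ _ _ _ _ (@mulmx_linear R _ _ (invmx H)).
  pose fl : {linear 'cV[R]_n -> 'cV[R]_n} := HB.pack (fun u : 'cV[R]_n => invmx H *m u) fM.
  have [|K K0 hK] := @linear_lipschitz _ _ _ fl; last by exists K.
  exact: (linear_col_continuous (@mulmx_linear _ _ _ (invmx H))).
pose dl (s : R) := w (s *: v + y) - w y.
have lin_y : (fun s : R => s *: v + y) @ (0 : R) --> y.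
  rewrite -[X in _ --> X]add0r -(scale0r v); apply: cvgD; last exact: cvg_cst.
  by apply: cvgZr_tmp; exact: cvg_id.
have cdl : dl s @[s --> (0 : R)] --> (0 : 'cV[R]_n).
  rewrite -(subrr (w y)); apply: cvgB; last exact: cvg_cst.
  exact: (@cvg_comp _ _ _ (fun s : R => s *: v + y) w _ _ _ lin_y cw).
have Hb e : 0 < e -> \forall s \near (0 : R),
    `|H *m dl s + s *: b| <= e * (`|dl s| + `|s| * `|v|).
  move=> e0.
  have near_i i : \forall s \near (0 : R),
      `|(H *m dl s + s *: b) i 0| <= e * (`|dl s| + `|s| * `|v|).
    have cp : (fun s : R => (dl s, s *: v)) @ (0 : R) --> ((0, 0) : 'cV[R]_n * E).
      have clv : s *: v @[s --> (0 : R)] --> (0 : E).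
        by rewrite -[X in _ --> X](scale0r v); apply: cvgZr_tmp; exact: cvg_id.
      exact: (cvg_pair cdl clv).
    have /eqaddoP/(_ _ e0) ho := diff_locally (dF i).
    have hs : \forall s \near (0 : R), `|(F i \o shift (w y, y) -
        (cst (F i (w y, y)) + 'd (F i) (w y, y))) (dl s, s *: v)| <= e * `|(dl s, s *: v)|.
      exact: (cp _ ho).
    have nF : \forall s \near (0 : R), F i (w (s *: v + y), s *: v + y) = 0.
      by apply: (lin_y (fun y' => F i (w y', y') = 0)); apply: filterS F0.
    apply: filterS2 hs nF => s hs Fs.
    have -> : (H *m dl s + s *: b) i 0 = 'd (F i) (w y, y) (dl s, s *: v).
      have Z : 'd (F i) (w y, y) (s *: (0, v)) = s * 'd (F i) (w y, y) (0, v).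
        exact: (linearZZ ('d (F i) (w y, y)) s (0, v)).
      have e2 : 'd (F i) (w y, y) (dl s, s *: v) =
          'd (F i) (w y, y) (dl s, 0) + s * 'd (F i) (w y, y) (0, v).
        rewrite -Z -linearD; congr ('d (F i) (w y, y) _).
        by congr (_, _) => /=; rewrite ?scaler0 ?addr0 ?add0r.
      by rewrite e2 dFu dFv mxE [X in _ + X]mxE.
    have le : `|(dl s, s *: v)| <= `|dl s| + `|s| * `|v|.
      by rewrite -normrZ prod_normE/= ge_max lerDl lerDr !normr_ge0.
    apply: le_trans (ler_wpM2l (ltW e0) le); apply: le_trans hs.
    have -> : (F i \o shift (w y, y) - (cst (F i (w y, y)) + 'd (F i) (w y, y)))
      (dl s, s *: v) = F i ((dl s, s *: v) + (w y, y)) - (F i (w y, y) +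
        'd (F i) (w y, y) (dl s, s *: v)) by [].
    have -> : (dl s, s *: v) + (w y, y) = (w (s *: v + y), s *: v + y).
      by congr (_, _); rewrite /dl/= subrK.
    by rewrite Fs (nbhs_singleton F0) !add0r normrN.
  have : \forall s \near (0 : R), forall i,
      `|(H *m dl s + s *: b) i 0| <= e * (`|dl s| + `|s| * `|v|).
    exact: (@filter_forall _ _ (fun i s => `|(H *m dl s + s *: b) i 0| <= e * (`|dl s| + `|s| * `|v|)) (nbhs (0 : R))).
  apply: filterS => s hs; apply: norm_le_coord => //.
  by rewrite mulr_ge0 ?(ltW e0)// addr_ge0// mulr_ge0.
set beta := invmx H *m b.
have Hd e : 0 < e -> \forall s \near (0 : R), `|dl s + s *: beta| <= e * (`|dl s| + `|s| * `|v|).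
  move=> e0; have eK : 0 < e / K by rewrite divr_gt0.
  apply: filterS (Hb _ eK) => s hs.
  have -> : dl s + s *: beta = invmx H *m (H *m dl s + s *: b).
    by rewrite mulmxDr mulmxA mulVmx// mul1mx -scalemxAr.
  apply: le_trans (hK _) _; rewrite -ler_pdivlMl// mulrA [K^-1 * e]mulrC.
  exact: hs.
(* [w] is first shown to be Lipschitz at [y], so that the error terms become
   small compared with [s]. *)
pose C := 2 * `|beta| + 2 * `|v| + 1.
have C0 : 0 < C by rewrite /C ltr_wpDl// addr_ge0// mulr_ge0.
have dlC : \forall s \near (0 : R), `|dl s| <= `|s| * C.
  have h2 : 0 < (2^-1 : R) by rewrite invr_gt0.
  apply: filterS (Hd _ h2) => s hs.
  have : `|dl s| <= `|dl s + s *: beta| + `|s| * `|beta|.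
    by rewrite -normrZ -[X in `|X| <= _](addrK (s *: beta)) (le_trans (ler_normB _ _)).
  have := normr_ge0 s; have := normr_ge0 beta; have := normr_ge0 v.
  by move: hs; rewrite /C; nra.
suff cv : (fun s : R => s^-1 *: ((w \o shift y) (s *: v) - w y)) @ 0^' --> - beta.
  by split; [apply/cvg_ex; eexists; exact: cv|exact: cvg_lim cv].
apply/cvgrPdist_le => e e0.
have e1 : 0 < e / (C + `|v| + 1) by rewrite divr_gt0// ltr_wpDl// addr_ge0// ltW.
have n1 : \forall s \near (0 : R)^', `|dl s + s *: beta| <= e / (C + `|v| + 1) * (`|dl s| + `|s| * `|v|).
  exact: nbhs_dnbhs (Hd _ e1).
have n2 : \forall s \near (0 : R)^', `|dl s| <= `|s| * C by exact: nbhs_dnbhs.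
have n3 : \forall s \near (0 : R)^', s != 0 by exact: nbhs_dnbhs_neq.
near=> s.
have s0 : s != 0 by near: s.
have h1 : `|dl s + s *: beta| <= e / (C + `|v| + 1) * (`|dl s| + `|s| * `|v|) by near: s.
have h2 : `|dl s| <= `|s| * C by near: s.
have -> : - beta - s^-1 *: ((w \o shift y) (s *: v) - w y) = - (s^-1 *: (dl s + s *: beta)).
  by rewrite [in RHS]scalerDr [in RHS]scalerA mulVf// scale1r opprD addrC.
rewrite normrN normrZ normfV ler_pdivrMl ?normr_gt0//.
apply: le_trans h1 _; rewrite [e / _ * _]mulrAC ler_pdivrMr; last first.
  by rewrite ltr_wpDl// addr_ge0// ltW.
have s1 : 0 < `|s| by rewrite normr_gt0.
have : e * (`|dl s| + `|s| * `|v|) <= e * (`|s| * C + `|s| * `|v|).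
  by rewrite ler_pM2l// lerD2r.
have : 0 <= e * `|s| by rewrite mulr_ge0// ltW.
by nra.
Unshelve. all: by end_near. Qed.

End ImplicitFunction.

(** * Smoothness of the projection along the slice *)

Section Preliminaries.
Context {R : realType}.

Lemma is_derive_linear (E F : normedModType R) (f : E -> F) x v :
  linear f -> continuous f -> is_derive x v f (f v).
Proof.
move=> lf cf; pose fM := GRing.isLinear.Build _ _ _ _ _ lf.
pose fl : {linear E -> F} := HB.pack f fM.
have df : differentiable fl x by exact: linear_differentiable.
by split; [exact: diff_derivable|rewrite deriveE// (diff_lin _ (f := fl))].
Qed.

Lemma linear_continuous_differentiable (E F : normedModType R) (f : E -> F) x :
  linear f -> continuous f -> differentiable f x.
Proof.
move=> lf cf; pose fM := GRing.isLinear.Build _ _ _ _ _ lf.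
by pose fl : {linear E -> F} := HB.pack f fM; exact: (@linear_differentiable _ _ _ fl).
Qed.

Lemma mulmx_vec3E m (A : 'M[R]_(m, 3)) u a k : (A *m vec3 u a) k 0 =
  \sum_i u i 0 * (A *m vec3 (delta_mx i 0) 0) k 0 + a * (A *m vec3 0 1) k 0.
Proof.
have -> : vec3 u a = \sum_i u i 0 *: vec3 (delta_mx i 0) 0 + a *: vec3 0 1.
  rewrite -vec3Z scaler0 mulr1.
  have -> : \sum_i u i 0 *: vec3 (delta_mx i 0) 0 = vec3 u 0.
    rewrite [in RHS](col_sum_delta u); elim/big_rec2 : _ => [|i y z _ ->].
      by rewrite vec3_0.
    by rewrite -vec3Z mulr0 -vec3D addr0.
  by rewrite -vec3D addr0 add0r.
rewrite mulmxDr mxE -scalemxAr [X in _ + X]mxE; congr (_ + _).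
rewrite mulmx_sumr summxE; apply: eq_bigr => i _.
by rewrite -scalemxAr mxE.
Qed.

Lemma Ck_mulmx_vec3 (E : normedModType R) (U : set E) k m (A : 'M[R]_(m, 3))
    (u : E -> 'cV[R]_2) (a : E -> R) i : open U ->
  (forall j, Ck U k (fun y => u y j 0)) -> Ck U k a ->
  Ck U k (fun y => (A *m vec3 (u y) (a y)) i 0).
Proof.
move=> oU Cu Ca; apply: (@Ck_eq _ _ _ _ (fun y =>
  \sum_j u y j 0 * (A *m vec3 (delta_mx j 0) 0) i 0 + a y * (A *m vec3 0 1) i 0)) => //.
  by move=> y _; rewrite [RHS]mulmx_vec3E.
apply: CkD => //; last by apply: CkM => //; exact: Ck_cst.
apply: (@Ck_sum _ _ _ _ _ _ (fun j y => u y j 0 * (A *m vec3 (delta_mx j 0) 0) i 0)) => // j _.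
by apply: CkM => //; exact: Ck_cst.
Qed.

Lemma near_below_reach (G : set 'cV[R]_3) x : compact G -> G !=set0 ->
  ((dist G x)%:E < reach G)%E -> \forall y \near x, ((dist G y)%:E < reach G)%E.
Proof.
move=> cG G0 lt; have [m xm mr] : exists2 m, dist G x < m & (m%:E <= reach G)%E.
  move: lt; case: (reach G) => [r||]//; first by rewrite lte_fin => h; exists r.
  by move=> _; exists (dist G x + 1); rewrite ?ltrDl// leey.
have nm : \forall y \near x, dist G y < m.
  have cd : {for x, continuous (dist G)} by exact: dist_continuous.
  exact: (@cvgr_lt _ _ (nbhs x) _ _ _ cd m xm).
by apply: filterS nm => y ym; apply: lt_le_trans mr; rewrite lte_fin.
Qed.

Lemma boundary_compact (G Om : set 'cV[R]_3) : smooth_surface_bounding G Om -> compact G.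
Proof.
move=> [oOm bOm -> _]; apply: bounded_closed_compact_col.
  have [M [Mr hM]] := bOm; exists (M + 1); split=> [|m Mm x [cx _]]; first exact: num_real.
  suff sub : closure Om `<=` [set x | `|x| <= M + 1] by apply: le_trans (sub _ cx) _; exact: ltW.
  have cl : closed [set x : 'cV[R]_3 | `|x| <= M + 1].
    have cn : continuous (fun x : 'cV[R]_3 => `|x|) by exact: norm_continuous.
    exact: ((continuous_closedP _).1 cn _ (@closed_le _ (M + 1))).
  rewrite ((closure_id _).1 cl); apply: closure_subset => y Omy /=.
  by apply: (hM (M + 1)) => //; rewrite ltrDl.
rewrite /boundary setDE; apply: closedI; first exact: closed_closure.
by apply: open_closedC; exact: open_interior.
Qed.

End Preliminaries.

Section Projection.
Context {R : realType} (G Om : set 'cV[R]_3) (xs : 'cV[R]_3) (z : R).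
Local Notation "''d_' i f" := (derive f ^~ (delta_mx i 0))
  (at level 10, i, f at next level, format "''d_' i  f").

(** The argument of the projection in the singular functions. *)
Definition slice_pt (y : 'cV[R]_2) : 'cV[R]_3 :=
  vec3 (y + horizontal (normal_pt xs (outward_unit_normal Om xs) z)) z.

Let n := outward_unit_normal Om xs.
Let x0 := normal_pt xs n z.
Let pr y := proj G (slice_pt y).
Let nu y := outward_unit_normal Om (pr y).

Hypotheses (smG : smooth_surface_bounding G Om) (Gxs : G xs)
  (nz : dot n (e_z R) != 0) (lt : ((dist G x0)%:E < reach G)%E)
  (projx0 : proj G x0 = xs).

Let cG : compact G. Proof. exact: boundary_compact smG. Qed.
Let G0 : G !=set0. Proof. by exists xs. Qed.

Lemma slice_ptE y : slice_pt y = x0 + vec3 y 0.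
Proof.
have hz : height x0 = z.
  rewrite /x0 /normal_pt addrC height_linear dot_e_z mulrC [_ * _]mulrC.
  move: nz; rewrite dot_e_z => nz'; rewrite [_ *: _]divfK// subrK.
  by [].
have xe : vec3 (horizontal x0) z = x0 by rewrite -[RHS](vec3_split x0) hz.
rewrite /slice_pt -/n -/x0; move: xe; move: (horizontal x0) => k <-.
by rewrite -vec3D [k + y]addrC addr0.
Qed.

Lemma slice_pt0 : slice_pt 0 = x0.
Proof. by rewrite slice_ptE vec3_0 addr0. Qed.

Lemma slice_projection0 : pr 0 = xs.
Proof. by rewrite /pr slice_pt0. Qed.

Let cvg_slice y : slice_pt y' @[y' --> y] --> slice_pt y.
Proof.
rewrite /slice_pt; apply: (@cvg_vec3 _ _ (nbhs y)); last exact: cvg_cst.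
by apply: cvgD; [exact: cvg_id|exact: cvg_cst].
Qed.

Let pr_continuous y : ((dist G (slice_pt y))%:E < reach G)%E -> {for y, continuous pr}.
Proof.
move=> lty; have cp := proj_continuous_below_reach cG G0 lty.
exact: (@cvg_comp _ _ _ slice_pt (proj G) _ _ _ (@cvg_slice y) cp).
Qed.

Section InChart.
Variables (Q : 'M[R]_3) (g : 'cV[R]_2 -> R) (W : set 'cV[R]_2) (V : set 'cV[R]_3).
Hypotheses (lg : local_graph G xs Q g W V)
  (nN : \forall x \near xs, G x ->
      is_outward_unit_normal Om x (graph_normal Q g (chart_coord xs Q x)) /\
      outward_unit_normal Om x = graph_normal Q g (chart_coord xs Q x)).

Let w y := chart_coord xs Q (pr y).
Let Z y := Q^T *m (slice_pt y - xs).

(** The conditions that allow the foot point of [slice_pt y] to be followed in the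
    chart. *)
Definition good_pt (y : 'cV[R]_2) :=
  [/\ ((dist G (slice_pt y))%:E < reach G)%E, V (pr y),
      is_outward_unit_normal Om (pr y) (graph_normal Q g (w y)) /\
      nu y = graph_normal Q g (w y) &
      foot_hess g (Z y) (w y) \in unitmx].

Lemma good_ptP y : good_pt y ->
  [/\ is_closest G (slice_pt y) (pr y), W (w y), pr y = chart xs Q g (w y),
      forall i, foot_eq g (Z y) (w y) i = 0 & {for y, continuous w}].
Proof.
move=> [lty Vy _ _]; have cl := proj_closest cG G0 (slice_pt y).
have [_ _ _ _ XG] := lg; have [Ww e] := XG _ Vy cl.1.
split; [exact: cl|exact: Ww|exact: e| |].
- by apply: (closest_foot_eq lg Ww); rewrite -e.
- apply: (@cvg_comp _ _ _ pr (chart_coord xs Q) _ _ _ (pr_continuous lty)).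
  exact: chart_coord_continuous.
Qed.

Let w0 : w 0 = 0.
Proof. by rewrite /w slice_projection0 chart_coord0. Qed.

Let pr0 : {for 0, continuous pr}.
Proof. by apply: pr_continuous; rewrite slice_pt0. Qed.

Let cw0 : {for 0, continuous w}.
Proof.
apply: (@cvg_comp _ _ _ pr (chart_coord xs Q) _ _ _ pr0).
exact: chart_coord_continuous.
Qed.

Let hess0 : foot_hess g (Z 0) (w 0) \in unitmx.
Proof.
have cl : is_closest G x0 xs by rewrite -projx0; exact: proj_closest.
have [c c0 growth] := closest_quadratic_growth cG G0 cl lt.
by rewrite w0 /Z slice_pt0; exact: foot_hess_unit lg cl c0 growth.
Qed.

Let Cd i k : Ck W k ('d_i g).
Proof. by have [_ Cg _ _ _] := lg; have [_ /(_ (delta_mx i 0))[]] := Cg k.+1. Qed.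

Let Cdd i j k : Ck W k ('d_j ('d_i g)).
Proof. by have [_ /(_ (delta_mx j 0))[]] := Cd i k.+1. Qed.

(** The conditions hold at [0], where the last one is [foot_hess_unit], and they
    persist nearby by continuity. *)
Lemma near_good_pt : \forall y \near (0 : 'cV[R]_2), good_pt y.
Proof.
have [[oQ oW W0 nV] Cg g0 GX XG] := lg.
have n1 : \forall y \near (0 : 'cV[R]_2), ((dist G (slice_pt y))%:E < reach G)%E.
  have h := near_below_reach cG G0 lt; rewrite -slice_pt0 in h.
  exact: (@cvg_slice 0 _ h).
have n2 : \forall y \near (0 : 'cV[R]_2), V (pr y).
  by apply: pr0; rewrite slice_projection0.
have n3 : \forall y \near (0 : 'cV[R]_2),
   is_outward_unit_normal Om (pr y) (graph_normal Q g (w y)) /\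
      nu y = graph_normal Q g (w y).
  pose P x := G x -> is_outward_unit_normal Om x (graph_normal Q g (chart_coord xs Q x)) /\
      outward_unit_normal Om x = graph_normal Q g (chart_coord xs Q x).
  have h : \forall y \near (0 : 'cV[R]_2), P (pr y).
    by apply: pr0; rewrite slice_projection0.
  by apply: filterS h => y; apply; have [] := proj_closest cG G0 (slice_pt y).
have n4 : \forall y \near (0 : 'cV[R]_2), \det (foot_hess g (Z y) (w y)) != 0.
  have comp f : Ck W 0 f -> f (w y) @[y --> (0 : 'cV[R]_2)] --> f (w 0).
    move=> [cf _]; apply: (@cvg_comp _ _ _ w f _ _ _ cw0).
    by apply: cf; rewrite w0.
  have cZ : Z y @[y --> (0 : 'cV[R]_2)] --> Z 0 by apply: (@cvg_frame _ _ _ _ (nbhs (0 : 'cV[R]_2))); exact: (@cvg_slice 0).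
  have cM i j : foot_hess g (Z y) (w y) i j @[y --> (0 : 'cV[R]_2)]
      --> foot_hess g (Z 0) (w 0) i j.
    rewrite [X in _ --> X]mxE.
    rewrite (_ : (fun y => _) = fun y => (i == j)%:R + 'd_j g (w y) * 'd_i g (w y) +
      (g (w y) - height (Z y)) * 'd_j ('d_i g) (w y)); last first.
      by rewrite funeqE => y; rewrite mxE.
    pose F0 := nbhs (0 : 'cV[R]_2).
    apply: (@cvgD _ _ _ F0).
      apply: (@cvgD _ _ _ F0); first exact: cvg_cst.
      by apply: (@cvgM _ _ F0); [exact: comp (Cd j 0)|exact: comp (Cd i 0)].
    apply: (@cvgM _ _ F0); last exact: comp (Cdd i j 0).
    by apply: (@cvgB _ _ _ F0); [exact: comp (Cg 0%N)|exact: (@cvg_height _ _ F0)].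
  have cdet : \det (foot_hess g (Z y) (w y)) @[y --> (0 : 'cV[R]_2)]
      --> \det (foot_hess g (Z 0) (w 0)).
    rewrite /determinant; apply: (@cvg_sumr _ _ (nbhs (0 : 'cV[R]_2))) => s _.
    apply: cvgM; first exact: cvg_cst.
    by apply: (@cvg_prodr _ _ (nbhs (0 : 'cV[R]_2))) => i _; exact: cM.
  have d0 : \det (foot_hess g (Z 0) (w 0)) != 0 by rewrite -unitfE -unitmxE.
  exact: (@cvgr_neq0 _ _ _ (nbhs (0 : 'cV[R]_2)) _ _ _ cdet d0).
apply: filterS3 n1 n2 (filterI n3 n4) => y h1 h2 [h3 h4].
by split; [exact: h1|exact: h2|exact: h3|rewrite unitmxE unitfE; exact: h4].
Qed.

(** The hypothesis says that [vec3 v 0] is orthogonal to the tangent plane at [xs];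
    a horizontal vector can be normal to the surface there only if it vanishes,
    because the normal is not horizontal. *)
Lemma transversal v : (forall i, horizontal (Q^T *m vec3 v 0) i 0
    + height (Q^T *m vec3 v 0) * 'd_i g 0 = 0) -> v = 0.
Proof.
move=> h; have [[oQ oW W0 nV] Cg g0 GX XG] := lg.
set c := height (Q^T *m vec3 v 0) in h.
have ha : horizontal (Q^T *m vec3 v 0) = - (c *: gradient g 0).
  apply/colP => i; have /eqP := h i; rewrite addr_eq0 => /eqP ->.
  by rewrite !mxE.
have e : vec3 v 0 = c *: (Q *m vec3 (- gradient g 0) 1).
  rewrite -[LHS](orthogonalVK _ oQ) -{1}(vec3_split (Q^T *m vec3 v 0)) ha -/c.
  by rewrite [RHS]scalemxAr -vec3Z mulr1 scalerN.
have ne : n = graph_normal Q g 0.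
  by have [_] := nbhs_singleton nN Gxs; rewrite chart_coord0.
set m := Q *m vec3 (- gradient g 0) 1 in e.
have hm : height m != 0.
  move: nz; rewrite dot_e_z ne /graph_normal -/m; apply: contra => /eqP hm.
  by rewrite heightZ hm mulr0.
have : height (vec3 v 0) = c * height m by rewrite e heightZ.
rewrite height_vec3 => /esym/eqP; rewrite mulf_eq0 (negbTE hm) orbF => /eqP c0.
by rewrite -(horizontal_vec3 v 0) e c0 scale0r horizontal0.
Qed.

Let is_derive_slice y v : is_derive y v Z (Q^T *m vec3 v 0).
Proof.
apply: is_derive_mulmx.
rewrite (_ : (fun y => _) = fun y => vec3 (y + horizontal x0) z - xs)//.
have d1 : is_derive y v (fun y : 'cV[R]_2 => y + horizontal x0) v.
  by have := is_deriveD (is_derive_id y v) (is_derive_cst (horizontal x0) y v); rewrite addr0.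
have := is_deriveD (is_derive_vec3 d1 (is_derive_cst z y v)) (is_derive_cst (- xs) y v).
by rewrite addr0.
Qed.

Let Z_affine y : Z y = Q^T *m vec3 y 0 + Z 0.
Proof. by rewrite /Z slice_ptE slice_pt0 -mulmxDr addrCA addrA. Qed.

Let Z_differentiable y : differentiable Z y.
Proof.
rewrite (_ : Z = fun y => Q^T *m vec3 y 0 + Z 0); last by rewrite funeqE.
apply: differentiableD => //.
apply: (@linear_continuous_differentiable _ _ _ (fun y : 'cV[R]_2 => Q^T *m vec3 y 0)).
  by move=> a u v; rewrite -[0 in LHS](addr0 0) -{1}(mulr0 a) vec3D vec3Z mulmxDr scalemxAr.
apply: linear_col_continuous => a u v.
by rewrite -[0 in LHS](addr0 0) -{1}(mulr0 a) vec3D vec3Z mulmxDr scalemxAr.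
Qed.

(** The derivative of the foot-point equations when the base point moves
    horizontally in the direction [v] and the foot point is held fixed. *)
Definition foot_rhs (y v : 'cV[R]_2) : 'cV[R]_2 := \col_i
  - (horizontal (Q^T *m vec3 v 0) i 0 + height (Q^T *m vec3 v 0) * 'd_i g (w y)).

Lemma foot_is_derive y v : (\forall y' \near y, good_pt y') ->
  is_derive y v w (- (invmx (foot_hess g (Z y) (w y)) *m foot_rhs y v)).
Proof.
move=> ng; have [[oQ oW W0 nV] Cg g0 GX XG] := lg.
have gy := nbhs_singleton ng; have [cl Ww e F0 cw] := good_ptP gy.
have [_ _ _ uH] := gy.
pose F i (q : 'cV[R]_2 * 'cV[R]_2) := foot_eq g (Z q.2) q.1 i.
have lfst : linear (@fst 'cV[R]_2 'cV[R]_2) by [].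
have lsnd : linear (@snd 'cV[R]_2 'cV[R]_2) by [].
have cfst : continuous (@fst 'cV[R]_2 'cV[R]_2) by move=> q; exact: cvg_fst.
have csnd : continuous (@snd 'cV[R]_2 'cV[R]_2) by move=> q; exact: cvg_snd.
have dF i : differentiable (F i) (w y, y).
  apply: (foot_eq_differentiable (w := fst) (Z := fun q => Z q.2) oW Cg) => //.
    exact: linear_continuous_differentiable.
  apply: (@differentiable_comp _ _ _ _ snd Z) => //.
  exact: linear_continuous_differentiable.
have dFE i u v' : 'd (F i) (w y, y) (u, v') = (foot_hess g (Z y) (w y) *m u) i 0
     + foot_rhs y v' i 0.
  rewrite -deriveE//.
  have d1 := is_derive_linear (w y, y) (u, v') lfst cfst.
  have d2 := is_derive_comp_diff (Z_differentiable y) (is_derive_linear (w y, y) (u, v') lsnd csnd).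
  have := @foot_eq_is_derive _ _ W g fst (fun q => Z q.2) (w y, y) oW Cg Ww i (u, v') _ _ d1 d2.
  move=> [_ ->]; congr (_ + _); rewrite [RHS]mxE.
  have -> : 'd Z y v' = Q^T *m vec3 v' 0.
    by rewrite -deriveE//; have [_ ->] := is_derive_slice y v'.
  by [].
have rhs0 i : foot_rhs y 0 i 0 = 0.
  by rewrite mxE vec3_0 mulmx0 horizontal0 height0 mxE mul0r addr0 oppr0.
have dFu i u : 'd (F i) (w y, y) (u, 0) = (foot_hess g (Z y) (w y) *m u) i 0.
  by rewrite dFE rhs0 addr0.
have dFv i : 'd (F i) (w y, y) (0, v) = foot_rhs y v i 0.
  by rewrite dFE mulmx0 [X in X + _]mxE add0r.
have nF : \forall y' \near y, forall i, F i (w y', y') = 0.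
  by apply: filterS ng => y' /good_ptP[].
exact: implicit_is_derive dF dFu dFv uH cw nF.
Qed.

Section OnOpenSet.
Variable B : set 'cV[R]_2.
Hypotheses (oB : open B) (gB : forall y, B y -> good_pt y).

Let BW y : B y -> W (w y).
Proof. by move=> /gB/good_ptP[]. Qed.

Let dw y v : B y ->
  is_derive y v w (- (invmx (foot_hess g (Z y) (w y)) *m foot_rhs y v)).
Proof.
move=> By; apply: foot_is_derive.
by apply: filterS (open_nbhs_nbhs (conj oB By)) => y'; exact: gB.
Qed.

(** Bootstrapping: the derivative of [w] given by [foot_is_derive] is a smooth
    function of [w y] and [y], so that each order of smoothness of [w] yields the
    next. *)
Lemma foot_Ck k i : Ck B k (fun y => w y i 0).
Proof.
have [[oQ oW W0 nV] Cg g0 GX XG] := lg.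
have CZ k' : Ck B k' (fun y => height (Z y)).
  apply: (@Ck_eq _ _ _ _ (fun y => height (Q^T *m vec3 y 0) + height (Z 0))) => //.
    by move=> y _; rewrite [in RHS]Z_affine heightD.
  apply: CkD => //; last exact: Ck_cst.
  have lin : linear (fun y : 'cV[R]_2 => height (Q^T *m vec3 y 0)).
    move=> a u v; rewrite -[0 in LHS](addr0 0) -{1}(mulr0 a) vec3D vec3Z mulmxDr.
    by rewrite -scalemxAr heightD heightZ.
  by apply: Ck_linear => //; exact: linear_col_continuous.
elim: k i => [|k IH] i.
  split=> // y By; have [_ _ _ _ cw] := good_ptP (gB By).
  apply: (@continuous_comp _ _ _ w (fun u : 'cV[R]_2 => u i 0)) => //.
  exact: coord_continuous.
have comp (f : 'cV[R]_2 -> R) : Ck W k f -> Ck B k (fun y => f (w y)).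
  by move=> Cf; exact: (Ck_comp oB oW BW IH Cf).
split=> [y By|v].
  have [_ _ _ _ cw] := good_ptP (gB By).
  apply: (@continuous_comp _ _ _ w (fun u : 'cV[R]_2 => u i 0)) => //.
  exact: coord_continuous.
split=> [y By|]; first by have [] := is_derive_coord i (dw v By).
apply: (@Ck_eq _ _ _ _ (fun y => - \sum_j invmx (foot_hess g (Z y) (w y)) i j *
  - (horizontal (Q^T *m vec3 v 0) j 0 + height (Q^T *m vec3 v 0) * 'd_j g (w y)))) => //.
  move=> y By; have [_ ->] := is_derive_coord i (dw v By).
  rewrite mxE [X in _ = - X]mxE; congr (- _); apply: eq_bigr => j _.
  by rewrite [foot_rhs _ _ _ _]mxE.
apply: CkN => //; apply: (@Ck_sum _ _ _ _ _ _ (fun j y =>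
  invmx (foot_hess g (Z y) (w y)) i j *
  - (horizontal (Q^T *m vec3 v 0) j 0 + height (Q^T *m vec3 v 0) * 'd_j g (w y)))) => // j _.
apply: CkM => //.
  apply: (Ck_invmx oB (M := fun y => foot_hess g (Z y) (w y))); last by move=> y /gB[].
  move=> a b; apply: (@Ck_eq _ _ _ _ (fun y => (a == b)%:R
    + 'd_b g (w y) * 'd_a g (w y) + (g (w y) - height (Z y)) * 'd_b ('d_a g) (w y))) => //.
    by move=> y _; rewrite mxE.
  apply: CkD => //.
    apply: CkD => //; first exact: Ck_cst.
    by apply: CkM => //; [exact: comp (Cd b k)|exact: comp (Cd a k)].
  apply: CkM => //; last exact: comp (Cdd a b k).
  by apply: CkB => //; exact: comp (Cg k).
apply: CkN => //; apply: CkD => //; first exact: Ck_cst.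
by apply: CkZ => //; exact: comp (Cd j k).
Qed.

Let comp k (f : 'cV[R]_2 -> R) : Ck W k f -> Ck B k (fun y => f (w y)).
Proof.
have [[oQ oW W0 nV] Cg g0 GX XG] := lg => Cf.
exact: (Ck_comp oB oW BW (foot_Ck k) Cf).
Qed.

Lemma projection_Ck k i : Ck B k (fun y => (pr y - xs) i 0).
Proof.
have [[oQ oW W0 nV] Cg g0 GX XG] := lg.
apply: (@Ck_eq _ _ _ _ (fun y => (Q *m vec3 (w y) (g (w y))) i 0)) => //.
  move=> y /gB/good_ptP[_ _ e _ _]; congr (fun_of_matrix _ i 0).
  by rewrite e /chart addrC addKr /w e chartK.
apply: Ck_mulmx_vec3 => //; first exact: foot_Ck.
exact: comp (Cg k).
Qed.

Lemma normal_Ck k i : Ck B k (fun y => nu y i 0).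
Proof.
have [[oQ oW W0 nV] Cg g0 GX XG] := lg.
pose q y := 1 + \sum_j 'd_j g (w y) * 'd_j g (w y).
have q0 y : 0 < q y by rewrite ltr_wpDr// sumr_ge0// => j _; rewrite -expr2 sqr_ge0.
apply: (@Ck_eq _ _ _ _ (fun y => (Num.sqrt (q y))^-1 *
   (Q *m vec3 (- gradient g (w y)) 1) i 0)) => //.
  move=> y /gB[_ _ [_ ->] _]; rewrite /graph_normal [RHS]mxE dotE.
  by congr ((Num.sqrt (1 + _))^-1 * _); apply: eq_bigr => j _; rewrite mxE.
apply: CkM => //.
  apply: CkV => //; first by move=> y _; rewrite gt_eqF// sqrtr_gt0.
  apply: Ck_sqrt => //; apply: CkD => //; first exact: Ck_cst.
  apply: (@Ck_sum _ _ _ _ _ _ (fun j y => 'd_j g (w y) * 'd_j g (w y))) => // j _.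
  by apply: CkM => //; exact: comp (Cd j k).
apply: Ck_mulmx_vec3 => //; last exact: Ck_cst.
move=> j; apply: (@Ck_eq _ _ _ _ (fun y => - 'd_j g (w y))) => //.
  by move=> y _; rewrite !mxE.
by apply: CkN => //; exact: comp (Cd j k).
Qed.

(** Two points of the slice with the same foot point differ by a vector that is
    both horizontal and normal to the surface. *)
Lemma projection_eq_base y : B y -> pr y = xs -> y = 0.
Proof.
move=> By e; have [_ _ _ F0 _] := good_ptP (gB By).
have wy : w y = 0 by rewrite /w e chart_coord0.
have [_ _ _ F00 _] := good_ptP (nbhs_singleton near_good_pt).
apply: transversal => i; have := F0 i; have := F00 i.
have hE (u v : 'cV[R]_3) : horizontal (u + v) i 0 = horizontal u i 0 + horizontal v i 0.
  by rewrite horizontalD mxE.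
rewrite /foot_eq w0 wy (Z_affine y) heightD hE.
move: (horizontal _ i 0) (horizontal _ i 0) (height _) (height _) => a b c d.
by rewrite mxE => h1 h2; move: h1 h2; nra.
Qed.

(** Infinitesimal form of [projection_eq_base]: where the foot point is stationary,
    the displacement of the base point is normal to the surface. *)
Lemma projection_immersive v : B 0 ->
  (forall i, 'D_v (fun y => (pr y - xs) i 0) 0 = 0) -> v = 0.
Proof.
move=> B0 dp; have dpr : is_derive (0 : 'cV[R]_2) v (fun y => pr y - xs) 0.
  apply: is_derive_mx => i j; rewrite (ord1 j) mxE -(dp i); apply/derivableP.
  by have [_ /(_ v)[+ _]] := projection_Ck 1 i; exact.
have d2 : is_derive (0 : 'cV[R]_2) v w (horizontal (Q^T *m 0)).
  exact: (linear_col_is_derive (@horizontal_linear R) (is_derive_mulmx Q^T dpr)).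
have [_ e1] := dw v B0; have [_ e2] := d2.
have h : invmx (foot_hess g (Z 0) (w 0)) *m foot_rhs 0 v = 0.
  by apply: oppr_inj; rewrite -e1 e2 mulmx0 horizontal0 oppr0.
have [_ _ _ uH] := gB B0.
have {}h : foot_rhs 0 v = 0.
  by rewrite -[LHS]mul1mx -(mulmxV uH) -mulmxA h mulmx0.
apply: transversal => i; have := congr1 (fun u : 'cV[R]_2 => u i 0) h.
by rewrite !mxE w0 => /eqP; rewrite oppr_eq0 => /eqP.
Qed.

End OnOpenSet.

End InChart.

(** The part of the geometry that the expansion depends on. The last two facts
    keep the denominators of the singular functions away from zero after blow-up. *)
Lemma smooth_projection : exists2 r0 : R, 0 < r0 & let B := ball (0 : 'cV[R]_2) r0 in
  [/\ forall k, Cinfty B (fun y => (pr y - xs) k 0),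
      forall k, Cinfty B (fun y => nu y k 0),
      forall y, B y -> is_closest G (slice_pt y) (pr y) /\
        is_outward_unit_normal Om (pr y) (nu y),
      forall y, B y -> pr y = xs -> y = 0 &
      forall v, (forall k, 'D_v (fun y => (pr y - xs) k 0) 0 = 0) -> v = 0].
Proof.
have [Q [g [W [V [lg nN]]]]] := smooth_surface_chart smG Gxs.
have /nbhs_ballP[r0 /= r00 hr] := near_good_pt lg nN.
have oB : open (ball (0 : 'cV[R]_2) r0) by exact: ball_open.
have {}hr y : ball (0 : 'cV[R]_2) r0 y -> good_pt Q g V y by exact: hr.
exists r0; [exact: r00|split].
- by move=> i k; exact: (projection_Ck lg oB hr).
- by move=> i k; exact: (normal_Ck lg oB hr).
- move=> y /hr gy; have [cl _ _ _ _] := good_ptP lg gy.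
  have [_ _ [h e] _] := gy; split; first exact: cl.
  by rewrite e; exact: h.
- by move=> y By; exact: (projection_eq_base lg nN hr By).
- by move=> v; apply: (projection_immersive lg nN oB hr); exact: ballxx.
Qed.

End Projection.

(** * Polar forms and two-term expansions *)

Section PolarForms.
Context {R : realType}.
Local Notation vec := 'cV[R]_2.
Implicit Types (h y : 'cV[R]_2) (rho r : R).

Lemma enorm_unit_dir y : y != 0 -> enorm (unit_dir y) = 1.
Proof.
by move=> y0; rewrite enormZ ger0_norm ?invr_ge0 ?enorm_ge0// mulVf// enorm_eq0.
Qed.

Lemma unit_dirK y : y != 0 -> enorm y *: unit_dir y = y.
Proof. by move=> y0; rewrite scalerA mulfV ?scale1r// enorm_eq0. Qed.

Definition cylinder r : set (R * vec) := [set q | - r < q.1 < r /\ enorm q.2 = 1].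

(** Smoothness on the cylinder is obtained from smoothness on one open set around
    it. *)
Lemma polar_formI r (s : vec -> R) (l : R -> vec -> R) (O : set (R * vec)) :
  open O -> cylinder r `<=` O -> Cinfty O (fun q : R * vec => l q.1 q.2 : R) ->
  (forall rho h, 0 < rho < r -> enorm h = 1 -> s (rho *: h) = rho^-1 * l rho h) ->
  polar_form r s l.
Proof.
move=> oO rO Cl sl; split=> [q hq|y /andP[y0 yr]].
  by exists O, (fun q : R * vec => l q.1 q.2); split=> //; exact: rO.
have yN0 : y != 0 by rewrite -enorm_gt0.
by rewrite -{1}(unit_dirK yN0) sl ?enorm_unit_dir// y0.
Qed.

Lemma sphere_compact : compact [set h : vec | enorm h = 1].
Proof.
apply: bounded_closed_compact_col.
  exists 1; split=> [|m hm h /= h1]; first exact: num_real.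
  by apply: le_trans (norm_le_enorm h) _; rewrite h1 ltW.
exact: ((continuous_closedP _).1 (@enorm_continuous R 2) _ (@closed_eq _ _)).
Qed.

Lemma is_derive_radial (f : R * vec -> R) rho h : derivable f (rho, h) (1, 0) ->
  is_derive rho 1 (fun t : R => f (t, h)) ('D_(1, 0) f (rho, h)).
Proof.
move=> d; pose u (t : R) : R * vec := t *: (1, 0) + (0, h).
have ut t : u t = (t, h).
  by congr (_, _) => /=; rewrite ?scaler0 ?add0r ?addr0//; exact: mulr1.
have -> : (fun t : R => f (t, h)) = (fun t => f (u t)).
  by rewrite funeqE => t; rewrite ut.
rewrite -ut; apply: (@is_derive_line _ _ _ f (0, h) (1, 0) rho).
by rewrite -/(u rho) ut; exact/derivableP.
Qed.

(** Taylor's formula in the first variable; the second derivative is bounded on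
    the part of the cylinder with radius at most [r / 2], which is compact. *)
Lemma two_term_expansionI r (s : vec -> R) (l : R -> vec -> R) (O : set (R * vec)) :
  0 < r -> open O -> cylinder r `<=` O -> Cinfty O (fun q : R * vec => l q.1 q.2 : R) ->
  polar_form r s l -> two_term_expansion s l.
Proof.
move=> r0 oO rO Cl [_ sl]; pose f (q : R * vec) := l q.1 q.2.
have [cf /(_ (1, 0))[df [cdf /(_ (1, 0))[ddf [cddf _]]]]] := Cl 2%N.
set f1 := 'D_(1, 0) f in df cdf ddf; set f2 := 'D_(1, 0) f1 in ddf cddf.
pose K : set (R * vec) := `[- (r / 2), r / 2]%classic `*` [set h | enorm h = 1].
have r2 : 0 < r / 2 by rewrite divr_gt0.
have r2r : r / 2 < r by rewrite ltr_pdivrMr// mulr_natr mulr2n ltrDl.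
have KO : K `<=` O.
  move=> [t h] [/=]; rewrite in_itv/= => /andP[t1 t2] h1; apply: rO; split=> //=.
  by rewrite (lt_le_trans _ t1) ?ltrN2// (le_lt_trans t2).
have cK : compact K by apply: compact_setX; [exact: segment_compact|exact: sphere_compact].
have [M M0 hM] : exists2 M, 0 < M & forall q, K q -> `|f2 q| <= M.
  have cK2 : {within K, continuous f2}.
    by apply: continuous_in_subspaceT => q /set_mem /KO; exact: cddf.
  have [M [Mr hM]] := compact_bounded (continuous_compact cK2 cK).
  exists (Num.max 1 (M + 1)); first by rewrite lt_max ltr01.
  move=> q Kq; apply: (hM (Num.max 1 (M + 1))); last by exists q.
  by rewrite lt_max ltrDl ltr01 orbT.
have bound t h : 0 < t <= r / 2 -> enorm h = 1 ->
    `|l t h - l 0 h - t * f1 (0, h)| <= M * t ^+ 2.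
  move=> /andP[t0 tr] h1.
  have Kc c : `|c| <= t -> K (c, h).
    move=> ct; split=> //=; rewrite in_itv/= -ler_norml.
    exact: le_trans ct tr.
  have d1 c : `|c| <= `|t| -> derivable (fun t : R => f (t, h)) (c *: 1 + 0) 1.
    rewrite (gtr0_norm t0) => ct; rewrite addr0 [_%:A]mulr1.
    exact: (ex_derive (is_derive := is_derive_radial (df _ (KO _ (Kc c ct))))).
  have [c ct] := mean_value d1; rewrite !addr0 ![_%:A]mulr1.
  rewrite (gtr0_norm t0) in ct.
  have [_ ->] := is_derive_radial (df _ (KO _ (Kc c ct))); rewrite -/f1 => e1.
  have d2 b : `|b| <= `|c| -> derivable (fun t : R => f1 (t, h)) (b *: 1 + 0) 1.
    move=> bc; rewrite addr0 [_%:A]mulr1.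
    exact: (ex_derive (is_derive := is_derive_radial (ddf _ (KO _ (Kc b (le_trans bc ct)))))).
  have [b bc] := mean_value d2; rewrite !addr0 ![_%:A]mulr1.
  have [_ ->] := is_derive_radial (ddf _ (KO _ (Kc b (le_trans bc ct)))); rewrite -/f2 => e2.
  have -> : l t h - l 0 h - t * f1 (0, h) = t * (c * f2 (b, h)).
    by rewrite -e2 mulrBr -e1.
  have -> : M * t ^+ 2 = t * (t * M) by ring.
  rewrite normrM (gtr0_norm t0) normrM ler_pM2l//.
  by rewrite ler_pM// hM//; apply: Kc; exact: le_trans bc ct.
have t1E h : enorm h = 1 -> derive1 (fun rho : R => l rho h) 0 = f1 (0, h).
  move=> h1; have K0 : K (0, h).
    by split=> //=; rewrite in_itv/= oppr_le0 ltW.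
  by rewrite derive1E; have [_ ->] := is_derive_radial (df _ (KO _ K0)).
rewrite /two_term_expansion; apply/eqOP; exists M; split; first exact: num_real.
move=> m Mm; near=> y.
have y0 : y != 0 by near: y; exact: nbhs_dnbhs_neq.
have yr : enorm y <= r / 2.
  near: y; apply: nbhs_dnbhs; have := near_enorm_lt (0 : vec) r2.
  by apply: filterS => y; rewrite subr0; exact: ltW.
have ny : 0 < enorm y by rewrite enorm_gt0.
rewrite sl ?ny ?(le_lt_trans yr)// /term0 /term1 t1E ?enorm_unit_dir//.
have := bound _ _ _ (enorm_unit_dir y0); move=> /(_ (enorm y)); rewrite ny yr => /(_ isT) b.
rewrite -mulrBr; set X := l _ _ - l _ _ in b *.
have -> : (enorm y)^-1 * X - f1 (0, unit_dir y) =
  (enorm y)^-1 * (X - enorm y * f1 (0, unit_dir y)).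
  by field; rewrite gt_eqF.
rewrite normrM normfV (gtr0_norm ny) ler_pdivrMl//.
apply: le_trans b _; have -> : enorm y * (m * enorm y) = m * enorm y ^+ 2 by ring.
by rewrite ler_wpM2r ?sqr_ge0// ltW.
Unshelve. all: by end_near. Qed.

End PolarForms.

(** * Blow-up at the singular point *)

Section NormDerivatives.
Context {R : realType}.

Lemma is_derive_enorm n (a : R -> 'cV[R]_n) (t : R) da : is_derive t (1 : R) a da -> a t != 0 ->
  is_derive t (1 : R) (fun s => enorm (a s)) (dot (a t) da / enorm (a t)).
Proof.
move=> d a0; have p : 0 < dot (a t) (a t) by rewrite lt0r dot_eq0 a0 dot_ge0.
apply: is_derive_eq (is_derive_sqrt (f := fun s => dot (a s) (a s)) p (is_derive_dot d d)) _.
rewrite -/(enorm (a t)) (dotC da) -mulr2n -[X in X / _]mulr_natl; field.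
by rewrite enorm_eq0.
Qed.

Lemma derive_inv_enorm n (a : R -> 'cV[R]_n) (t : R) da c : is_derive t (1 : R) a da -> a t != 0 ->
  derive1 (fun s => c * (enorm (a s))^-1) t = - c * (dot (a t) da / enorm (a t) ^+ 3).
Proof.
move=> d a0; have e0 : enorm (a t) != 0 by rewrite enorm_eq0.
have [d1 d2] := is_derive_enorm d a0.
have dV := derivableV (f := fun s => enorm (a s)) e0 d1.
rewrite derive1E; have := deriveZ c dV; rewrite (deriveV (f := fun s => enorm (a s)) e0 d1) d2.
have -> : c \*: (fun y : R => (enorm (a y))^-1) = (fun s => c * (enorm (a s))^-1) by [].
have sc (x y : R) : x *: (y : R^o) = x * y by [].
move=> ->; rewrite !sc; field.
by [].
Qed.

Lemma derive_quotient_enorm n (a : R -> 'cV[R]_n) (b : R -> R) (t : R) da db c :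
  is_derive t (1 : R) a da -> is_derive t (1 : R) b db -> a t != 0 ->
  derive1 (fun s => c * (b s / enorm (a s) ^+ 3)) t =
  c * (db / enorm (a t) ^+ 3 - 3 * (b t * dot (a t) da / enorm (a t) ^+ 5)).
Proof.
move=> d d' a0; have e0 : enorm (a t) != 0 by rewrite enorm_eq0.
have dE := is_derive_enorm d a0.
have d3 : is_derive t (1 : R) (fun s => enorm (a s) ^+ 3)
    (3 * enorm (a t) ^+ 2 * (dot (a t) da / enorm (a t))).
  by have := is_deriveX 3 dE; rewrite exprfctE.
have e3 : enorm (a t) ^+ 3 != 0 by rewrite expf_neq0.
have [d31 d32] := d3.
have dV : is_derive t (1 : R) (fun s => (enorm (a s) ^+ 3)^-1)
   (- (enorm (a t) ^+ 3) ^- 2 * (3 * enorm (a t) ^+ 2 * (dot (a t) da / enorm (a t)))).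
  split; first exact: (derivableV (f := fun s => enorm (a s) ^+ 3) e3 d31).
  by rewrite (deriveV (f := fun s => enorm (a s) ^+ 3) e3 d31) d32.
have := is_deriveZ c (is_deriveM d' dV).
set f := c \*: _; have -> : f = (fun s => c * (b s / enorm (a s) ^+ 3)) by [].
move=> [_ e]; rewrite derive1E e.
have sc (x y : R) : x *: (y : R^o) = x * y by [].
rewrite !sc; field.
by [].
Qed.

End NormDerivatives.

Section BlowUp.
Context {R : realType} (r0 : R).
Hypothesis r00 : 0 < r0.
Local Notation vec := 'cV[R]_2.
Local Notation B := (ball (0 : 'cV[R]_2) r0).

Let oB : open B. Proof. exact: ball_open. Qed.

Lemma ball0P (y : vec) : B y <-> `|y| < r0.
Proof. by rewrite -ball_normE /ball_/= sub0r normrN. Qed.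

Lemma ball0_star (x : vec) (s : R) : B x -> 0 <= s <= 1 -> B (s *: x).
Proof.
move=> /ball0P xr /andP[s0 s1]; apply/ball0P; rewrite normrZ ger0_norm//.
by apply: le_lt_trans xr; rewrite ler_piMl.
Qed.

Let B0 : B 0. Proof. exact: ballxx. Qed.

(** The second variable ranges over all vectors, so that functions on the
    cylinder over the unit circle are restrictions of functions on an open set. *)
Definition blow_up_domain : set (R * vec) := [set q | B (q.1 *: q.2)].

Lemma blow_up_domain_open : open blow_up_domain.
Proof.
have c : continuous (fun q : R * vec => q.1 *: q.2) by exact: (@scale_continuous R vec).
by apply: (open_comp (f := fun q : R * vec => q.1 *: q.2) _ oB) => q _; exact: c.
Qed.

Let oD := blow_up_domain_open.

Lemma Ck_blow_up k (f : vec -> R) : Ck B k f ->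
  Ck blow_up_domain k (fun q : R * vec => f (q.1 *: q.2)).
Proof.
move=> Cf; apply: (Ck_comp oD oB _ _ Cf) => // i.
apply: (@Ck_eq _ _ _ _ (fun q : R * vec => q.1 * q.2 i 0)) => //.
  by move=> q _; rewrite mxE.
by apply: CkM => //; [exact: Ck_fst|exact: Ck_snd_coord].
Qed.

(** By Hadamard's lemma, a function that vanishes at [0] can be divided by the
    radius without loss of smoothness. *)
Lemma blow_up1 (u : vec -> R) : Cinfty B u -> u 0 = 0 ->
  exists2 v : R -> vec -> R,
    Cinfty blow_up_domain (fun q : R * vec => v q.1 q.2 : R) &
    (forall (rho : R) (h : vec), B (rho *: h) -> u (rho *: h) = rho * v rho h) /\
    (forall h : vec, v 0 h = 'D_h u 0).
Proof.
move=> Cu u0; have [b [Cb ub b0 _]] := hadamard1 oB ball0_star Cu B0 u0.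
exists (fun (rho : R) (h : vec) => \sum_j h j 0 * b j (rho *: h)); last split.
- move=> k; apply: (@Ck_sum _ _ _ _ _ _ (fun j (q : R * vec) => q.2 j 0 * b j (q.1 *: q.2))) => // j _.
  by apply: CkM => //; [exact: Ck_snd_coord|apply: Ck_blow_up; exact: Cb].
- move=> rho h Bh; rewrite ub// mulr_sumr; apply: eq_bigr => j _.
  by rewrite mxE mulrA.
- move=> h; rewrite derive_col; last exact: Cinfty_differentiable oB Cu B0.
  by apply: eq_bigr => j _; rewrite scale0r b0.
Qed.

(** As [blow_up1], with two powers of the radius for a function that vanishes to
    second order. *)
Lemma blow_up2 (u : vec -> R) : Cinfty B u -> u 0 = 0 -> (forall v, 'D_v u 0 = 0) ->
  exists2 v : R -> vec -> R,
    Cinfty blow_up_domain (fun q : R * vec => v q.1 q.2 : R) &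
    forall (rho : R) (h : vec), B (rho *: h) -> u (rho *: h) = rho ^+ 2 * v rho h.
Proof.
move=> Cu u0 du0.
have [c [Cc uc _ _]] := hadamard2 oB ball0_star Cu B0 u0 (fun i => du0 _).
exists (fun (rho : R) (h : vec) => \sum_i \sum_j h i 0 * h j 0 * c i j (rho *: h)).
- move=> k; apply: (@Ck_sum _ _ _ _ _ _ (fun i (q : R * vec) =>
    \sum_j q.2 i 0 * q.2 j 0 * c i j (q.1 *: q.2))) => // i _.
  apply: (@Ck_sum _ _ _ _ _ _ (fun j (q : R * vec) =>
    q.2 i 0 * q.2 j 0 * c i j (q.1 *: q.2))) => // j _.
  apply: CkM => //; last by apply: Ck_blow_up; exact: Cc.
  by apply: CkM => //; exact: Ck_snd_coord.
- move=> rho h Bh; rewrite uc// mulr_sumr; apply: eq_bigr => i _.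
  by rewrite mulr_sumr; apply: eq_bigr => j _; rewrite !mxE; ring.
Qed.

Section Quotients.
Variables (P : vec -> 'cV[R]_3) (A : R -> vec -> 'cV[R]_3).
Hypotheses (CA : forall k, Cinfty blow_up_domain (fun q : R * vec => A q.1 q.2 k 0 : R))
  (PA : forall (rho : R) (h : vec), B (rho *: h) -> P (rho *: h) = rho *: A rho h)
  (P_inj : forall y : vec, B y -> P y = 0 -> y = 0)
  (A_inj : forall h : vec, A 0 h = 0 -> h = 0).

Definition regular_domain : set (R * vec) :=
  blow_up_domain `&` [set q | A q.1 q.2 != 0].

Let dotA k : Ck blow_up_domain k (fun q : R * vec => dot (A q.1 q.2) (A q.1 q.2)).
Proof.
apply: (@Ck_eq _ _ _ _ (fun q : R * vec => \sum_i A q.1 q.2 i 0 * A q.1 q.2 i 0)) => //.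
  by move=> q _; rewrite dotE.
apply: (@Ck_sum _ _ _ _ _ _ (fun i (q : R * vec) => A q.1 q.2 i 0 * A q.1 q.2 i 0)) => // i _.
by apply: CkM => //; exact: CA.
Qed.

Lemma regular_domain_open : open regular_domain.
Proof.
rewrite openE => q [Dq /= Aq].
have p : 0 < dot (A q.1 q.2) (A q.1 q.2) by rewrite lt0r dot_eq0 Aq dot_ge0.
have [cS _] := dotA 0; have cq := cS q Dq.
have n1 : \forall x \near q, 0 < dot (A x.1 x.2) (A x.1 x.2).
  exact: (@cvgr_gt _ _ (nbhs q) _ _ _ cq 0 p).
have n2 : \forall x \near q, blow_up_domain x := open_nbhs_nbhs (conj oD Dq).
apply: filterS2 n1 n2 => x x1 x2; split=> //=.
by rewrite -dot_eq0 gt_eqF.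
Qed.

(** For nonzero [rho] a zero of [A rho h] is a zero of [P], and at [rho = 0] the
    injectivity of [A 0] applies. *)
Lemma cylinder_regular : cylinder r0 `<=` regular_domain.
Proof.
move=> [rho h] [/= rr h1].
have D : blow_up_domain (rho, h).
  apply/ball0P => /=; apply: le_lt_trans (norm_le_enorm _) _.
  by rewrite enormZ h1 mulr1 ltr_norml.
have hN0 : h != 0 by rewrite -enorm_eq0 h1 oner_neq0.
split=> //=; apply: contra hN0 => /eqP A0; apply/eqP.
have [rho0|rho0] := eqVneq rho 0; first by apply: A_inj; rewrite -rho0.
have : rho *: h = 0 by apply: P_inj => //; rewrite PA// A0 scaler0.
by move=> /eqP; rewrite scaler_eq0 (negbTE rho0) => /eqP.
Qed.

Let enormA k : Ck regular_domain k (fun q : R * vec => enorm (A q.1 q.2)).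
Proof.
apply: Ck_sqrt; first exact: regular_domain_open.
  by move=> q [_ /= Aq]; rewrite lt0r dot_eq0 Aq dot_ge0.
by apply: Ck_sub (dotA k) => q [].
Qed.

Let enormA0 q : regular_domain q -> enorm (A q.1 q.2) != 0.
Proof. by move=> [_ /=]; rewrite enorm_eq0. Qed.

Let oO := regular_domain_open.

(** The factor [rho] comes out of the norm of [P (rho *: h) = rho *: A rho h], and
    [A] does not vanish on the cylinder. *)
Lemma inv_norm_expansion (s : vec -> R) (c : R) :
  (forall y : vec, B y -> s y = c * (enorm (P y))^-1) ->
  let l := fun (rho : R) (h : vec) => c * (enorm (A rho h))^-1 in
  polar_form r0 s l /\ two_term_expansion s l.
Proof.
move=> sP l.
have Cl : Cinfty regular_domain (fun q : R * vec => l q.1 q.2 : R).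
  by move=> k; apply: CkZ => //; apply: CkV.
have pf : polar_form r0 s l.
  apply: (polar_formI oO cylinder_regular Cl) => rho h /andP[rho0 rr] h1.
  have [D _] : regular_domain (rho, h).
    by apply: cylinder_regular; split=> //=; rewrite rr andbT (lt_trans _ rho0)// oppr_lt0.
  by rewrite sP// PA// enormZ gtr0_norm// invfM /l; ring.
by split=> //; exact: (two_term_expansionI r00 oO cylinder_regular Cl pf).
Qed.

(** The numerator vanishes to second order, and the denominator to third order, so
    that one inverse power of the radius is left. *)
Lemma inv_norm_cube_expansion (s N : vec -> R) (n : R -> vec -> R) (c : R) :
  Cinfty blow_up_domain (fun q : R * vec => n q.1 q.2 : R) ->
  (forall (rho : R) (h : vec), B (rho *: h) -> N (rho *: h) = rho ^+ 2 * n rho h) ->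
  (forall y : vec, B y -> s y = c * (N y / enorm (P y) ^+ 3)) ->
  let l := fun (rho : R) (h : vec) => c * (n rho h / enorm (A rho h) ^+ 3) in
  polar_form r0 s l /\ two_term_expansion s l.
Proof.
move=> Cn Nn sP l.
have Cl : Cinfty regular_domain (fun q : R * vec => l q.1 q.2 : R).
  move=> k; apply: CkZ => //; apply: CkM => //; first by apply: Ck_sub (Cn k) => q [].
  apply: CkV => //; first by move=> q /enormA0 h; rewrite expf_neq0.
  by rewrite (_ : (fun q => _) = fun q : R * vec => enorm (A q.1 q.2) *
    (enorm (A q.1 q.2) * enorm (A q.1 q.2))); [apply: CkM => //; exact: CkM|
    rewrite funeqE => q; ring].
have pf : polar_form r0 s l.
  apply: (polar_formI oO cylinder_regular Cl) => rho h /andP[rho0 rr] h1.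
  have [D Ah] : regular_domain (rho, h).
    by apply: cylinder_regular; split=> //=; rewrite rr andbT (lt_trans _ rho0)// oppr_lt0.
  have e0 : enorm (A rho h) != 0 by rewrite enorm_eq0.
  rewrite sP// PA// enormZ gtr0_norm// Nn// /l; field.
  by rewrite e0 lt0r_neq0.
by split=> //; exact: (two_term_expansionI r00 oO cylinder_regular Cl pf).
Qed.

End Quotients.

End BlowUp.

(** * The signed distance along a normal line *)

Section SignedDistance.
Context {R : realType} (G Om : set 'cV[R]_3) (xs n : 'cV[R]_3) (t : R).
Hypotheses (smG : smooth_surface_bounding G Om) (nP : is_outward_unit_normal Om xs n)
  (cl : is_closest G (xs + t *: n) xs).

Let not_G_dichotomy x : closure Om x -> ~ G x -> Om x.
Proof.
have [_ _ GE _] := smG => cx nGx; apply: contrapT => nO; apply: nGx.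
by rewrite GE; split=> // /interior_subset.
Qed.

Let enorm_n : enorm n = 1. Proof. by case: nP. Qed.

Let segment_off_G (s : R) : t != 0 -> 0 < s <= 1 -> ~ G (xs + (s * t) *: n).
Proof.
move=> t0 /andP[s0 s1] Gs; have [_ /(_ _ Gs)] := cl.
rewrite addrC addKr.
have -> : xs + t *: n - (xs + (s * t) *: n) = ((1 - s) * t) *: n.
  by rewrite opprD addrACA subrr add0r -scalerBl mulrBl mul1r.
rewrite !enormZ enorm_n !mulr1 normrM (@ger0_norm _ (1 - s)) ?subr_ge0//.
have : 0 < `|t| by rewrite normr_gt0.
by nra.
Qed.

Let segment_connected : t != 0 -> (exists2 s : R, 0 < s <= 1 & Om (xs + (s * t) *: n)) ->
  forall s : R, 0 < s <= 1 -> Om (xs + (s * t) *: n).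
Proof.
move=> t0 [s1 s101 Os1] s s01.
pose u (s : R) := xs + (s * t) *: n.
have cu : continuous u.
  move=> r; apply: (@cvgD _ _ _ (nbhs r)); first exact: cvg_cst.
  by apply: cvgZr_tmp; apply: cvgM; [exact: cvg_id|exact: cvg_cst].
have I01 : connected (`]0%R, 1%R]%classic : set R).
  by apply/connected_intervalP; exact: interval_is_interval.
have := I01 (`]0%R, 1%R]%classic `&` u @^-1` Om).
have inI (r : R) : `]0%R, 1%R]%classic r = (0 < r <= 1) :> Prop by rewrite /= in_itv.
move=> /(_ _ _ _) h.
have {}h : `]0%R, 1%R]%classic `&` u @^-1` Om = `]0%R, 1%R]%classic.
  apply: h.
  - by exists s1; split=> //; rewrite inI.
  - by exists (u @^-1` Om) => //; apply: open_comp => [r _|]; [exact: cu|case: smG].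
  - exists (u @^-1` closure Om).
      exact: ((continuous_closedP _).1 cu _ (@closed_closure _ _)).
    rewrite eqEsubset; split=> r [Ir Or]; split=> //; first exact: subset_closure.
    by apply: not_G_dichotomy Or _; apply: segment_off_G => //; rewrite -inI.
have [_ +] : (`]0%R, 1%R]%classic `&` u @^-1` Om) s by rewrite h inI.
by [].
Qed.

(** The segment from [xs] to [xs + t *: n] meets [G] only at [xs], since any other
    point of [G] on it would be closer than [xs]. By connectedness the rest of it
    lies either in [Om] or outside its closure, and the behaviour of an outward
    normal near [xs] tells which. *)
Lemma signed_dist_normal : signed_dist G Om (xs + t *: n) = t.
Proof.
have d : dist G (xs + t *: n) = `|t|.
  by rewrite (dist_closest cl) addrC addKr enormZ enorm_n mulr1.
have Gxs : G xs by case: cl.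
rewrite /signed_dist d; have [t0|t0|t0] := ltgtP t 0; last first.
- by rewrite t0 normr0 oppr0; case: ifP.
- case: asboolP => Ot; last by rewrite gtr0_norm.
  exfalso.
  have all := segment_connected (lt0r_neq0 t0) (ex_intro2 _ _ 1 _ _).
  have {}all (s : R) : 0 < s <= 1 -> Om (xs + (s * t) *: n).
    by apply: all; rewrite ?ltr01 ?lexx// mul1r.
  have [_ _ near0] := nP.
  have n1 : \forall s \near (0 : R)^'+, 0 < s by exact: nbhs_right_gt.
  have n2 : \forall s \near (0 : R)^'+, s < t by apply: nbhs_right_lt.
  have [s [[[_ nc] s0] st]] := @filter_ex _ (0 : R)^'+ _ _ (filterI (filterI near0 n1) n2).
  have Os : Om (xs + s *: n).
    have := all (s / t); rewrite divr_gt0// ler_pdivrMr// mul1r (ltW st) divfK ?gt_eqF//.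
    exact.
  by apply: nc; exact: subset_closure.
- case: ifPn => [_|/asboolPn nO]; first by rewrite ltr0_norm// opprK.
  have t0' : t != 0 by rewrite lt_eqF.
  suff /nO : Om (xs + t *: n) by [].
  have [_ _ near0] := nP.
  have n1 : \forall s \near (0 : R)^'+, 0 < s by exact: nbhs_right_gt.
  have n2 : \forall s \near (0 : R)^'+, s < - t by apply: nbhs_right_lt; rewrite oppr_gt0.
  have [s [[[Os _] s0] st]] := @filter_ex _ (0 : R)^'+ _ _ (filterI (filterI near0 n1) n2).
  have tN : 0 < - t by rewrite oppr_gt0.
  rewrite -[t]mul1r; apply: (segment_connected t0'); last by rewrite ltr01 lexx.
  exists (s / - t); first by rewrite divr_gt0// ler_pdivrMr// mul1r ltW.
  have -> : s / - t * t = - s by field; rewrite t0'.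
  by rewrite scaleNr.
Qed.

End SignedDistance.

(** * Coefficients in the principal frame *)

Section GraphJet.
Context {R : realType} (f : 'cV[R]_2 -> R) (r : R).
Hypothesis r0 : 0 < r.
Local Notation vec := 'cV[R]_2.
Local Notation B := (ball (0 : 'cV[R]_2) r).
Local Notation M := (hessian f 0).
Local Notation "''d_' i f" := (derive f ^~ (delta_mx i 0))
  (at level 10, i, f at next level, format "''d_' i  f").
Hypotheses (Cf : Cinfty B f) (f0 : f 0 = 0) (df0 : gradient f 0 = 0).

Let oB : open B. Proof. exact: ball_open. Qed.
Let B0 : B 0. Proof. exact: ballxx. Qed.

Let Cd i : Cinfty B ('d_i f). Proof. exact: Cinfty_derive. Qed.
Let Cdd i j : Cinfty B ('d_j ('d_i f)). Proof. exact: Cinfty_derive. Qed.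

Lemma e_x2E : e_x2 R = delta_mx 0 0.
Proof. by apply/colP; case; case=> [|[|]]// ?; rewrite !mxE. Qed.

Lemma e_y2E : e_y2 R = delta_mx 1 0.
Proof. by apply/colP; case; case=> [|[|]]// ?; rewrite !mxE. Qed.

Lemma hessian_sym i j : M i j = M j i.
Proof. by rewrite !mxE; exact: (deriveC oB (Cf 2) B0). Qed.

Let T3 := locked (fun i j k => 'd_k ('d_j ('d_i f)) 0).

Let T3_23 i j k : T3 i j k = T3 i k j.
Proof. by rewrite /T3 -lock; exact: (deriveC oB (Cd i 2) B0). Qed.

(** The symmetry of second derivatives is needed in a neighbourhood of [0], because
    it is differentiated once more. *)
Let T3_12 i j k : T3 i j k = T3 j i k.
Proof.
rewrite /T3 -lock; apply: near_eq_derive; apply: filterS (open_nbhs_nbhs (conj oB B0)) => x Bx.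
exact: (deriveC oB (Cf 2) Bx).
Qed.

Let sum2 (F : 'I_2 -> R) : \sum_i F i = F 0 + F 1.
Proof. by rewrite !big_ord_recl big_ord0 addr0; congr (_ + F _); exact: val_inj. Qed.

Lemma dot2 (u v : vec) : dot u v = u 0 0 * v 0 0 + u 1 0 * v 1 0.
Proof. by rewrite dotE sum2. Qed.

Let third i j (a : vec) : 'D_a ('d_j ('d_i f)) 0 = a 0 0 * T3 i j 0 + a 1 0 * T3 i j 1 :> R.
Proof. by rewrite /T3 -lock derive_col ?sum2//; exact: Cinfty_differentiable oB (Cdd i j) B0. Qed.

Let thirdE : [/\ 'D_(e_x2 R) ('D_(e_x2 R) ('D_(e_x2 R) f)) 0 = T3 0 0 0 :> R,
  'D_(e_y2 R) ('D_(e_x2 R) ('D_(e_x2 R) f)) 0 = T3 0 0 1 :> R,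
  'D_(e_y2 R) ('D_(e_y2 R) ('D_(e_x2 R) f)) 0 = T3 0 1 1 :> R &
  'D_(e_y2 R) ('D_(e_y2 R) ('D_(e_y2 R) f)) 0 = T3 1 1 1 :> R].
Proof. by rewrite /T3 -lock e_x2E e_y2E. Qed.

Let vec2E (a b : R) i : vec2 a b i 0 = if i == 0 then a else b.
Proof. by rewrite mxE; case: i; case=> [|[|]]. Qed.

Let I2P (P : 'I_2 -> Prop) : P 0 -> P 1 -> forall i, P i.
Proof.
move=> P0 P1; case; case=> [|[|//]] p.
  by rewrite (_ : Ordinal p = 0)//; exact: val_inj.
by rewrite (_ : Ordinal p = 1)//; exact: val_inj.
Qed.

Let quadratic_C_coef (a : vec) xxx xxy xyy yyy :
  'D_(e_x2 R) ('D_(e_x2 R) ('D_(e_x2 R) f)) 0 = xxx ->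
  'D_(e_y2 R) ('D_(e_x2 R) ('D_(e_x2 R) f)) 0 = xxy ->
  'D_(e_y2 R) ('D_(e_y2 R) ('D_(e_x2 R) f)) 0 = xyy ->
  'D_(e_y2 R) ('D_(e_y2 R) ('D_(e_y2 R) f)) 0 = yyy ->
  let x := a 0 0 in let y := a 1 0 in
  quadratic_C f a = 2^-1 *: vec2 (xxx * x ^+ 2 + 2 * xxy * x * y + xyy * y ^+ 2)
    (yyy * y ^+ 2 + 2 * xyy * x * y + xxy * x ^+ 2).
Proof. by move=> <- <- <- <-. Qed.

Let cubic_B_coef (a : vec) xxx xxy xyy yyy :
  'D_(e_x2 R) ('D_(e_x2 R) ('D_(e_x2 R) f)) 0 = xxx ->
  'D_(e_y2 R) ('D_(e_x2 R) ('D_(e_x2 R) f)) 0 = xxy ->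
  'D_(e_y2 R) ('D_(e_y2 R) ('D_(e_x2 R) f)) 0 = xyy ->
  'D_(e_y2 R) ('D_(e_y2 R) ('D_(e_y2 R) f)) 0 = yyy ->
  let x := a 0 0 in let y := a 1 0 in
  cubic_B f a = 2^-1 * (xxx * (x ^+ 3 / 3) + yyy * (y ^+ 3 / 3)
          + xxy * x ^+ 2 * y + xyy * x * y ^+ 2).
Proof. by move=> <- <- <- <-. Qed.

(** By the symmetry of third derivatives, [quadratic_C] is half the third derivative
    of [f] contracted twice with [a]; [cubic_BE] is the analogue for [cubic_B]. *)
Lemma quadratic_CE (a : vec) i :
  quadratic_C f a i 0 = 2^-1 * \sum_j a j 0 * 'D_a ('d_j ('d_i f)) 0.
Proof.
transitivity (2^-1 * \sum_j a j 0 * (a 0 0 * T3 i j 0 + a 1 0 * T3 i j 1)); last first.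
  by congr (_ * _); apply: eq_bigr => j _; congr (_ * _); exact: esym (third i j a).
have [e1 e2 e3 e4] := thirdE; rewrite (quadratic_C_coef a e1 e2 e3 e4).
rewrite sum2 mxE vec2E; elim/I2P: i => /=.
  by rewrite (T3_23 0 1 0); field.
by rewrite (T3_12 1 0 0) (T3_23 0 1 0) (T3_12 1 0 1) (T3_23 1 1 0) (T3_12 1 0 1); field.
Qed.

Lemma cubic_BE (a : vec) :
  cubic_B f a = 6^-1 * \sum_i a i 0 * \sum_j a j 0 * 'D_a ('d_j ('d_i f)) 0.
Proof.
transitivity (6^-1 * \sum_i a i 0 * \sum_j a j 0 * (a 0 0 * T3 i j 0 + a 1 0 * T3 i j 1)); last first.
  congr (_ * _); apply: eq_bigr => i _; congr (_ * _); apply: eq_bigr => j _.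
  by congr (_ * _); exact: esym (third i j a).
have [e1 e2 e3 e4] := thirdE; rewrite (cubic_B_coef a e1 e2 e3 e4) !sum2.
by rewrite (T3_12 1 0 0) (T3_23 0 1 0) (T3_12 1 0 1) (T3_23 1 1 0) (T3_12 1 0 1); field.
Qed.

Let is_derive_along (c : vec -> R) (al : R -> vec) dal : Cinfty B c ->
  is_derive (0 : R) (1 : R) al dal ->
  is_derive (0 : R) (1 : R) (fun t : R => c (t *: al t)) ('D_(al 0) c 0).
Proof.
move=> Cc d; have dc := Cinfty_differentiable oB Cc B0.
have dw : is_derive (0 : R) (1 : R) (fun t : R => t *: al t) (al 0).
  apply: is_derive_mx => i j; rewrite (ord1 j).
  have di := is_derive_coord i d.
  have := is_deriveM (is_derive_id (0 : R) (1 : R)) di.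
  rewrite scale0r add0r [X in is_derive _ _ _ X]mulr1.
  by congr is_derive; rewrite funeqE => t; rewrite !mxE.
rewrite deriveE//.
have dc' : differentiable c ((fun t : R => t *: al t) 0) by rewrite scale0r.
have := is_derive_comp_diff (u := fun t : R => t *: al t) dc' dw.
by rewrite scale0r.
Qed.

Let cubic_key (a b : vec) (c T : 'I_2 -> 'I_2 -> R) (N : 'M[R]_2) :
  (forall i j, c i j = 2^-1 * N i j) -> (forall i j, N i j = N j i) ->
  dot b (\col_i dot a (\col_j c i j))
    + dot a (\col_i (dot b (\col_j c i j) + dot a (\col_j (6^-1 * T i j))))
  = dot a (N *m b) + 6^-1 * \sum_i a i 0 * \sum_j a j 0 * T i j.
Proof.
by move=> cN NC; rewrite !dot2 !mxE !dot2 !sum2 !mxE !cN (NC 1 0); field.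
Qed.

(** Along [w = t *: a] the height of the graph is [t ^+ 2] times, and its gradient
    [t] times, a smooth function of [t] and [a]. The values and derivatives of these
    functions along a curve [al] at [t = 0] determine all the coefficients. *)
Lemma graph_blow_up : exists (F : R -> vec -> R) (E : 'I_2 -> R -> vec -> R),
  [/\ forall (t : R) (a : vec), B (t *: a) -> f (t *: a) = t ^+ 2 * F t a,
      forall i (t : R) (a : vec), B (t *: a) -> 'd_i f (t *: a) = t * E i t a &
      forall (al : R -> vec) dal, is_derive (0 : R) (1 : R) al dal ->
      [/\ F 0 (al 0) = 2^-1 * dot (al 0) (M *m al 0),
         is_derive (0 : R) (1 : R) (fun t => F t (al t))
           (dot (al 0) (M *m dal) + cubic_B f (al 0)),
         forall i, E i 0 (al 0) = (M *m al 0) i 0 &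
         forall i, is_derive (0 : R) (1 : R) (fun t => E i t (al t))
           ((M *m dal + quadratic_C f (al 0)) i 0)]].
Proof.
have df i : 'd_i f 0 = 0 by have /colP/(_ i) := df0; rewrite !mxE.
have [c [Cc fc c0 dc]] := hadamard2 oB (ball0_star (r0 := r)) Cf B0 f0 df.
have /choice[e he] i := hadamard1 oB (ball0_star (r0 := r)) (Cd i) B0 (df i).
exists (fun t a => dot a (\col_i dot a (\col_j c i j (t *: a)))),
  (fun i t a => dot a (\col_j e i j (t *: a))); split.
- move=> t a Ba; rewrite fc// dotE mulr_sumr; apply: eq_bigr => i _.
  rewrite [in RHS]mxE dotE mulr_sumr mulr_sumr; apply: eq_bigr => j _; rewrite !mxE; ring.
- move=> i t a Ba; have [_ -> // _ _] := he i; rewrite dotE mulr_sumr.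
  by apply: eq_bigr => j _; rewrite !mxE mulrA.
move=> al dal d; set a := al 0.
have e0 i j : e i j 0 = M i j by have [_ _ -> _] := he i; rewrite mxE.
have de i : is_derive (0 : R) (1 : R) (fun t : R => \col_j e i j (t *: al t))
    (\col_j (2^-1 * 'D_a ('d_j ('d_i f)) 0)).
  apply: is_derive_mx => j k; have [Ce _ _ dE] := he i; rewrite mxE -dE.
  by under eq_fun do rewrite mxE; apply: is_derive_along d; exact: Ce.
have dcj i : is_derive (0 : R) (1 : R) (fun t : R => \col_j c i j (t *: al t))
    (\col_j (6^-1 * 'D_a ('d_j ('d_i f)) 0)).
  apply: is_derive_mx => j k; rewrite mxE -dc.
  by under eq_fun do rewrite mxE; apply: is_derive_along d; exact: Cc.
have dci : is_derive (0 : R) (1 : R) (fun t : R => \col_i dot (al t) (\col_j c i j (t *: al t)))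
    (\col_i (dot dal (\col_j c i j 0) + dot a (\col_j (6^-1 * 'D_a ('d_j ('d_i f)) 0)))).
  apply: is_derive_mx => i k; under eq_fun do rewrite mxE; rewrite mxE.
  by have := is_derive_dot d (dcj i); rewrite scale0r.
split.
- rewrite dotE [in RHS]dotE mulr_sumr; apply: eq_bigr => i _; rewrite !mxE dotE.
  rewrite mulr_sumr mulr_sumr mulr_sumr; apply: eq_bigr => j _.
  by rewrite scale0r !mxE c0; ring.
- apply: is_derive_eq (is_derive_dot d dci) _; rewrite (scale0r (al 0)).
  rewrite cubic_BE; apply: cubic_key => [i j|i j]; last exact: hessian_sym.
  by rewrite c0 mxE.
- move=> i; rewrite dotE mxE; apply: eq_bigr => j _.
  by rewrite !mxE scale0r e0 mulrC mxE.
- move=> i; apply: is_derive_eq (is_derive_dot d (de i)) _; rewrite scale0r.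
  rewrite [RHS]mxE quadratic_CE; congr (_ + _).
    by rewrite dotE mxE; apply: eq_bigr => j _; rewrite !mxE e0 mulrC mxE.
  rewrite dotE mulr_sumr; apply: eq_bigr => j _; rewrite mxE; ring.
Qed.

End GraphJet.

Section ExplicitCoefficients.
Context {R : realType} (Q : 'M[R]_3) (f : 'cV[R]_2 -> R) (eta : R) (y : 'cV[R]_2).
Local Notation vec := 'cV[R]_2.
Local Notation M := (hessian f 0).
Local Notation A := (@ulsubmx R 2 1 2 1 Q^T).
Local Notation s := (dot ((@dlsubmx R 2 1 2 1 Q^T)^T) y).
Local Notation D0 := (invmx (1%:M - eta *: M)).
Local Notation p := (D0 *m (A *m y)).
Local Notation C := (quadratic_C f p).
Hypotheses (MT : M^T = M) (uK : 1%:M - eta *: M \in unitmx).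

(** The resolvent commutes with the Hessian; this and the symmetry of both
    matrices account for the different arrangements of factors in the explicit
    formulas. *)
Let D0M : D0 *m M = M *m D0.
Proof.
have c : (1%:M - eta *: M) *m M = M *m (1%:M - eta *: M).
  by rewrite mulmxBl mulmxBr mul1mx mulmx1 -scalemxAl -scalemxAr.
move: c uK; move: (1%:M - _) => K c uK'.
by rewrite -[LHS](mulmxK uK') -[invmx K *m M *m K]mulmxA -c mulmxA mulVmx// mul1mx.
Qed.

Let D0T : D0^T = D0.
Proof. by rewrite trmx_inv linearB linearZ/= trmx1 MT. Qed.

Let dotD0 (u v : vec) : dot (D0 *m u) v = dot u (D0 *m v).
Proof. by rewrite dot_mulmxl D0T. Qed.

Let dotM (u v : vec) : dot (M *m u) v = dot u (M *m v).
Proof. by rewrite dot_mulmxl MT. Qed.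

Let dotA (u v : vec) : dot u (A^T *m v) = dot (A *m u) v.
Proof. by rewrite dot_mulmxl. Qed.

Lemma chi0E : chi0 Q f eta y = p.
Proof. by rewrite /chi0 mulmxA. Qed.

Lemma chi1E : chi1 Q f eta y = D0 *m (s *: (M *m p) + eta *: C).
Proof.
rewrite /chi1 -chi0E /chi0; move: (quadratic_C f _) => c; rewrite mulmxDr -!scalemxAr.
by rewrite !mulmxA -[D0 *m D0 *m M]mulmxA {1}D0M !mulmxA.
Qed.

Let a1 := chi1 Q f eta y.

Lemma xi0E : xi0 Q f eta y = 2^-1 * dot p (M *m p).
Proof. by rewrite /xi0 -!mulmxA dotA D0T dotD0. Qed.

Let dot_chi1 : dot p (M *m a1) =
  s * dot (A *m y) (D0 *m (M *m (D0 *m (M *m p)))) + eta * dot (D0 *m (M *m p)) C.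
Proof.
rewrite /a1 chi1E; move: C => c; rewrite mulmxDr mulmxDr -!scalemxAr dotDr !dotZr.
by rewrite !dotD0 dotM dotD0.
Qed.

Let cubic_term : dot (D0 *m C) (M *m p) = dot (D0 *m (M *m p)) C.
Proof. by rewrite dotD0 dotC. Qed.

Let cubic_term' : dot p (M *m (D0 *m C)) = dot (D0 *m (M *m p)) C.
Proof. by rewrite -dotM dotD0. Qed.

Lemma xi1E : xi1 Q f eta y = dot p (M *m a1) + cubic_B f p.
Proof.
rewrite /xi1 dot_chi1 MT D0T -/(chi0 Q f eta y) chi0E -!mulmxA dotA cubic_term cubic_term'.
have -> : M *m (D0 *m (D0 *m (M *m p))) = D0 *m (M *m (D0 *m (M *m p))).
  by rewrite !mulmxA D0M.
by field.
Qed.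

Lemma xi1_tildeE : xi1_tilde Q f eta y = dot p (M *m a1) + dot p C - cubic_B f p.
Proof.
rewrite /xi1_tilde dot_chi1 D0T -/(chi0 Q f eta y) chi0E -!mulmxA !dotA cubic_term cubic_term'.
have -> : D0 *m (M *m (A *m y)) = M *m p by rewrite [LHS]mulmxA D0M -mulmxA.
have -> : dot (A *m y) (D0 *m ((1%:M + eta *: (M *m D0)) *m C)) =
    dot p C + eta * dot (D0 *m (M *m p)) C.
  rewrite -dotD0 mulmxDl mul1mx -scalemxAl dotDr dotZr -mulmxA.
  by rewrite cubic_term'.
by field.
Qed.

End ExplicitCoefficients.

(** Identities between blown-up functions are obtained by dividing by powers of [t],
    hence for nonzero [t] only. *)
Lemma is_derive_punctured (R : realType) (phi psi : R -> R) dphi dpsi :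
  is_derive (0 : R) (1 : R) phi dphi -> is_derive (0 : R) (1 : R) psi dpsi ->
  (\forall t \near (0 : R), t != 0 -> phi t = psi t) -> phi 0 = psi 0 /\ dphi = dpsi.
Proof.
move=> d d' e.
have c (g : R -> R) dg : is_derive (0 : R) (1 : R) g dg -> g @ (0 : R)^' --> g 0.
  move=> [dd _] P gP; apply: nbhs_dnbhs.
  have cg : {for (0 : R), continuous g}.
    by apply: differentiable_continuous; exact/derivable1_diffP.
  exact: cg.
have e0 : phi 0 = psi 0.
  have h : phi @ (0 : R)^' --> psi 0.
    apply: cvg_trans (c _ _ d'); apply: near_eq_cvg.
    have n0 : \forall s \near (0 : R)^', s != 0 by exact: nbhs_dnbhs_neq.
    by apply: filterS2 n0 (nbhs_dnbhs e) => t t0 h; rewrite h.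
  exact: (cvg_unique _ (c _ _ d) h).
split=> //; have e' : \forall t \near (0 : R), phi t = psi t.
  by apply: filterS e => t h; have [->|/h] := eqVneq t 0.
have [_ <-] := d; have [_ <-] := d'; exact: near_eq_derive.
Qed.

Section FrameExpansion.
Context {R : realType} (G : set 'cV[R]_3) (xs : 'cV[R]_3) (Q : 'M[R]_3) (f : 'cV[R]_2 -> R)
  (W : set 'cV[R]_2) (V : set 'cV[R]_3) (eta : R).
Local Notation vec := 'cV[R]_2.
Local Notation M := (hessian f 0).
Local Notation "''d_' i f" := (derive f ^~ (delta_mx i 0))
  (at level 10, i, f at next level, format "''d_' i  f").
Hypotheses (lg : local_graph G xs Q f W V) (df0 : gradient f 0 = 0)
  (uK : 1%:M - eta *: M \in unitmx).
Variables (u : vec) (s : R) (x a : R -> 'cV[R]_3) (da : 'cV[R]_3).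
Hypotheses (d : is_derive (0 : R) (1 : R) a da)
  (cl : \forall t \near (0 : R), is_closest G (x t) (xs + t *: a t))
  (xE : forall t : R, Q^T *m (x t - xs) = vec3 (t *: u) (eta + t * s)).

Let al (t : R) := horizontal (Q^T *m a t).
Let dal := horizontal (Q^T *m da).

Let is_derive_al : is_derive (0 : R) (1 : R) al dal.
Proof. exact: (linear_col_is_derive (@horizontal_linear R) (is_derive_mulmx Q^T d)). Qed.

Let chart_near r : 0 < r -> \forall t \near (0 : R),
  [/\ ball (0 : vec) r (t *: al t), W (t *: al t), xs + t *: a t = chart xs Q f (t *: al t) &
      forall i, foot_eq f (vec3 (t *: u) (eta + t * s)) (t *: al t) i = 0].
Proof.
move=> r0; have [[oQ oW W0 nV] Cf f0 GX XG] := lg.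
have ca : {for 0, continuous a}.
  apply: differentiable_continuous; apply/derivable1_diffP; exact: (ex_derive (is_derive := d)).
have cp : (fun t : R => xs + t *: a t) @ (0 : R) --> xs.
  rewrite [X in _ --> X](_ : xs = xs + (0 : R) *: a 0); last by rewrite scale0r addr0.
  apply: cvgD; first exact: cvg_cst.
  by apply: cvgZ; [exact: cvg_id|exact: ca].
have wE (t : R) : chart_coord xs Q (xs + t *: a t) = t *: al t.
  by rewrite /chart_coord addrC addKr -scalemxAr horizontalZ.
have cw : t *: al t @[t --> (0 : R)] --> (0 : vec).
  have h := @cvg_comp _ _ _ (fun t : R => xs + t *: a t) (chart_coord xs Q) _ _ _ cp
    (@chart_coord_continuous _ xs Q xs).
  rewrite chart_coord0 in h.
  by apply: cvg_trans h; apply: near_eq_cvg; apply: nearW => t; rewrite /= wE.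
have n1 : \forall t \near (0 : R), V (xs + t *: a t) by exact: cp.
have n2 : \forall t \near (0 : R), ball (0 : vec) r (t *: al t).
  by apply: cw; exact: nbhsx_ballx.
apply: filterS3 cl n1 n2 => t ct Vt Bt.
have [Wt e] := XG _ Vt ct.1; rewrite wE in Wt e.
split=> // i; move: ct; rewrite e => ct.
by have := closest_foot_eq lg Wt ct i; rewrite xE.
Qed.

Let is_derive_t : is_derive (0 : R) (1 : R) (fun t : R => t) 1.
Proof. exact: is_derive_id. Qed.

(** Write [w = t *: al t] for the coordinates of the foot point of [x t], with [F] and
    [E] from [graph_blow_up]. The foot-point equation divided by [t] is
    [al t - u + (t ^+ 2 * F - eta - t * s) * E = 0]; its value and derivative at
    [t = 0] determine [al] and its derivative there. The height of the foot point is
    [t ^+ 2 * F]. A unit normal [nu t] is [m *: (- gradient f w, 1)] in the frame, so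
    that [- dot (nu t) (t *: a t)] is [t ^+ 2 * m * (dot al E - F)]; here [m] is [1]
    at [0] with derivative [0], because [nu t] has length [1]. *)
Lemma frame_expansion :
  [/\ al 0 = invmx (1%:M - eta *: M) *m u,
      dal = invmx (1%:M - eta *: M) *m (s *: (M *m al 0) + eta *: quadratic_C f (al 0)),
      height (Q^T *m a 0) = 0,
      forall (v : R -> R) dv, is_derive (0 : R) (1 : R) v dv ->
        (\forall t \near (0 : R), t ^+ 2 * v t = height (Q^T *m (t *: a t))) ->
        v 0 = 2^-1 * dot (al 0) (M *m al 0) /\
        dv = dot (al 0) (M *m dal) + cubic_B f (al 0) &
      forall (v : R -> R) dv (nu : R -> 'cV[R]_3) dnu, is_derive (0 : R) (1 : R) v dv ->
        is_derive (0 : R) (1 : R) nu dnu -> Q^T *m nu 0 = vec3 0 1 ->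
        (\forall t \near (0 : R), enorm (nu t) = 1 /\
           forall q, tangent G (xs + t *: a t) q -> dot (nu t) q = 0) ->
        (\forall t \near (0 : R), t ^+ 2 * v t = - dot (nu t) (t *: a t)) ->
        v 0 = 2^-1 * dot (al 0) (M *m al 0) /\
        dv = dot (al 0) (M *m dal) + dot (al 0) (quadratic_C f (al 0)) - cubic_B f (al 0)].
Proof.
have [[oQ oW W0 nV] Cf f0 GX XG] := lg.
have /nbhs_ballP[r /= r0 rW] : nbhs (0 : vec) W by exact: open_nbhs_nbhs.
have CfB : Cinfty (ball (0 : vec) r) f by move=> k; apply: Ck_sub (Cf k).
have [F [E [fF dfE FE]]] := graph_blow_up r0 CfB f0 df0.
have {FE}[F0 dF E0 dE] := FE _ _ is_derive_al.
have near_chart := chart_near r0.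
have h0 (t : R) : height (Q^T *m (t *: a t)) = t * height (Q^T *m a t).
  by rewrite -scalemxAr heightZ.
have heightE : \forall t \near (0 : R), height (Q^T *m (t *: a t)) = t ^+ 2 * F t (al t).
  apply: filterS near_chart => t [Bt Wt e _].
  by rewrite -fF// -[t *: a t](addKr xs) addrC e chart_frame// height_vec3.
have zE (t : R) (b : vec) i : (t *: b) i 0 = t * b i 0 by rewrite mxE.
have eqs i : al 0 i 0 - (u i 0 + eta * (M *m al 0) i 0) = 0 /\
    dal i 0 - (s * (M *m al 0) i 0 + eta * (M *m dal + quadratic_C f (al 0)) i 0) = 0.
  pose phi (t : R) := al t i 0 - u i 0 + (t * (t * F t (al t)) - (eta + t * s)) * E i t (al t).
  have dphi : is_derive (0 : R) (1 : R) phi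
      (dal i 0 - (s * (M *m al 0) i 0 + eta * (M *m dal + quadratic_C f (al 0)) i 0)).
    have di := is_derive_coord i is_derive_al.
    have dtF := is_deriveM is_derive_t (is_deriveM is_derive_t dF).
    have dc := is_deriveB dtF (is_deriveD (is_derive_cst eta (0 : R) (1 : R))
      (is_deriveM is_derive_t (is_derive_cst s (0 : R) (1 : R)))).
    apply: is_derive_eq (is_deriveD (is_deriveB di (is_derive_cst (u i 0) (0 : R) (1 : R)))
      (is_deriveM dc (dE i))) _.
    have sc (b c : R) : b *: (c : R^o) = b * c by [].
    have key (p e q Fv dFv : R) : p - 0 + ((0 * (0 * Fv) - (eta + 0 * s)) * q
        + e * (0 * (0 * dFv + Fv * 1) + 0 * Fv * 1 - (0 + (0 * 0 + s * 1))))
        = p - (s * e + eta * q) by ring.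
    by rewrite !sc E0; exact: key.
  have [|h1 h2] := is_derive_punctured dphi (is_derive_cst (0 : R) (0 : R) (1 : R)).
    apply: filterS near_chart => t [Bt Wt e /(_ i) F0'] t0.
    apply: (mulfI t0); rewrite mulr0 -[RHS]F0' /foot_eq horizontal_vec3 height_vec3.
    rewrite dfE// fF// (zE t (al t)) (zE t u) /phi; ring.
  split=> //; apply: etrans h1; rewrite /phi E0. ring.
have subE (b c : vec) (k : R) i : (b - k *: c) i 0 = b i 0 - k * c i 0 by rewrite !mxE.
have addE (b c : vec) i : (b + c) i 0 = b i 0 + c i 0 by rewrite !mxE.
have K_inj (b c : vec) : (1%:M - eta *: M) *m b = c -> b = invmx (1%:M - eta *: M) *m c.
  by move=> <-; rewrite mulKmx.
have KE (b : vec) : (1%:M - eta *: M) *m b = b - eta *: (M *m b).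
  by rewrite mulmxBl mul1mx scalemxAl.
have value_deriv (v g : R -> R) dv dg : is_derive (0 : R) (1 : R) v dv ->
    is_derive (0 : R) (1 : R) g dg ->
    (\forall t \near (0 : R), t ^+ 2 * v t = t ^+ 2 * g t) -> v 0 = g 0 /\ dv = dg.
  move=> d1 d2 e; apply: is_derive_punctured d1 d2 _.
  by apply: filterS e => t h t0; apply: mulfI h; rewrite expf_neq0.
split.
- apply: K_inj; rewrite KE; apply/colP => i; have [/subr0_eq h _] := eqs i.
  by rewrite subE h addrK.
- apply: K_inj; rewrite KE; apply/colP => i; have [_ /subr0_eq h] := eqs i.
  rewrite subE h addE; move: (M *m al 0) (quadratic_C _ _) (M *m dal) => b c e.
  by rewrite !mxE; ring.
- have dh : is_derive (0 : R) (1 : R) (fun t => height (Q^T *m a t)) (height (Q^T *m da)).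
    exact: (linear_col_is_derive (@height_linear R) (is_derive_mulmx Q^T d)).
  have [|h1 _] := is_derive_punctured dh (is_deriveM is_derive_t dF); last first.
    by apply: etrans h1 _; exact: mul0r.
  apply: filterS heightE => t h t0; apply: (mulfI t0).
  by rewrite -h0 h expr2 -mulrA.
- move=> v dv dv' e; rewrite -F0; apply: value_deriv dv' dF _.
  by apply: filterS2 e heightE => t -> ->.
- move=> v dv nu dnu dv' dnu' nu0 nuT e.
  pose m (t : R) := height (Q^T *m nu t).
  have dm : is_derive (0 : R) (1 : R) m (height (Q^T *m dnu)).
    exact: (linear_col_is_derive (@height_linear R) (is_derive_mulmx Q^T dnu')).
  have m0 : m 0 = 1 by rewrite /m nu0 height_vec3.
  have dm0 : height (Q^T *m dnu) = 0.
    have [|_ h] := is_derive_punctured (is_derive_dot dnu' dnu') (is_derive_cst (1 : R) (0 : R) (1 : R)).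
      by apply: filterS nuT => t [n1 _] _; rewrite -enorm_sqr n1 expr1n.
    have : dot (nu 0) dnu = 0 by move: h; rewrite (dotC dnu); lra.
    rewrite -(dot_orthogonalV _ _ oQ) nu0 -{1}(vec3_split (Q^T *m dnu)) dot_vec3 dot0l add0r.
    by rewrite mul1r.
  pose g (t : R) := m t * (dot (al t) (\col_i E i t (al t)) - F t (al t)).
  have dE' : is_derive (0 : R) (1 : R) (fun t : R => \col_i E i t (al t))
      (M *m dal + quadratic_C f (al 0)).
    apply: is_derive_mx => i j; rewrite (ord1 j); under eq_fun do rewrite mxE.
    exact: dE.
  have dg := is_deriveM dm (is_deriveB (is_derive_dot is_derive_al dE') dF).
  have [|h1 h2] := value_deriv v g dv _ dv' dg.
    apply: filterS3 e near_chart nuT => t -> [Bt Wt ct _] [n1 nT].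
    have -> : nu t = m t *: (Q *m vec3 (- gradient f (t *: al t)) 1).
      apply: chart_tangent_orthogonal => // q; apply: nT; rewrite ct.
      exact: chart_tangentP lg Wt.
    have -> : t *: a t = Q *m vec3 (t *: al t) (f (t *: al t)).
      by rewrite -[LHS](addKr xs) ct /chart addKr.
    have -> : gradient f (t *: al t) = t *: (\col_i E i t (al t)).
      by apply/colP => i; rewrite [LHS]mxE dfE// zE mxE.
    rewrite dotZl dot_orthogonal// dot_vec3 mul1r dotNl dotZl dotZr fF// dotC /g; ring.
  have EM : \col_i E i 0 (al 0) = M *m al 0 by apply/colP => i; rewrite mxE E0.
  split; first by rewrite h1 /g m0 EM F0; field.
  have MT : M^T = M by apply/matrixP => i j; rewrite mxE; exact: (hessian_sym r0 CfB).
  rewrite h2 EM dm0 scaler0 addr0 m0 scale1r -{1}MT -dot_mulmxl dotC dotDr; ring.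
Qed.

End FrameExpansion.

(** * The expansion of the singular functions *)

Lemma is_derive_radial0 (R : realType) (r0 : R) (v : R -> 'cV[R]_2 -> R) (h : 'cV[R]_2) :
  0 < r0 -> Cinfty (blow_up_domain r0) (fun q : R * 'cV[R]_2 => v q.1 q.2 : R) ->
  exists dv, is_derive (0 : R) (1 : R) (fun t : R => v t h) dv.
Proof.
move=> r00 Cv; have [_ /(_ (1, 0))[dv _]] := Cv 1%N.
eexists; apply: (@is_derive_radial _ (fun q : R * 'cV[R]_2 => v q.1 q.2)).
by apply: dv; rewrite /blow_up_domain /= scale0r; exact: ballxx.
Qed.

Lemma Ck_dot (R : realType) (E : normedModType R) n (U : set E) k (u w : E -> 'cV[R]_n) :
  open U -> (forall i, Ck U k (fun y => u y i 0)) -> (forall i, Ck U k (fun y => w y i 0)) ->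
  Ck U k (fun y => dot (u y) (w y)).
Proof.
move=> oU Cu Cw; apply: (Ck_eq (f := fun y => \sum_i u y i 0 * w y i 0) oU).
  by move=> y _; rewrite dotE.
apply: (@Ck_sum _ _ _ _ _ _ (fun i y => u y i 0 * w y i 0)); first exact: oU.
by move=> i _; apply: CkM; [exact: oU|exact: Cu|exact: Cw].
Qed.

Section SurfaceBlowUp.
Context {R : realType} (G Om : set 'cV[R]_3) (xs : 'cV[R]_3) (z : R).
Local Notation vec := 'cV[R]_2.
Let n := outward_unit_normal Om xs.
Let x0 := normal_pt xs n z.
Let pr y := proj G (slice_pt Om xs z y).
Let nu y := outward_unit_normal Om (pr y).
Let P y := pr y - xs.
Hypotheses (smG : smooth_surface_bounding G Om) (Gxs : G xs)
  (nz : dot n (e_z R) != 0) (lt : ((dist G x0)%:E < reach G)%E)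
  (projx0 : proj G x0 = xs).

(** The numerators [dot n (P y)] and [- dot (nu y) (P y)] vanish to second order at
    [0]: [P 0] is [0], and the derivatives of [P] at [0] are tangent to the surface,
    hence orthogonal to [n = nu 0]. *)
Lemma surface_blow_up : exists (r0 : R) (A : R -> vec -> 'cV[R]_3) (vC vL : R -> vec -> R),
  let B := ball (0 : vec) r0 in let D := blow_up_domain r0 in
  [/\ [/\ 0 < r0,
        forall k, Cinfty B (fun y => nu y k 0),
        forall y, B y -> is_closest G (slice_pt Om xs z y) (pr y) /\
          is_outward_unit_normal Om (pr y) (nu y) &
        forall y, B y -> P y = 0 -> y = 0],
      [/\ forall k, Cinfty D (fun q : R * vec => A q.1 q.2 k 0 : R),
        forall (t : R) (h : vec), B (t *: h) -> P (t *: h) = t *: A t h &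
        forall h, A 0 h = 0 -> h = 0],
      Cinfty D (fun q : R * vec => vC q.1 q.2 : R) /\
        forall (t : R) (h : vec), B (t *: h) -> dot n (P (t *: h)) = t ^+ 2 * vC t h &
      Cinfty D (fun q : R * vec => vL q.1 q.2 : R) /\
        forall (t : R) (h : vec), B (t *: h) ->
          - dot (nu (t *: h)) (P (t *: h)) = t ^+ 2 * vL t h].
Proof.
have [r0 r00 [CP Cnu cl inj imm]] := smooth_projection smG Gxs nz lt projx0.
have {}CP : forall k, Cinfty (ball (0 : vec) r0) (fun y => P y k 0) := CP.
have {}Cnu : forall k, Cinfty (ball (0 : vec) r0) (fun y => nu y k 0) := Cnu.
have oB : open (ball (0 : vec) r0) by exact: ball_open.
have B0 : ball (0 : vec) r0 0 by exact: ballxx.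
have pr0 : pr 0 = xs by exact: slice_projection0.
have P0 : P 0 = 0 by rewrite /P pr0 subrr.
have nP : is_outward_unit_normal Om xs n.
  by have [_] := cl _ B0; rewrite -/(pr 0) pr0.
have nu0 : nu 0 = n by rewrite /nu pr0.
have dP v : is_derive (0 : vec) v P (\col_k 'D_v (fun y => P y k 0) 0).
  apply: is_derive_mx => k j; rewrite (ord1 j) mxE; apply/derivableP.
  by have [_ /(_ v)[dk _]] := CP k 1%N; exact: dk.
have dnu v : is_derive (0 : vec) v nu (\col_k 'D_v (fun y => nu y k 0) 0).
  apply: is_derive_mx => k j; rewrite (ord1 j) mxE; apply/derivableP.
  by have [_ /(_ v)[dk _]] := Cnu k 1%N; exact: dk.
have n_dP v : dot n (\col_k 'D_v (fun y => P y k 0) 0) = 0.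
  have [_ nT _] := nP; apply: nT.
  have [_ _ GE _] := smG; rewrite -GE.
  exists (fun t : R => P (t *: v + 0) + xs); split.
  - by rewrite scale0r addr0 P0 add0r.
  - have nB : \forall t \near (0 : R), ball (0 : vec) r0 (t *: v + 0).
      exact: (@cvg_line _ _ 0 v _ (open_nbhs_nbhs (conj oB B0))).
    by apply: filterS nB => t Bt; rewrite /P subrK; have [[]] := cl _ Bt.
  - have d : is_derive ((0 : R) *: v + 0) v P (\col_k 'D_v (fun y => P y k 0) 0).
      by rewrite scale0r addr0.
    by have := is_deriveD (is_derive_line d) (is_derive_cst xs (0 : R) (1 : R)); rewrite addr0.
have CPdot (w : vec -> 'cV[R]_3) : (forall k, Cinfty (ball (0 : vec) r0) (fun y => w y k 0)) ->
    Cinfty (ball (0 : vec) r0) (fun y => dot (w y) (P y)).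
  by move=> Cw k; apply: Ck_dot oB _ _ => i; [exact: Cw|exact: CP].
have /choice[A hA] k : exists A : R -> vec -> R,
    [/\ Cinfty (blow_up_domain r0) (fun q : R * vec => A q.1 q.2 : R),
      forall (t : R) (h : vec), ball (0 : vec) r0 (t *: h) -> P (t *: h) k 0 = t * A t h &
      forall h : vec, A 0 h = 'D_h (fun y => P y k 0) 0].
  have [|v Cv [vE v0]] := blow_up1 r00 (CP k).
    by rewrite P0 mxE.
  by exists v; split.
have [||v|vC CvC vCE] := @blow_up2 _ _ r00 (fun y => dot n (P y)).
- by apply: CPdot => k' k''; exact: Ck_cst.
- by rewrite P0 dot0r.
- have [_ ->] := is_derive_dot (is_derive_cst n (0 : vec) v) (dP v).
  by rewrite dot0l add0r; exact: n_dP.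
have [||v|vL CvL vLE] := @blow_up2 _ _ r00 (fun y => - dot (nu y) (P y)).
- have CnP := CPdot _ Cnu.
  by move=> k; apply: CkN; [exact: oB|exact: CnP].
- by rewrite P0 dot0r oppr0.
- have [_ ->] := is_deriveN (is_derive_dot (dnu v) (dP v)).
  by rewrite P0 dot0r add0r nu0 n_dP oppr0.
exists r0, (fun t h => \col_k A k t h), vC, vL; split.
- split; [exact: r00|exact: Cnu|exact: cl|].
  by move=> y By /subr0_eq; exact: inj.
- split=> [k k'|t h Bt|h Ah].
  + have [CA _ _] := hA k.
    rewrite (_ : (fun q : R * vec => _) = fun q : R * vec => A k q.1 q.2).
      exact: CA.
    by rewrite funeqE => q; rewrite mxE.
  + by apply/colP => k; have [_ AE _] := hA k; rewrite (AE _ _ Bt) [RHS]mxE mxE.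
  + apply: imm => k; have [_ _ A0] := hA k; apply: etrans (esym (A0 h)) _.
    by have /colP/(_ k) := Ah; rewrite !mxE.
- by split; [exact: CvC|exact: vCE].
- by split; [exact: CvL|exact: vLE].
Qed.

End SurfaceBlowUp.

Lemma frame_normal (R : realType) (t1 t2 n : 'cV[R]_3) :
  frame t1 t2 n *m vec3 0 1 = n.
Proof.
have e := @mul_row_col R 3 2 1 1 (row_mx t1 t2) n 0 1%:M.
by rewrite mulmx0 add0r mulmx1 in e.
Qed.

Lemma transpose_horizontal (R : realType) (Q : 'M[R]_3) (h : 'cV[R]_2) :
  Q^T *m vec3 h 0 =
  vec3 (@ulsubmx R 2 1 2 1 Q^T *m h) (dot ((@dlsubmx R 2 1 2 1 Q^T)^T) h).
Proof.
have e := @mul_block_col R 2 1 2 1 1 (@ulsubmx R 2 1 2 1 Q^T)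
  (@ursubmx R 2 1 2 1 Q^T) (@dlsubmx R 2 1 2 1 Q^T) (@drsubmx R 2 1 2 1 Q^T) h 0.
rewrite -[X in X *m _](@submxK R 2 1 2 1 Q^T) /vec3.
have -> : (0 : R)%:M = 0 :> 'cV[R]_1 by rewrite raddf0.
apply: etrans e _; rewrite !mulmx0 !addr0; congr col_mx.
by apply/matrixP => i j; rewrite !ord1 [RHS]mxE eqxx mulr1n /dot trmxK.
Qed.

Section FrameCoefficients.
Context {R : realType} (G Om : set 'cV[R]_3) (xs : 'cV[R]_3) (z : R).
Local Notation vec := 'cV[R]_2.
Let n := outward_unit_normal Om xs.
Let x0 := normal_pt xs n z.
Let eta := signed_dist G Om x0.
Let pr y := proj G (slice_pt Om xs z y).
Let nu y := outward_unit_normal Om (pr y).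
Let P y := pr y - xs.
Hypotheses (smG : smooth_surface_bounding G Om) (Gxs : G xs)
  (nz : dot n (e_z R) != 0) (lt : ((dist G x0)%:E < reach G)%E)
  (projx0 : proj G x0 = xs).
Variables (t1 t2 : 'cV[R]_3) (k1 k2 : R) (f : vec -> R).
Let Q := frame t1 t2 n.
Hypotheses (oQ : orthogonal_mx Q) (rep : local_representation G xs Q k1 k2 f).
Variables (r0 : R) (a : R -> 'cV[R]_3) (vC vL : R -> R) (h : vec)
  (da : 'cV[R]_3) (dC dL : R) (dnu : 'cV[R]_3).
Hypotheses (r00 : 0 < r0)
  (cl : forall y, ball (0 : vec) r0 y -> is_closest G (slice_pt Om xs z y) (pr y) /\
          is_outward_unit_normal Om (pr y) (nu y))
  (d_a : is_derive (0 : R) (1 : R) a da) (d_C : is_derive (0 : R) (1 : R) vC dC)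
  (d_L : is_derive (0 : R) (1 : R) vL dL)
  (d_nu : is_derive (0 : R) (1 : R) (fun t : R => nu (t *: h)) dnu)
  (PA : forall t : R, ball (0 : vec) r0 (t *: h) -> P (t *: h) = t *: a t)
  (PC : forall t : R, ball (0 : vec) r0 (t *: h) -> dot n (P (t *: h)) = t ^+ 2 * vC t)
  (PL : forall t : R, ball (0 : vec) r0 (t *: h) ->
    - dot (nu (t *: h)) (P (t *: h)) = t ^+ 2 * vL t).

(** [frame_expansion] applied in the principal frame: a horizontal displacement [h]
    has the components [A *m h] and [dot d h] there, and [foot_hess_unit] yields the
    invertibility of [1 - eta M]. *)
Lemma blow_up_coefficients :
  [/\ enorm (a 0) = psi0 Q f eta h, dot (a 0) da = dot (chi0 Q f eta h) (chi1 Q f eta h),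
      vC 0 = xi0 Q f eta h /\ dC = xi1 Q f eta h &
      vL 0 = xi0 Q f eta h /\ dL = xi1_tilde Q f eta h].
Proof.
have cG : compact G := boundary_compact smG; have G0 : G !=set0 by exists xs.
have B0 : ball (0 : vec) r0 0 by exact: ballxx.
have pr0 : pr 0 = xs by exact: slice_projection0.
have nP : is_outward_unit_normal Om xs n.
  by have [_] := cl B0; rewrite /nu pr0.
have clo : is_closest G x0 xs by rewrite -projx0; exact: proj_closest.
have [c c0 growth] := closest_quadratic_growth cG G0 clo lt.
have etaE : eta = (z - height xs) / dot n (e_z R) by exact: signed_dist_normal.
have [U [[oU U0 Cf] nG f0 df0 Hf]] := rep.
have [W [V [_ lg]]] := local_graph_exists oQ oU U0 Cf f0 nG.
have [[_ oW W0 _] CfW _ _ _] := lg.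
have Qn : Q^T *m n = vec3 0 1 by rewrite -{1}(frame_normal t1 t2 n) orthogonalK.
have Qx0 : Q^T *m (x0 - xs) = vec3 0 eta.
  rewrite /x0 /normal_pt addrC addKr -etaE -scalemxAr Qn -vec3Z.
  by rewrite scaler0 mulr1.
have uK : 1%:M - eta *: hessian f 0 \in unitmx.
  have := foot_hess_unit lg clo c0 growth; rewrite Qx0.
  congr (_ \in unitmx); apply/matrixP => i j; rewrite !mxE f0 height_vec3.
  have /colP/(_ i) := df0; rewrite !mxE => ->.
  by rewrite mulr0 addr0 sub0r mulNr.
have MT : (hessian f 0)^T = hessian f 0 by rewrite Hf tr_diag_mx.
have nB : \forall t \near (0 : R), ball (0 : vec) r0 (t *: h).
  have n0 : \forall t \near (0 : R), ball (0 : vec) r0 (t *: h + 0).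
    have oB : open (ball (0 : vec) r0) by exact: ball_open.
    exact: (@cvg_line _ _ 0 h _ (open_nbhs_nbhs (conj oB B0))).
  by apply: filterS n0 => t; rewrite addr0.
have prE : \forall t \near (0 : R), pr (t *: h) = xs + t *: a t.
  have e (t : R) : ball (0 : vec) r0 (t *: h) -> pr (t *: h) = xs + t *: a t.
    by move=> Bt; rewrite -PA// /P addrC subrK.
  by apply: filterS nB => t; exact: e.
have ncl : \forall t \near (0 : R), is_closest G (slice_pt Om xs z (t *: h)) (xs + t *: a t).
  have e (t : R) : ball (0 : vec) r0 (t *: h) -> pr (t *: h) = xs + t *: a t ->
    is_closest G (slice_pt Om xs z (t *: h)) (xs + t *: a t).
    by move=> Bt <-; have [] := cl Bt.
  by apply: filterS2 nB prE => t; exact: e.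
have xE (t : R) : Q^T *m (slice_pt Om xs z (t *: h) - xs) =
    vec3 (t *: (@ulsubmx R 2 1 2 1 Q^T *m h))
      (eta + t * dot ((@dlsubmx R 2 1 2 1 Q^T)^T) h).
  rewrite slice_ptE// addrAC mulmxDr Qx0 -{1}(mulr0 t) vec3Z -scalemxAr.
  by rewrite transpose_horizontal -vec3Z -vec3D add0r.
have [e0 e1 e2 eC eL] := frame_expansion lg df0 uK d_a ncl xE.
have E0 : horizontal (Q^T *m a 0) = chi0 Q f eta h by rewrite e0 chi0E.
have E1 : horizontal (Q^T *m da) = chi1 Q f eta h.
  by rewrite e1 (chi1E _ _ uK) E0 chi0E.
have dotE' (b : 'cV[R]_3) : dot (a 0) b = dot (chi0 Q f eta h) (horizontal (Q^T *m b)).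
  rewrite -(dot_orthogonalV _ _ oQ) -(vec3_split (Q^T *m a 0)) -(vec3_split (Q^T *m b)).
  by rewrite dot_vec3 e2 mul0r addr0 E0 vec3_split.
have nC : \forall t \near (0 : R), t ^+ 2 * vC t = height (Q^T *m (t *: a t)).
  have e (t : R) : ball (0 : vec) r0 (t *: h) -> t ^+ 2 * vC t = height (Q^T *m (t *: a t)).
    by move=> Bt; rewrite -PC// PA// -dot_e_z dotC -(dot_orthogonalV _ _ oQ) Qn.
  by apply: filterS nB => t; exact: e.
have nL : \forall t \near (0 : R), t ^+ 2 * vL t = - dot (nu (t *: h)) (t *: a t).
  have e (t : R) : ball (0 : vec) r0 (t *: h) ->
    t ^+ 2 * vL t = - dot (nu (t *: h)) (t *: a t) by move=> Bt; rewrite -PL// PA.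
  by apply: filterS nB => t; exact: e.
have nnu : \forall t \near (0 : R), enorm (nu (t *: h)) = 1 /\
    forall q, tangent G (xs + t *: a t) q -> dot (nu (t *: h)) q = 0.
  have e (t : R) : ball (0 : vec) r0 (t *: h) -> pr (t *: h) = xs + t *: a t ->
      enorm (nu (t *: h)) = 1 /\
      forall q, tangent G (xs + t *: a t) q -> dot (nu (t *: h)) q = 0.
    move=> Bt <-; have [_ [n1 nT _]] := cl Bt; split=> // q Tq; apply: nT.
    by have [_ _ <- _] := smG.
  by apply: filterS2 nB prE => t; exact: e.
have nu0 : Q^T *m nu ((0 : R) *: h) = vec3 0 1 by rewrite scale0r /nu pr0 Qn.
have {eC}[C0 C1] := eC vC dC d_C nC.
have {eL}[L0 L1] := eL vL dL (fun t : R => nu (t *: h)) dnu d_L d_nu nu0 nnu nL.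
split.
- by rewrite /psi0 /enorm dotE' E0.
- by rewrite dotE' E1.
- by rewrite C0 C1 E0 E1 (xi0E _ _ _ MT) (xi1E _ _ MT uK) chi0E.
- by rewrite L0 L1 E0 E1 (xi0E _ _ _ MT) (xi1_tildeE _ _ MT uK) chi0E.
Qed.

End FrameCoefficients.

Theorem theorem3p2 (R : realType) (G Om : set 'cV[R]_3) (eps : R)
    (xs : 'cV[R]_3) (z : R) :
  smooth_surface_bounding G Om ->
  (0 < reach G)%E ->
  0 < eps -> (eps%:E < reach G)%E ->
  G xs ->
  let n := outward_unit_normal Om xs in
  dot n (e_z R) != 0 ->
  tube G Om eps (normal_pt xs n z) ->
  proj G (normal_pt xs n z) = xs ->
  exists (r : R) (l_SL l_DLC l_DL : R -> 'cV[R]_2 -> R),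
  [/\ 0 < r,
      [/\ polar_form r (s_SL G Om xs z) l_SL,
          polar_form r (s_DLC G Om xs z) l_DLC &
          polar_form r (s_DL G Om xs z) l_DL],
      [/\ two_term_expansion (s_SL G Om xs z) l_SL,
          two_term_expansion (s_DLC G Om xs z) l_DLC &
          two_term_expansion (s_DL G Om xs z) l_DL] &
      forall (t1 t2 : 'cV[R]_3) (k1 k2 : R) (f : 'cV[R]_2 -> R),
      let Q := frame t1 t2 n in
      orthogonal_mx Q ->
      local_representation G xs Q k1 k2 f ->
      let eta := signed_dist G Om (normal_pt xs n z) in
      let psi0 := psi0 Q f eta in
      let psi1 := psi1 Q f eta in
      let xi0 := xi0 Q f eta in
      let xi1 := xi1 Q f eta in
      let xi1_tilde := xi1_tilde Q f eta in
      forall y : 'cV[R]_2, y != 0 ->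
      let h := unit_dir y in
      [/\ term0 l_SL y = (4 * pi)^-1 * (enorm y)^-1 * (psi0 h)^-1
            /\ term1 l_SL y = - (4 * pi)^-1 * (psi1 h / psi0 h ^+ 2),
          term0 l_DLC y = (4 * pi)^-1 * (enorm y)^-1 * (xi0 h / psi0 h ^+ 3)
            /\ term1 l_DLC y = (4 * pi)^-1 *
                 (- 3 * (xi0 h * psi1 h / psi0 h ^+ 4) + xi1 h / psi0 h ^+ 3) &
          term0 l_DL y = term0 l_DLC y
            /\ term1 l_DL y = (4 * pi)^-1 *
                 (- 3 * (xi0 h * psi1 h / psi0 h ^+ 4)
                  + xi1_tilde h / psi0 h ^+ 3)]].
Proof.
move=> smG _ _ eps_reach Gxs n nz tb projx0.
have lt : ((dist G (normal_pt xs n z))%:E < reach G)%E.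
  apply: le_lt_trans eps_reach; rewrite lee_fin; apply: le_trans tb.
  rewrite /signed_dist; case: ifP => _; last exact: ler_norm.
  by rewrite normrN; exact: ler_norm.
have [r0 [A [vC [vL [[r00 Cnu cl inj] [CA PA A_inj] [CC PC] [CL PL]]]]]] :=
  surface_blow_up smG Gxs nz lt projx0.
pose c : R := (4 * pi)^-1.
have [pfS teS] := inv_norm_expansion r00 CA PA inj A_inj
  (s := s_SL G Om xs z) (c := c) (fun y By => erefl).
have [pfC teC] := inv_norm_cube_expansion r00 CA PA inj A_inj CC PC
  (s := s_DLC G Om xs z) (c := c) (fun y By => erefl).
have sL y : ball (0 : 'cV[R]_2) r0 y -> s_DL G Om xs z y = c *
    (- dot (outward_unit_normal Om (proj G (slice_pt Om xs z y))) (proj G (slice_pt Om xs z y) - xs)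
      / enorm (proj G (slice_pt Om xs z y) - xs) ^+ 3).
  by move=> _; rewrite mulNr mulrN -mulNr.
have [pfL teL] := inv_norm_cube_expansion r00 CA PA inj A_inj CL PL sL.
exists r0, (fun rho h => c * (enorm (A rho h))^-1),
  (fun rho h => c * (vC rho h / enorm (A rho h) ^+ 3)),
  (fun rho h => c * (vL rho h / enorm (A rho h) ^+ 3)).
split; [exact: r00|by split; [exact: pfS|exact: pfC|exact: pfL]|
  by split; [exact: teS|exact: teC|exact: teL]|].
move=> t1 t2 k1 k2 f Q oQ rep eta p0 p1 x0 x1 x1t y y0 h.
have h0 : h != 0 by rewrite -enorm_eq0 enorm_unit_dir// oner_neq0.
have A0 : A 0 h != 0 by apply: contra h0 => /eqP/A_inj ->.
have [dC d_C] := is_derive_radial0 h r00 CC.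
have [dL d_L] := is_derive_radial0 h r00 CL.
have /choice[da hda] k := is_derive_radial0 (v := fun t h => A t h k 0) h r00 (CA k).
have d_a : is_derive (0 : R) (1 : R) (A ^~ h) (\col_k da k).
  by apply: is_derive_mx => k j; rewrite (ord1 j) mxE; exact: hda.
pose nu y := outward_unit_normal Om (proj G (slice_pt Om xs z y)).
have [dnu d_nu] : exists dnu, is_derive (0 : R) (1 : R) (fun t : R => nu (t *: h)) dnu.
  have /choice[dn hdn] k := is_derive_radial0 (v := fun t h => nu (t *: h) k 0) h r00
    (fun k' => Ck_blow_up (Cnu k k')).
  exists (\col_k dn k).
  by apply: is_derive_mx => k j; rewrite (ord1 j) mxE; exact: hdn.
have [e0 e1 [C0 C1] [L0 L1]] := blow_up_coefficients smG Gxs nz lt projx0 oQ rep r00 cl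
  d_a d_C d_L d_nu (PA ^~ h) (PC ^~ h) (PL ^~ h).
have p00 : p0 h != 0 by rewrite /p0 -e0 enorm_eq0.
have p1E : p1 h = dot (A 0 h) (\col_k da k) / p0 h by rewrite e1.
split; split.
- rewrite /term0 -/h e0 -/(p0 h); rewrite -/c; ring.
- rewrite /term1 -/h (derive_inv_enorm c d_a A0) e0 -/(p0 h) -/c p1E; field.
  exact: p00.
- rewrite /term0 -/h e0 C0 -/(p0 h) -/(x0 h) -/c; ring.
- rewrite /term1 -/h (derive_quotient_enorm c d_a d_C A0) e0 C0 C1 -/(p0 h) -/(x0 h) -/(x1 h).
  rewrite -/c p1E; field.
  exact: p00.
- by rewrite /term0 -/h C0 L0.
- rewrite /term1 -/h (derive_quotient_enorm c d_a d_L A0) e0 L0 L1 -/(p0 h) -/(x0 h) -/(x1t h).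
  rewrite -/c p1E; field.
  exact: p00.
Qed.
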